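(* Let $d,\nu\ge 1$. (Part 1) Let $X(p)=(X_1(p),\dots,X_d(p))$, $p\in\mathbb{Z}^\nu$, be a $d$-dimensional (real valued) stationary random field with expectation zero, and let $r_{j,j'}(p)=EX_j(0)X_{j'}(p)$, $1\le j,j'\le d$, $p\in\mathbb{Z}^\nu$. Then for all $1\le j,j'\le d$ there exists a complex measure $G_{j,j'}$ with finite total variation on the torus $[-\pi,\pi)^\nu$ such that $$r_{j,j'}(p)=\int_{[-\pi,\pi)^\nu}e^{i(p,x)}\,G_{j,j'}(dx)\qquad\text{for all }p\in\mathbb{Z}^\nu .$$ For every pair $(j,j')$ the function $r_{j,j'}(p)$, $p\in\mathbb{Z}^\nu$, uniquely determines the complex measure $G_{j,j'}$ with finite total variation. The matrix $(G_{j,j'})$ is Hermitian, i.e. $G_{j',j}(A)=\overline{G_{j,j'}(A)}$, and the measures are even, i.e. $G_{j,j'}(-A)=\overline{G_{j,j'}(A)}$, for all $1\le j,j'\le d$ and all measurable $A\subset[-\pi,\pi)^\nu$. Moreover, if $\mu$ is any finite measure on $[-\pi,\pi)^\nu$ such that all the complex measures $G_{j,j'}$ are absolutely continuous with respect to $\mu$ (such measures $\mu$ exist), and $g_{j,j'}(x)=\frac{dG_{j,j'}}{d\mu}(x)$, then the matrix $(g_{j,j'}(x))_{1\le j,j'\le d}$ is positive semidefinite for $\mu$-almost all $x\in[-\pi,\pi)^\nu$. (Part 2) Conversely, let $G_{j,j'}$, $1\le j,j'\le d$, be complex measures with finite total variation on $[-\pi,\pi)^\nu$ such that $(G_{j,j'})_{1\le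 j,j'\le d}$ is a positive semidefinite matrix valued, even measure on the torus. Then there exists a $d$-dimensional stationary Gaussian random field $X(p)=(X_1(p),\dots,X_d(p))$, $p\in\mathbb{Z}^\nu$, with expectation $EX_j(p)=0$ and covariance $EX_j(p)X_{j'}(q)=r_{j,j'}(p-q)$ for all $1\le j,j'\le d$ and $p,q\in\mathbb{Z}^\nu$, where $r_{j,j'}(p)=\int_{[-\pi,\pi)^\nu}e^{i(p,x)}G_{j,j'}(dx)$.
   Context: A $d$-dimensional real valued random field $X(p)=(X_1(p),\dots,X_d(p))$, $p\in\mathbb{Z}^\nu$ (with finite second moments), is stationary if for every $m\in\mathbb{Z}^\nu$ the field $X(p+m)$, $p\in\mathbb{Z}^\nu$, has the same finite dimensional distributions as $X(p)$, $p\in\mathbb{Z}^\nu$. It is Gaussian if every finite collection $(X(p_1),\dots,X(p_k))$ is a Gaussian random vector. The torus $[-\pi,\pi)^\nu$ is obtained by identifying coordinates modulo $2\pi$ (so $\pi$ is identified with $-\pi$); $-A=\{-x: x\in A\}$ is understood on the torus. Measurable means Borel measurable. A complex measure has finite total variation if its real and imaginary parts are both differences of two finite measures. Definition. Let $G_{j,j'}$, $1\le j,j'\le d$, be complex measures with finite total variation on the Borel sets of $[-\pi,\pi)^\nu$. The matrix valued measure $(G_{j,j'})$ is called positive semidefinite if there exists a finite positive measure $\mu$ on $[-\pi,\pi)^\nu$ such that all $G_{j,j'}$ are absolutely continuous with respect to $\mu$ and the matrix of Radon--Nikodym derivatives $(g_{j,j'}(x))$, $g_{j,j'}=\frac{dG_{j,j'}}{d\mu}$,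 is a positive semidefinite (Hermitian) matrix for $\mu$-almost all $x$. It is called even if $G_{j,j'}(-A)=\overline{G_{j,j'}(A)}$ for all measurable $A\subset[-\pi,\pi)^\nu$ and $1\le j,j'\le d$. *)

(* Defs.v *)
From HB Require Import structures.
From mathcomp Require Import all_boot all_order all_algebra.
From mathcomp Require Import all_classical all_reals all_analysis.
From mathcomp Require Import complex.

Set Implicit Arguments.
Unset Strict Implicit.
Unset Printing Implicit Defensive.

Import Order.TTheory GRing.Theory Num.Theory.
Import numFieldNormedType.Exports.

Local Open Scope classical_set_scope.
Local Open Scope ring_scope.
Local Open Scope complex_scope.

Section torus.
Context (R : realType).

Definition arc_sub := {x : R | - pi <= x < pi}.

Lemma arc_base_subproof : - pi <= (- pi : R) < pi.
Proof. by rewrite lexx /= gtrN// pi_gt0. Qed.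

Definition arc_base : arc_sub := @exist R _ (- pi) arc_base_subproof.

HB.instance Definition _ := Choice.on arc_sub.
HB.instance Definition _ := isPointed.Build arc_sub arc_base.

Definition arc_val (x : arc_sub) : R := \val x.

(* The sigma-algebra is the trace on [-pi, pi[ of the Borel sets of R; it is
   also the Borel sigma-algebra of the circle R / 2 pi Z. *)
Definition arc := g_sigma_algebra_preimageType arc_val.

(* - x modulo 2 pi: the only x in [-pi, pi[ with - x outside [-pi, pi[ is -pi,
   and there the default value of [insubd] is -pi, identified with pi. *)
Definition arc_opp (x : arc) : arc := insubd arc_base (- arc_val x).

(* Tuples carry the product sigma-algebra. *)
Definition torus (nu : nat) := nu.-tuple arc.

Definition torus_opp nu (x : torus nu) : torus nu :=
  [tuple arc_opp (tnth x k) | k < nu].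

Definition torus_char nu (p : 'rV[int]_nu) (x : torus nu) : R[i] :=
  let t := \sum_(k < nu) (p 0 k)%:~R * arc_val (tnth x k) in
  cos t +i* sin t.

End torus.

Section charge_integral.
Context d (T : measurableType d) (R : realType).
Variable nu : {charge set T -> \bar R}.

Definition hahn_pos : set T := sval (cid (Hahn_decomposition nu)).

Definition hahn_neg : set T := sval (cid (svalP (cid (Hahn_decomposition nu)))).

Lemma hahn_posneg : hahn_decomposition nu hahn_pos hahn_neg.
Proof. exact: svalP (cid (svalP (cid (Hahn_decomposition nu)))). Qed.

(* Integral against the Jordan decomposition; by uniqueness of the latter it
   does not depend on the chosen Hahn decomposition. *)
Definition charge_integral (f : T -> R) : R :=
  \int[jordan_pos hahn_posneg]_x f x - \int[jordan_neg hahn_posneg]_x f x.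

End charge_integral.

Section complex_measure.
Context d (T : measurableType d) (R : realType).

Record complex_measure := ComplexMeasure {
  cm_re : {charge set T -> \bar R} ;
  cm_im : {charge set T -> \bar R} }.

Definition cm_val (G : complex_measure) (A : set T) : R[i] :=
  fine (cm_re G A) +i* fine (cm_im G A).

Definition finite_measure_difference (nu : {charge set T -> \bar R}) :=
  exists m1 m2 : {finite_measure set T -> \bar R},
    forall A, measurable A -> nu A = (m1 A - m2 A)%E.

(* Charges are finite valued, so this holds for every complex_measure by the
   Jordan decomposition. *)
Definition finite_total_variation (G : complex_measure) :=
  finite_measure_difference (cm_re G) /\ finite_measure_difference (cm_im G).

Definition complex_integral (G : complex_measure) (f : T -> R[i]) : R[i] :=
  (charge_integral (cm_re G) (fun x => complex.Re (f x)) -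
   charge_integral (cm_im G) (fun x => complex.Im (f x))) +i*
  (charge_integral (cm_re G) (fun x => complex.Im (f x)) +
   charge_integral (cm_im G) (fun x => complex.Re (f x))).

Definition cm_dominated (G : complex_measure)
    (mu : {finite_measure set T -> \bar R}) :=
  (cm_re G `<< mu) /\ (cm_im G `<< mu).

Definition cm_RN (G : complex_measure)
    (mu : {finite_measure set T -> \bar R}) (x : T) : R[i] :=
  fine (Radon_Nikodym (cm_re G) mu x) +i* fine (Radon_Nikodym (cm_im G) mu x).

End complex_measure.

Coercion cm_val : complex_measure >-> Funclass.

Definition psdmx (C : numClosedFieldType) (n : nat) (A : 'M[C]_n) :=
  (A \is hermsymmx) /\
  (forall v : 'rV[C]_n, 0 <= (v *m A *m (map_mx Num.conj v)^T) 0 0).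

Section matrix_measure.
Context d (T : measurableType d) (R : realType) (n : nat).
Implicit Type G : 'I_n -> 'I_n -> complex_measure T R.

Definition RN_matrix G (mu : {finite_measure set T -> \bar R}) (x : T) :
    'M[R[i]]_n :=
  \matrix_(j, j') cm_RN (G j j') mu x.

Definition positive_semidefinite_measure G :=
  exists mu : {finite_measure set T -> \bar R},
    (forall j j', cm_dominated (G j j') mu) /\
    {ae mu, forall x, psdmx (RN_matrix G mu x)}.

Definition hermitian_measure G :=
  forall j j' (A : set T), measurable A -> G j' j A = (G j j' A)^*.

End matrix_measure.

Definition even_measure (R : realType) (nu n : nat)
    (G : 'I_n -> 'I_n -> complex_measure (torus R nu) R) :=
  forall j j' (A : set (torus R nu)), measurable A ->
    G j j' (@torus_opp R nu @` A) = (G j j' A)^*.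

Section random_field.
Context dO (Omega : measurableType dO) (R : realType) (P : probability Omega R).

(* Dirac masses are the Gaussian laws of variance zero; [normal_prob m 0] is
   not a Dirac mass in the library. *)
Definition gaussian_rv (Y : Omega -> R) :=
  (exists m s : R, 0 < s /\
     forall B : set R, measurable B -> P (Y @^-1` B) = normal_prob m s B) \/
  (exists m : R,
     forall B : set R, measurable B -> P (Y @^-1` B) = \d_m B).

Definition gaussian_vector (I : finType) (Y : I -> Omega -> R) :=
  forall a : I -> R, gaussian_rv (fun w => \sum_(i : I) a i * Y i w).

Context (nu n : nat).
Implicit Type X : 'rV[int]_nu -> 'I_n -> {RV P >-> R}.

Definition finite_second_moments X :=
  forall p j, (X p j : Omega -> R) \in Lfun P 2%:E.

Definition sample X k (p : k.-tuple 'rV[int]_nu) (w : Omega) :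
    k.-tuple (n.-tuple R) :=
  [tuple [tuple X (tnth p i) j w | j < n] | i < k].

Definition stationary X :=
  forall (m : 'rV[int]_nu) k (p : k.-tuple 'rV[int]_nu)
         (B : set (k.-tuple (n.-tuple R))), measurable B ->
    P (sample X [tuple tnth p i + m | i < k] @^-1` B) = P (sample X p @^-1` B).

Definition gaussian_field X :=
  forall k (p : k.-tuple 'rV[int]_nu),
    gaussian_vector (fun (ij : 'I_k * 'I_n) w => X (tnth p ij.1) ij.2 w).

End random_field.

(* Main.v *)
Require Import Defs.
From HB Require Import structures.
From mathcomp Require Import all_boot all_order all_algebra.
From mathcomp Require Import all_classical all_reals all_analysis.
From mathcomp Require Import complex zify ring lra measurable_realfun.

(* [arc] would otherwise be the function on sequences of path.v. *)
Import Defs.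

Set Implicit Arguments.
Unset Strict Implicit.
Unset Printing Implicit Defensive.

Import Order.TTheory GRing.Theory Num.Theory.
Import numFieldNormedType.Exports.

Local Open Scope classical_set_scope.
Local Open Scope ring_scope.
Local Open Scope complex_scope.

(* Part 1. For complex weights v the function sum_jj' v_j conj(v_j') r_jj' is
   positive definite on Z^nu, so by Herglotz's theorem it is the Fourier
   transform of a finite measure mu_v; G_jj' is obtained from the mu_v by
   polarization.  The measures in Herglotz's theorem are limits of discrete
   Fejer sums on dyadic grids of the torus: coding the grid points by their
   binary digits turns a limit into a choice, along an ultrafilter, of
   consistent weights of finite bit strings, and such weights are realised by
   successive subdivision of an interval.  The Hermitian and even symmetries
   follow from uniqueness of the Fourier coefficients, and
   sum_jj' v_j conj(v_j') g_jj' >= 0 almost everywhere simultaneously for all v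
   in a countable dense set, as it is the density of mu_v.

   Uniqueness.  Two finite measures that integrate equally the members of a
   class A of bounded functions, products of which are sums of members of A,
   agree on the sigma-algebra generated by A: the bounded f such that
   multiplication by f preserves equality of the two integrals form an algebra
   closed under bounded pointwise limits, hence under exponentials, and
   1_{f < c} = lim exp(- n exp(n (f - c))).

   Part 2. Bit coding also yields a measurable map of [0, 1[ into [0, 1[ x R
   with law Lebesgue x N(0, 1); iterating it gives independent standard normal
   variables Z_0, Z_1, ... on [0, 1[.  The covariance
   C((p, j), (q, j')) = int e^(i (p - q, x)) dG_jj' is real because G is even, is
   positive semidefinite because the densities are, and has an infinite Cholesky
   factor L; then X = sum_k L_k Z_k.  Laws of finite samples are determined by
   integrals of cosines and sines of linear combinations, which depend only on
   the shift invariant C. *)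

(** * Measures determined by trigonometric integrals *)

(** No topology on the torus is used, only its sigma-algebra and the characters: uniqueness comes
    from an algebra of test functions, and a limit of measures is built rather than extracted by
    weak compactness. Bit streams serve this purpose because a function of finitely many bits is a
    finite sum of cylinder indicators, so the limit of its integrals is read off the limit weights,
    and characters are uniform limits of such functions. The ultrafilter picks the limits for all
    strings at once, so additivity survives; boundedness holds because every Fejer sum has the same
    total mass [Re r(0)]. The half-open interval does no harm: a coordinate whose digits are all
    ones has angle pi, which is sent to -pi, and integer frequencies do not see the difference.

    In Part 2 independence of the Z_k is never stated. What is used is the law of finite
    combinations of them, N(0, sum of c_k^2), which follows by induction from completing a square;
    covariances then follow by polarization. The Cholesky factor is triangular, so every X is a
    finite sum and no convergence of random series occurs. *)

Section bounded_measurable_functions.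
Context d (T : measurableType d) (R : realType).
Implicit Types (f g : T -> R) (mu : {finite_measure set T -> \bar R}).

(** Every finite measure integrates such functions and products stay in the class, so linearity of
    the integral carries no integrability conditions. *)
Definition bounded_measurable f :=
  measurable_fun setT f /\ exists M : R, forall x, `|f x| <= M.

Lemma bounded_measurable_cst c : bounded_measurable (fun=> c).
Proof. by split; [exact: measurable_cst|exists `|c|]. Qed.

Lemma bounded_measurableD f g : bounded_measurable f -> bounded_measurable g ->
  bounded_measurable (fun x => f x + g x).
Proof.
move=> [mf [M fM]] [mg [N gN]]; split; first exact: measurable_funD.
by exists (M + N) => x; rewrite (le_trans (ler_normD _ _))// lerD.
Qed.

Lemma bounded_measurableM f g : bounded_measurable f -> bounded_measurable g ->
  bounded_measurable (fun x => f x * g x).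
Proof.
move=> [mf [M fM]] [mg [N gN]]; split; first exact: measurable_funM.
by exists (M * N) => x; rewrite normrM ler_pM.
Qed.

Lemma bounded_measurableZ c f : bounded_measurable f ->
  bounded_measurable (fun x => c * f x).
Proof. by move=> bf; apply: bounded_measurableM => //; exact: bounded_measurable_cst. Qed.

Lemma bounded_measurableN f : bounded_measurable f ->
  bounded_measurable (fun x => - f x).
Proof.
move=> /(bounded_measurableZ (-1)); congr bounded_measurable.
by apply/funext => x; rewrite mulN1r.
Qed.

Lemma bounded_measurableB f g : bounded_measurable f -> bounded_measurable g ->
  bounded_measurable (fun x => f x - g x).
Proof. by move=> bf bg; apply: bounded_measurableD => //; exact: bounded_measurableN. Qed.

Lemma bounded_measurable_sum (I : Type) (r : seq I) (F : I -> T -> R) :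
  (forall i, bounded_measurable (F i)) ->
  bounded_measurable (fun x => \sum_(i <- r) F i x).
Proof.
move=> bF; elim: r => [|i r IH].
  by under eq_fun do rewrite big_nil; exact: bounded_measurable_cst.
by under eq_fun do rewrite big_cons; exact: bounded_measurableD.
Qed.

Lemma bounded_measurable_indic (A : set T) : measurable A ->
  bounded_measurable (\1_A : T -> R).
Proof.
move=> mA; split; first exact: measurable_indic.
by exists 1 => x; rewrite indicE; case: (_ \in _); rewrite ?normr1 ?normr0.
Qed.

Lemma bounded_measurable_integrable mu (D : set T) f : measurable D ->
  bounded_measurable f -> mu.-integrable D (EFin \o f).
Proof.
move=> mD [mf [M fM]].
apply: (@le_integrable _ _ _ mu D mD _ (EFin \o cst M)) => //.
- exact/measurable_EFinP/measurable_funTS.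
- by move=> x _ /=; rewrite lee_fin (le_trans (fM x)) ?ler_norm.
- exact: finite_measure_integrable_cst.
Qed.

Lemma RintegralD_bounded mu f g : bounded_measurable f -> bounded_measurable g ->
  \int[mu]_x (f x + g x) = \int[mu]_x f x + \int[mu]_x g x.
Proof. by move=> bf bg; rewrite RintegralD//; exact: bounded_measurable_integrable. Qed.

Lemma RintegralZ_bounded mu c f : bounded_measurable f ->
  \int[mu]_x (c * f x) = c * \int[mu]_x f x.
Proof. by move=> bf; rewrite RintegralZl//; exact: bounded_measurable_integrable. Qed.

Lemma RintegralN_bounded mu f : bounded_measurable f ->
  \int[mu]_x (- f x) = - \int[mu]_x f x.
Proof.
move=> bf; rewrite -mulN1r -RintegralZ_bounded//.
by apply: eq_Rintegral => x _; rewrite mulN1r.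
Qed.

Lemma RintegralB_bounded mu f g : bounded_measurable f -> bounded_measurable g ->
  \int[mu]_x (f x - g x) = \int[mu]_x f x - \int[mu]_x g x.
Proof.
move=> bf bg; rewrite RintegralD_bounded ?RintegralN_bounded//.
exact: bounded_measurableN.
Qed.

Lemma Rintegral_sum_bounded mu (I : Type) (r : seq I) (F : I -> T -> R) :
  (forall i, bounded_measurable (F i)) ->
  \int[mu]_x (\sum_(i <- r) F i x) = \sum_(i <- r) \int[mu]_x F i x.
Proof.
move=> bF; elim: r => [|i r IH].
  rewrite big_nil -(Rintegral_set0 mu (fun=> 0)) /Rintegral.
  by rewrite integral_set0 integral0_eq// => x _; rewrite big_nil.
rewrite big_cons -IH -RintegralD_bounded//; last exact: bounded_measurable_sum.
by apply: eq_Rintegral => x _; rewrite big_cons.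
Qed.

Lemma Rintegral_indic mu (A : set T) : measurable A ->
  \int[mu]_x (\1_A x) = fine (mu A).
Proof. by move=> mA; rewrite /Rintegral integral_indic// setIT. Qed.

Lemma bounded_convergence mu (F : nat -> T -> R) f (M : R) :
  (forall n, measurable_fun setT (F n)) ->
  (forall n x, `|F n x| <= M) ->
  (forall x, F n x @[n --> \oo] --> f x) ->
  bounded_measurable f /\ \int[mu]_x F n x @[n --> \oo] --> \int[mu]_x f x.
Proof.
move=> mF FM Ff.
have mf : measurable_fun setT f by exact: (@measurable_fun_cvg _ _ _ setT F).
have fM x : `|f x| <= M.
  rewrite -(cvg_lim _ (cvg_norm (Ff x)))//.
  apply: limr_le; first by apply/cvg_ex; exists `|f x|; exact: cvg_norm.
  exact: nearW.
have bf : bounded_measurable f by split => //; exists M.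
split => //.
apply: fine_cvg; rewrite fineK; last first.
  by apply: integrable_fin_num => //; exact: (bounded_measurable_integrable _ _ bf).
apply: (@dominated_cvg _ _ _ mu setT measurableT (fun n => EFin \o F n) (EFin \o f) (EFin \o cst M)) => //.
- by move=> n; exact/measurable_EFinP.
- by move=> x _; apply/fine_cvgP; split; [exact: nearW|exact: Ff].
- exact: finite_measure_integrable_cst.
- by move=> n x _; rewrite /= lee_fin.
Qed.

End bounded_measurable_functions.

Section measure_uniqueness.
Context d (T : measurableType d) (R : realType).
Variables (m1 m2 : {finite_measure set T -> \bar R}) (A : set (T -> R)).
Hypothesis bA : forall f, A f -> bounded_measurable f.
Hypothesis A1 : A (fun=> 1).
Hypothesis AM : forall f g, A f -> A g ->
  exists u v, [/\ A u, A v & forall x, f x * g x = u x + v x].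
Hypothesis intA : forall f, A f -> \int[m1]_x f x = \int[m2]_x f x.

Let S (f : T -> R) := bounded_measurable f /\
  forall h, A h -> \int[m1]_x (f x * h x) = \int[m2]_x (f x * h x).

(** [S] is closed under sums, multiples and bounded limits, but not visibly under products. Its
    multipliers [S'] form an algebra for formal reasons and inherit the bounded limits. *)
Let S' (f : T -> R) := bounded_measurable f /\
  forall g, S g -> S (fun x => f x * g x).

Let SD f g : S f -> S g -> S (fun x => f x + g x).
Proof.
move=> [bf Hf] [bg Hg]; split; first exact: bounded_measurableD.
move=> h Ah; have bh := bA Ah.
have E (m : {finite_measure set T -> \bar R}) : \int[m]_x ((f x + g x) * h x) =
    \int[m]_x (f x * h x) + \int[m]_x (g x * h x).
  rewrite -RintegralD_bounded//; try exact: bounded_measurableM.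
  by apply: eq_Rintegral => x _; rewrite mulrDl.
by rewrite !E Hf// Hg.
Qed.

Let SZ c f : S f -> S (fun x => c * f x).
Proof.
move=> [bf Hf]; split; first exact: bounded_measurableZ.
move=> h Ah; have bh := bA Ah.
have E (m : {finite_measure set T -> \bar R}) : \int[m]_x (c * f x * h x) =
    c * \int[m]_x (f x * h x).
  rewrite -RintegralZ_bounded//; try exact: bounded_measurableM.
  by apply: eq_Rintegral => x _; rewrite mulrA.
by rewrite !E Hf.
Qed.

Let Slim (F : nat -> T -> R) f (M : R) : (forall n, S (F n)) ->
  (forall n x, `|F n x| <= M) -> (forall x, F n x @[n --> \oo] --> f x) -> S f.
Proof.
move=> SF FM Ff.
have mF n : measurable_fun setT (F n) by case: (SF n) => -[].
have [bf _] := bounded_convergence m1 mF FM Ff.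
split=> // h Ah; have [mh [N hN]] := bA Ah.
have cvgm (m : {finite_measure set T -> \bar R}) :
    \int[m]_x (F n x * h x) @[n --> \oo] --> \int[m]_x (f x * h x).
  apply: (proj2 (@bounded_convergence _ _ _ m (fun n x => F n x * h x)
    (fun x => f x * h x) (M * N) _ _ _)).
  - by move=> n; exact: measurable_funM.
  - by move=> n x; rewrite normrM ler_pM.
  - by move=> x; apply: cvgMl; exact: Ff.
have := cvgm m1; rewrite (_ : (fun n => _) = fun n => \int[m2]_x (F n x * h x)).
  by move=> c1; rewrite -(cvg_lim (@Rhausdorff R) c1) -(cvg_lim (@Rhausdorff R) (cvgm m2)).
by apply/funext => n; case: (SF n) => _; exact.
Qed.

Let S'D f g : S' f -> S' g -> S' (fun x => f x + g x).
Proof.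
move=> [bf Hf] [bg Hg]; split; first exact: bounded_measurableD.
move=> h Sh; rewrite (_ : (fun x => _) = fun x => f x * h x + g x * h x).
  by apply: SD; [exact: Hf|exact: Hg].
by apply/funext => x; rewrite mulrDl.
Qed.

Let S'M f g : S' f -> S' g -> S' (fun x => f x * g x).
Proof.
move=> [bf Hf] [bg Hg]; split; first exact: bounded_measurableM.
move=> h Sh; rewrite (_ : (fun x => _) = fun x => f x * (g x * h x)).
  by apply: Hf; exact: Hg.
by apply/funext => x; rewrite mulrA.
Qed.

Let S'cst c : S' (fun=> c).
Proof. by split; [exact: bounded_measurable_cst|move=> g; exact: SZ]. Qed.

Let S'B f g : S' f -> S' g -> S' (fun x => f x - g x).
Proof.
move=> Sf Sg; rewrite (_ : (fun x => _) = fun x => f x + -1 * g x).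
  by apply: S'D => //; apply: S'M.
by apply/funext => x; rewrite mulN1r.
Qed.

Let S'X f n : S' f -> S' (fun x => f x ^+ n).
Proof.
move=> Sf; elim: n => [|n IH].
  by under eq_fun do rewrite expr0; exact: S'cst.
by under eq_fun do rewrite exprS; exact: S'M.
Qed.

Let S'sum (F : nat -> T -> R) n : (forall i, S' (F i)) ->
  S' (fun x => \sum_(0 <= i < n) F i x).
Proof.
move=> SF; elim: n => [|n IH].
  by under eq_fun do rewrite big_nil; exact: S'cst.
by under eq_fun do rewrite big_nat_recr//=; exact: S'D.
Qed.

Let S'lim (F : nat -> T -> R) f (M : R) : (forall n, S' (F n)) ->
  (forall n x, `|F n x| <= M) -> (forall x, F n x @[n --> \oo] --> f x) -> S' f.
Proof.
move=> SF FM Ff.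
have mF n : measurable_fun setT (F n) by case: (SF n) => -[].
have [bf _] := bounded_convergence m1 mF FM Ff.
split=> // g Sg; have [[mg [N gN]] _] := Sg.
apply: (@Slim (fun n x => F n x * g x) _ (M * N)).
- by move=> n; exact: (proj2 (SF n)).
- by move=> n x; rewrite normrM ler_pM.
- by move=> x; apply: cvgMl; exact: Ff.
Qed.

(** Testing [f * g] against [h] in [A] amounts to testing [g] against [f * h], which [AM] splits
    into two members of [A]. *)
Let AS' f : A f -> S' f.
Proof.
move=> Af; split; first exact: bA.
move=> g [bg Hg]; split; first by apply: bounded_measurableM => //; exact: bA.
move=> h Ah; have [u [v [Au Av fh]]] := AM Af Ah.
have E (m : {finite_measure set T -> \bar R}) : \int[m]_x (f x * g x * h x) =
    \int[m]_x (g x * u x) + \int[m]_x (g x * v x).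
  rewrite -RintegralD_bounded//; try by apply: bounded_measurableM => //; exact: bA.
  by apply: eq_Rintegral => x _; rewrite -mulrDr -fh mulrCA mulrA.
by rewrite !E !Hg.
Qed.

Let S'int f : S' f -> \int[m1]_x f x = \int[m2]_x f x.
Proof.
move=> [bf Hf]; have S1 : S (fun=> 1).
  split; first exact: bounded_measurable_cst.
  by move=> h Ah; under eq_Rintegral do rewrite mul1r;
     under [RHS]eq_Rintegral do rewrite mul1r; exact: intA.
have [_ /(_ _ A1)] := Hf _ S1.
by under eq_Rintegral do rewrite !mulr1;
   under [RHS]eq_Rintegral do rewrite !mulr1.
Qed.

Let S'exp f : S' f -> S' (fun x => expR (f x)).
Proof.
move=> Sf; have [[mf [M fM]] _] := Sf.
(* Partial sums at [f x] are dominated by partial sums at [M], which increase to [expR M]. *)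
apply: (@S'lim (fun n x => series (exp_coeff (f x)) n) _ (expR M)).
- move=> n; rewrite /series /=; apply: S'sum => i.
  rewrite /exp_coeff/= (_ : (fun x => _) = fun x => i`!%:R^-1 * f x ^+ i).
    by apply: S'M => //; exact: S'X.
  by apply/funext => x; rewrite mulrC.
- move=> n x; rewrite (@le_trans _ _ (series (exp_coeff M) n))//.
    rewrite /series/= (le_trans (ler_norm_sum _ _ _))//; apply: ler_sum => i _.
    rewrite /exp_coeff/= normrM normrX ler_pM//; last by rewrite ger0_norm.
    by rewrite lerXn2r ?nnegrE// (le_trans _ (fM x)).
  rewrite /expR; apply: nondecreasing_cvgn_le; last exact: is_cvg_series_exp_coeff.
  move=> a b ab; apply: nondecreasing_series => // i _ _.
  by rewrite /exp_coeff/= divr_ge0// exprn_ge0// (le_trans _ (fM x)).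
- by move=> x; exact: is_cvg_series_exp_coeff.
Qed.

Let S'lt f c : S' f -> S' (\1_[set x | f x < c] : T -> R).
Proof.
move=> Sf.
(* The outer factor [n] settles the boundary: where [f x = c] the value is [expR (- n)], which tends
   to 0, so the limit is the indicator of the strict inequality. *)
apply: (@S'lim (fun n x => expR (- n%:R * expR (n%:R * (f x - c)))) _ 1).
- by move=> n; apply: S'exp; apply: S'M => //; apply: S'exp; apply: S'M => //; exact: S'B.
- by move=> n x; rewrite gtr0_norm ?expR_gt0// -expR0 ler_expR mulNr oppr_le0
    mulr_ge0 ?expR_ge0.
- move=> x; rewrite indicE; case: (ltP (f x) c) => fc.
    rewrite mem_set// [X in _ --> X](_ : _ = expR 0); last by rewrite expR0.
    apply: (@cvg_comp _ _ _ (fun n : nat => - n%:R * expR (n%:R * (f x - c))) expR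
      _ (nbhs (0 : R))); last exact: continuous_expR.
    pose e := c - f x; have e0 : 0 < e by rewrite subr_gt0.
    (* The exponent is [- n * expR (- n e)]; from [expR t >= 1 + t^2 / 2] and [n + 1 <= 2 n] its
       absolute value is at most [(4 / e^2) / (n + 1)]. *)
    apply: (@squeeze_cvgr _ _ _ _ (fun n : nat => - (4 / e ^+ 2) * n.+1%:R^-1) (fun=> 0)).
    - apply: nearW => n; apply/andP; split; last by rewrite mulNr oppr_le0 mulr_ge0 ?expR_ge0.
      rewrite !mulNr lerN2 -opprB -/e mulrN expRN.
      have [->|n0] := posnP n; first by rewrite mul0r mulr_ge0// divr_ge0// sqr_ge0.
      have n1 : (1 : R) <= n%:R by rewrite ler1n.
      have ne : 0 <= n%:R * e by rewrite mulr_ge0// ltW.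
      have := expR_ge1Dxn 1 ne; rewrite ler_pdivrMr ?expR_gt0// => h.
      have e2 : 0 < e ^+ 2 by exact: exprn_gt0.
      have -> : 4 / e ^+ 2 / n.+1%:R * expR (n%:R * e) =
          4 * expR (n%:R * e) / (e ^+ 2 * n.+1%:R).
        by rewrite [in RHS]invfM; ring.
      rewrite ler_pdivlMr ?mulr_gt0 ?ltr0Sn//.
      rewrite (@le_trans _ _ (4 * ((n%:R * e) ^+ 2 / 2)))//; last first.
        by rewrite ler_pM2l//; move: h; rewrite (_ : 2`!%:R = 2 :> R)//; lra.
      by rewrite -natr1 exprMn; nra.
    - rewrite -(mulr0 (- (4 / e ^+ 2))); apply: cvgMr; exact: cvg_harmonic.
    - exact: cvg_cst.
  rewrite memNset/=; last by apply/negP; rewrite -leNgt.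
  have e1 n : expR (- n%:R * expR (n%:R * (f x - c))) <= expR (- n%:R).
    by rewrite ler_expR ler_neMr ?oppr_le0// -expR0 ler_expR mulr_ge0// subr_ge0.
  apply: (@squeeze_cvgr _ _ _ _ (fun=> 0) (fun n : nat => n.+1%:R^-1)).
  - apply: nearW => n; rewrite expR_ge0 (le_trans (e1 n))//= expRN lef_pV2 ?posrE ?expR_gt0//.
    by rewrite -nat1r expR_ge1Dx.
  - exact: cvg_cst.
  - exact: cvg_harmonic.
Qed.

Let D (B : set T) := measurable B /\ S' (\1_B : T -> R).

(** As [S'] is closed under products, unions need not be disjoint: the indicator of a union is the
    bounded limit of [1 - prod (1 - 1_{B i})]. *)
Let sigma_algebra_D : sigma_algebra setT D.
Proof.
split.
- split => //; rewrite indic0; exact: S'cst.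
- move=> B [mB SB]; rewrite setTD; split; first exact: measurableC.
  rewrite (_ : \1_(~` B) = fun x => 1 - \1_B x); first exact: S'B.
  by apply/funext => x; rewrite !indicE in_setC; case: (x \in B); rewrite ?subrr ?subr0.
- move=> B DB; split; first by apply: bigcupT_measurable => n; case: (DB n).
  apply: (@S'lim (fun n x => 1 - \prod_(0 <= i < n) (1 - \1_(B i) x)) _ 1).
  + move=> n; apply: S'B => //; elim: n => [|n IH].
      by under eq_fun do rewrite big_nil; exact: S'cst.
    under eq_fun do rewrite big_nat_recr//=; apply: S'M => //.
    by apply: S'B => //; case: (DB n).
  + move=> n x; set p := \prod_(_ <= _ < _) _.
    have : 0 <= p <= 1.
      rewrite /p; elim: (n) => [|k IH]; first by rewrite big_nil lexx ler01.
      rewrite big_nat_recr//= indicE; case: (_ \in _); rewrite ?subrr ?subr0 ?mulr0 ?mulr1//.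
      by rewrite lexx ler01.
    by move=> p01; rewrite ler_norml; lra.
  + move=> x; rewrite indicE; have [[k _ Bkx]|nBx] := pselect ((\bigcup_k B k) x).
      rewrite mem_set; last by exists k.
      apply: cvg_near_cst; exists k.+1 => // n /= kn.
      rewrite (big_cat_nat (n := k.+1))//= big_nat_recr//= indicE mem_set//.
      by rewrite subrr mulr0 mul0r subr0.
    rewrite memNset//=; apply: cvg_near_cst; apply: nearW => n.
    rewrite big1_seq ?subrr// => i _; rewrite indicE memNset ?subr0//.
    by move=> Bi; apply: nBx; exists i.
Qed.

Lemma measure_eq_generated B :
  <<s [set [set x | f x < c] | f in A & c in setT] >> B -> m1 B = m2 B.
Proof.
suff : <<s [set [set x | f x < c] | f in A & c in setT] >> `<=` D.
  move=> /[apply] -[mB /S'int].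
  rewrite !Rintegral_indic// => e.
by rewrite -[LHS]fineK ?fin_num_measure// e fineK ?fin_num_measure.
apply: smallest_sub => //.
move=> _ [f Af [c _ <-]]; split; last exact/S'lt/AS'.
have [mf _] := bA Af.
rewrite (_ : [set x | _] = setT `&` f @^-1` `]-oo, c[%classic).
  exact: mf.
by rewrite setTI; apply/seteqP; split => x /=; rewrite in_itv.
Qed.

End measure_uniqueness.

Section torus_character.
Context (R : realType).
Implicit Types (t s : R) (m : int).

Definition cis t : R[i] := cos t +i* sin t.

Lemma cisD t s : cis (t + s) = cis t * cis s.
Proof. by rewrite /cis cosD sinD; simpc; congr (_ +i* _); rewrite addrC mulrC [X in _ + X]mulrC addrC. Qed.

Lemma cis0 : cis 0 = 1.
Proof. by rewrite /cis cos0 sin0. Qed.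

Lemma cis_sum (I : Type) (r : seq I) (F : I -> R) :
  cis (\sum_(i <- r) F i) = \prod_(i <- r) cis (F i).
Proof. exact: (big_morph cis cisD cis0). Qed.

Lemma cisN t : cis (- t) = conjc (cis t).
Proof. by rewrite /cis cosN sinN. Qed.

Lemma cisMn t n : cis (t *+ n) = cis t ^+ n.
Proof. by elim: n => [|n IH]; rewrite ?mulr0n ?cis0// mulrS cisD IH exprS. Qed.

Lemma cis2pi m : cis (m%:~R * (pi *+ 2)) = 1.
Proof.
have h n : cis (n%:R * (pi *+ 2)) = 1.
  rewrite mulr_natl cisMn (_ : cis _ = 1) ?expr1n// mulr2n cisD.
  by rewrite /cis cospi sinpi; simpc.
by case: m => n; [exact: h|rewrite NegzE mulrNz mulNr cisN h conjc1].
Qed.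

Lemma cisDM2pi t m : cis (t + m%:~R * (pi *+ 2)) = cis t.
Proof. by rewrite cisD cis2pi mulr1. Qed.

Lemma measurable_cos : measurable_fun setT (@cos R).
Proof. by apply: continuous_measurable_fun; exact: continuous_cos. Qed.

Lemma measurable_sin : measurable_fun setT (@sin R).
Proof. by apply: continuous_measurable_fun; exact: continuous_sin. Qed.

End torus_character.

Lemma measurable_fun_ray d (T : measurableType d) (R : realType) (f : T -> R) :
  (forall c, measurable [set x | f x < c]) -> measurable_fun setT f.
Proof.
move=> mf; apply: (measurability _ (RGenInftyO.measurableE R)).
move=> _ [_ [c ->] <-]; rewrite setTI (_ : _ @^-1` _ = [set x | f x < c]).
  exact: mf.
by apply/seteqP; split => x /=; rewrite in_itv.
Qed.

Section trigonometric_class.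
Context (R : realType) (T V : Type) (phi : V -> T -> R) (add opp : V -> V -> V).

(* [phi v x] plays the role of the pairing (v, x). *)
Definition trig_class : set (T -> R) :=
  [set f | exists v c, f = (fun x => c * cos (phi v x)) \/
                       f = (fun x => c * sin (phi v x))].

Hypothesis phiD : forall v w x, phi (add v w) x = phi v x + phi w x.
Hypothesis phiB : forall v w x, phi (opp v w) x = phi v x - phi w x.

(** Product-to-sum formulas; the scalar in [trig_class] absorbs their signs and the factor 1/2. *)
Lemma trig_classM f g : trig_class f -> trig_class g ->
  exists u v, [/\ trig_class u, trig_class v & forall x, f x * g x = u x + v x].
Proof.
have cosE v w x : cos (phi (opp v w) x) = cos (phi v x) * cos (phi w x) +
    sin (phi v x) * sin (phi w x) by rewrite phiB cosD cosN sinN; ring.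
have sinE v w x : sin (phi (opp v w) x) = sin (phi v x) * cos (phi w x) -
    cos (phi v x) * sin (phi w x) by rewrite phiB sinD cosN sinN; ring.
move=> [v [c [->|->]]] [w [c' [->|->]]].
- exists (fun x => c * c' / 2 * cos (phi (opp v w) x)),
    (fun x => c * c' / 2 * cos (phi (add v w) x)); split.
  + by exists (opp v w), (c * c' / 2); left.
  + by exists (add v w), (c * c' / 2); left.
  + by move=> x; rewrite phiD cosE cosD; field.
- exists (fun x => - (c * c' / 2) * sin (phi (opp v w) x)),
    (fun x => c * c' / 2 * sin (phi (add v w) x)); split.
  + by exists (opp v w), (- (c * c' / 2)); right.
  + by exists (add v w), (c * c' / 2); right.
  + by move=> x; rewrite phiD sinE sinD; field.
- exists (fun x => c * c' / 2 * sin (phi (opp v w) x)),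
    (fun x => c * c' / 2 * sin (phi (add v w) x)); split.
  + by exists (opp v w), (c * c' / 2); right.
  + by exists (add v w), (c * c' / 2); right.
  + by move=> x; rewrite phiD sinE sinD; field.
- exists (fun x => c * c' / 2 * cos (phi (opp v w) x)),
    (fun x => - (c * c' / 2) * cos (phi (add v w) x)); split.
  + by exists (opp v w), (c * c' / 2); left.
  + by exists (add v w), (- (c * c' / 2)); left.
  + by move=> x; rewrite phiD cosE cosD; field.
Qed.

End trigonometric_class.

Section trigonometric_uniqueness.
Context (R : realType) d (T : measurableType d) (V : Type) (phi : V -> T -> R).
Variables (add opp : V -> V -> V) (v0 : V).
Hypothesis phi0 : forall x, phi v0 x = 0.
Hypothesis phiD : forall v w x, phi (add v w) x = phi v x + phi w x.
Hypothesis phiB : forall v w x, phi (opp v w) x = phi v x - phi w x.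
Hypothesis mphi : forall v, measurable_fun setT (phi v).

Lemma bounded_measurable_cos v : bounded_measurable (fun x => cos (phi v x)).
Proof.
split; first exact: (measurableT_comp (@measurable_cos R)).
by exists 1 => x; rewrite ler_norml cos_geN1 cos_le1.
Qed.

Lemma bounded_measurable_sin v : bounded_measurable (fun x => sin (phi v x)).
Proof.
split; first exact: (measurableT_comp (@measurable_sin R)).
by exists 1 => x; rewrite ler_norml sin_geN1 sin_le1.
Qed.

Variables m1 m2 : {finite_measure set T -> \bar R}.
Hypothesis cosE : forall v, \int[m1]_x cos (phi v x) = \int[m2]_x cos (phi v x).
Hypothesis sinE : forall v, \int[m1]_x sin (phi v x) = \int[m2]_x sin (phi v x).

Let D := [set [set x | f x < c] | f in trig_class phi & c in setT].

Lemma trig_measure_eq (B : set T) : <<s D >> B -> m1 B = m2 B.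
Proof.
apply: measure_eq_generated.
- move=> _ [v [c [->|->]]]; apply: bounded_measurableZ.
    exact: bounded_measurable_cos.
  exact: bounded_measurable_sin.
- by exists v0, 1; left; apply/funext => x; rewrite phi0 cos0 mulr1.
- exact: trig_classM phiD phiB.
- move=> _ [v [c [->|->]]].
    by rewrite !RintegralZ_bounded ?cosE//; exact: bounded_measurable_cos.
  by rewrite !RintegralZ_bounded ?sinE//; exact: bounded_measurable_sin.
Qed.

(** Serves to show, coordinate by coordinate, that trigonometric sublevel sets generate the whole
    given sigma-algebra. *)
Lemma trig_generated_cos v :
  measurable_fun setT ((fun x => cos (phi v x)) : g_sigma_algebraType D -> R).
Proof.
apply: measurable_fun_ray => c; apply: sub_sigma_algebra.
exists (fun x => 1 * cos (phi v x)); first by exists v, 1; left.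
by exists c => //; under eq_set do rewrite mul1r.
Qed.

Lemma trig_generated_sin v :
  measurable_fun setT ((fun x => sin (phi v x)) : g_sigma_algebraType D -> R).
Proof.
apply: measurable_fun_ray => c; apply: sub_sigma_algebra.
exists (fun x => 1 * sin (phi v x)); first by exists v, 1; right.
by exists c => //; under eq_set do rewrite mul1r.
Qed.

End trigonometric_uniqueness.

(** * Characters generate the sigma-algebra of the torus *)

Section arc_measurability.
Context (R : realType).

Lemma arc_bound (x : arc R) : - pi <= arc_val x < pi.
Proof. exact: (valP x). Qed.

Lemma measurable_arc_val : measurable_fun setT (@arc_val R : arc R -> R).
Proof. by move=> _ B mB; exists B => //; rewrite setTI. Qed.

Lemma measurable_fun_arcP d (T : measurableType d) (f : T -> arc R) :
  measurable_fun setT (fun x => arc_val (f x)) -> measurable_fun setT f.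
Proof. by move=> mf _ _ [B mB <-]; rewrite !setTI -comp_preimage -[X in measurable X]setTI; exact: mf. Qed.

(** Cosine and sine determine an angle of [-pi, pi[ explicitly enough for sublevel sets: [sin < 0]
    singles out ]-pi, 0[, [cos <= -1] singles out -pi, and cosine is monotone on each half. *)
Lemma measurable_angle d (T : measurableType d) (f : T -> R) :
  (forall x, - pi <= f x < pi) ->
  measurable_fun setT (fun x => cos (f x)) ->
  measurable_fun setT (fun x => sin (f x)) -> measurable_fun setT f.
Proof.
move=> bf mc ms.
have mlt (g : T -> R) c : measurable_fun setT g -> measurable [set x | g x < c].
  move=> mg; rewrite (_ : [set x | _] = setT `&` g @^-1` `]-oo, c[%classic).
    exact: mg.
  by rewrite setTI; apply/seteqP; split => x /=; rewrite in_itv.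
have mle (g : T -> R) c : measurable_fun setT g -> measurable [set x | g x <= c].
  move=> mg; rewrite (_ : [set x | _] = setT `&` g @^-1` `]-oo, c]%classic).
    exact: mg.
  by rewrite setTI; apply/seteqP; split => x /=; rewrite in_itv.
apply: measurable_fun_ray => t.
have sin_lt0 x : sin (f x) < 0 = (- pi < f x < 0).
  have /andP[b1 b2] := bf x; have [f0|f0] := ltP (f x) 0; last first.
    by rewrite andbF; apply/negbTE; rewrite -leNgt sin_ge0_pi ?f0 ?(ltW b2).
  move: b1; rewrite andbT le_eqVlt => /predU1P[<-|b1].
    by rewrite sinN sinpi oppr0 !ltxx.
  rewrite b1 -[f x]opprK sinN oppr_lt0 sin_gt0_pi//; lra.
have cosN1 x : (cos (f x) <= -1) = (f x == - pi).
  have [->|fpi] := eqVneq (f x) (- pi); first by rewrite cosN cospi lexx.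
  apply/negbTE; rewrite -ltNge -cospi; have /andP[b1 b2] := bf x.
  have {}b1 : - pi < f x by rewrite lt_neqAle eq_sym fpi.
  have [f0|f0] := ltP (f x) 0; last by rewrite ltr_cos ?in_itv/=; lra.
  by rewrite -(cosN (f x)) ltr_cos ?in_itv/=; lra.
have [tpi|tpi] := leP t (- pi).
  rewrite (_ : [set x | _] = set0)//; apply/seteqP; split => // x /=.
  by have /andP[] := bf x; lra.
have [pit|pit] := leP pi t.
  rewrite (_ : [set x | _] = setT)//; apply/seteqP; split => // x _ /=.
  by have /andP[] := bf x; lra.
have [t0|t0] := leP t 0.
  rewrite (_ : [set x | _] = [set x | cos (f x) <= -1] `|`
      ([set x | sin (f x) < 0] `&` [set x | cos (f x) < cos t])).
    by apply: measurableU; [exact: mle|apply: measurableI; exact: mlt].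
  apply/seteqP; split => x /=; rewrite sin_lt0 cosN1.
    move=> xt; have /andP[] := bf x; rewrite le_eqVlt => /predU1P[<- _|b1 b2]; first by left.
    right; split; first by rewrite b1 (lt_le_trans xt).
    rewrite -cosN -(cosN t) ltr_cos ?in_itv/=; lra.
  move=> [/eqP -> //|[/andP[h1 h2]]].
  rewrite -cosN -(cosN t) ltr_cos ?in_itv/=; lra.
rewrite (_ : [set x | _] = ([set x | cos (f x) <= -1] `|` [set x | sin (f x) < 0]) `|`
    ~` [set x | cos (f x) <= cos t]).
  apply: measurableU; first by apply: measurableU; [exact: mle|exact: mlt].
  by apply: measurableC; exact: mle.
apply/seteqP; split => x /=; rewrite sin_lt0 cosN1.
  move=> xt; have /andP[] := bf x; rewrite le_eqVlt => /predU1P[<- _|b1 b2]; first by left; left.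
  have [fx0|fx0] := ltP (f x) 0; first by left; right; rewrite b1.
  right; apply/negP; rewrite -ltNge ltr_cos ?in_itv/=; lra.
move=> [[/eqP ->|/andP[_]]|/negP]; try lra.
have [fx0|fx0] := ltP (f x) 0; first by lra.
have /andP[h1 h2] := bf x.
rewrite -ltNge ltr_cos ?in_itv/=; lra.
Qed.

Lemma torus_measure_eq nu (m1 m2 : {finite_measure set (torus R nu) -> \bar R}) :
  (forall p : 'rV[int]_nu, \int[m1]_x complex.Re (torus_char p x) =
                           \int[m2]_x complex.Re (torus_char p x)) ->
  (forall p : 'rV[int]_nu, \int[m1]_x complex.Im (torus_char p x) =
                           \int[m2]_x complex.Im (torus_char p x)) ->
  forall A, measurable A -> m1 A = m2 A.
Proof.
move=> eRe eIm A mA.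
pose phi (p : 'rV[int]_nu) (x : torus R nu) :=
  \sum_(k < nu) (p 0 k)%:~R * arc_val (tnth x k).
have mphi p : measurable_fun setT (phi p).
  apply: measurable_sum => k; apply: measurable_funM => //.
  by apply: (measurableT_comp measurable_arc_val); exact: measurable_tnth.
have phiD p q x : phi (p + q) x = phi p x + phi q x.
  by rewrite -big_split/=; apply: eq_bigr => k _; rewrite mxE intrD mulrDl.
have phiB p q x : phi (p - q) x = phi p x - phi q x.
  by rewrite -sumrB; apply: eq_bigr => k _; rewrite !mxE intrB mulrBl.
have phi0 x : phi 0 x = 0 by rewrite /phi big1// => k _; rewrite mxE mul0r.
apply: (@trig_measure_eq _ _ _ _ phi +%R (fun p q => p - q) 0) => //.
set D := [set _ | _ in _ & _ in _].
(* Measurability of the identity says that every measurable set of the torus lies in the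
   sigma-algebra generated by the characters; unit frequency vectors recover the coordinates. *)
have mid : measurable_fun setT (id : g_sigma_algebraType D -> torus R nu).
  apply/measurable_fun_tnthP => k; apply: measurable_fun_arcP => /=.
  apply: measurable_angle => [x||]; first exact: arc_bound.
    pose p : 'rV[int]_nu := \row_j (j == k)%:R.
    have := trig_generated_cos (phi := phi) p; congr measurable_fun; apply/funext => x.
    rewrite /phi (bigD1 k)//= mxE eqxx mul1r big1 ?addr0// => j jk.
    by rewrite mxE (negbTE jk) mul0r.
  pose p : 'rV[int]_nu := \row_j (j == k)%:R.
  have := trig_generated_sin (phi := phi) p; congr measurable_fun; apply/funext => x.
  rewrite /phi (bigD1 k)//= mxE eqxx mul1r big1 ?addr0// => j jk.
  by rewrite mxE (negbTE jk) mul0r.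
by have := mid measurableT A mA; rewrite setTI.
Qed.

End arc_measurability.

(** * Integrals against charges *)

Section image_measure.
Context d d' (T : measurableType d) (T' : measurableType d') (R : realType).
Variables (f : T -> T').

(** The proof [mf] is an argument so that the measure structure of the image can be inferred from
    the term. *)
Definition image_measure (mf : measurable_fun setT f)
  (m : {measure set T -> \bar R}) : set T' -> \bar R := pushforward m f.

Definition image_charge (mf : measurable_fun setT f)
  (m : {charge set T -> \bar R}) : set T' -> \bar R := pushforward m f.

Section instances.
Variables (mf : measurable_fun setT f) (m : {measure set T -> \bar R}).
Variable (n : {charge set T -> \bar R}).

Let mpre A : measurable A -> measurable (f @^-1` A).
Proof. by move=> mA; rewrite -[X in measurable X]setTI; exact: mf. Qed.

Let push0 : image_measure mf m set0 = 0%E.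
Proof. by rewrite /image_measure /pushforward preimage_set0 measure0. Qed.

Let push_ge0 A : (0 <= image_measure mf m A)%E.
Proof. exact: measure_ge0. Qed.

Let push_sigma : semi_sigma_additive (image_measure mf m).
Proof.
move=> F mF tF mUF; rewrite /image_measure /pushforward preimage_bigcup.
apply: measure_semi_sigma_additive.
- by move=> k; exact: mpre.
- apply/trivIsetP => /= i j _ _ ij; rewrite -preimage_setI.
  by move/trivIsetP : tF => /(_ _ _ _ _ ij) ->//; rewrite preimage_set0.
- by rewrite -preimage_bigcup; exact: mpre.
Qed.

HB.instance Definition _ := isMeasure.Build _ _ _ (image_measure mf m)
  push0 push_ge0 push_sigma.

Let cpush0 : image_charge mf n set0 = 0%E.
Proof. by rewrite /image_charge /pushforward preimage_set0 charge0. Qed.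

Let cpush_fin A : measurable A -> image_charge mf n A \is a fin_num.
Proof. by move=> mA; rewrite /image_charge /pushforward fin_num_measure//; exact: mpre. Qed.

Let cpush_sigma : semi_sigma_additive (image_charge mf n).
Proof.
move=> F mF tF mUF; rewrite /image_charge /pushforward preimage_bigcup.
apply: charge_semi_sigma_additive.
- by move=> k; exact: mpre.
- apply/trivIsetP => /= i j _ _ ij; rewrite -preimage_setI.
  by move/trivIsetP : tF => /(_ _ _ _ _ ij) ->//; rewrite preimage_set0.
- by rewrite -preimage_bigcup; exact: mpre.
Qed.

HB.instance Definition _ := isCharge.Build _ _ _ (image_charge mf n)
  cpush0 cpush_fin cpush_sigma.

End instances.

Section finite_instance.
Variables (mf : measurable_fun setT f) (m : {finite_measure set T -> \bar R}).

Let push_fin : fin_num_fun (image_measure mf m).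
Proof.
move=> A mA; rewrite /image_measure /pushforward fin_num_measure//.
by rewrite -[X in measurable X]setTI; exact: mf.
Qed.

HB.instance Definition _ := Measure_isFinite.Build _ _ _ (image_measure mf m) push_fin.

End finite_instance.

Lemma Rintegral_image_measure (mf : measurable_fun setT f)
    (m : {finite_measure set T -> \bar R}) (g : T' -> R) :
  bounded_measurable g -> \int[image_measure mf m]_x g x = \int[m]_x g (f x).
Proof.
move=> [mg [M gM]]; congr fine.
have := @integral_pushforward _ _ _ _ R f mf m setT (EFin \o g).
rewrite preimage_setT; apply => //; first exact/measurable_EFinP.
apply: bounded_measurable_integrable => //; split; last by exists M => x; exact: gM.
exact: measurableT_comp.
Qed.

End image_measure.

Section charge_integral_theory.
Context d (T : measurableType d) (R : realType).
Implicit Types (nu : {charge set T -> \bar R}) (m : {finite_measure set T -> \bar R}).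
Implicit Types (f : T -> R).

Section finite_measure_add.
Variables m1 m2 : {finite_measure set T -> \bar R}.

Definition finite_add : set T -> \bar R := measure_add m1 m2.

HB.instance Definition _ := Measure.copy finite_add
  (msum (fun n => if n is 0%N then (m1 : {measure set T -> \bar R}) else m2) 2).

Lemma finite_addE A : finite_add A = (m1 A + m2 A)%E.
Proof. exact: measure_addE. Qed.

Let fin : fin_num_fun finite_add.
Proof. by move=> A mA; rewrite finite_addE fin_numD !fin_num_measure. Qed.

HB.instance Definition _ := Measure_isFinite.Build _ _ _ finite_add fin.

End finite_measure_add.

Lemma Rintegral_finite_add m1 m2 f : bounded_measurable f ->
  \int[finite_add m1 m2]_x f x = \int[m1]_x f x + \int[m2]_x f x.
Proof.
move=> bf; rewrite /Rintegral.
rewrite (_ : (\int[finite_add m1 m2]_x _)%E = (\int[m1]_x (f x)%:E + \int[m2]_x (f x)%:E)%E).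
  by rewrite fineD//; apply: integrable_fin_num => //; exact: bounded_measurable_integrable.
by apply: integral_measure_add => //; exact: bounded_measurable_integrable.
Qed.

Lemma Rintegral_mscale (k : {nonneg R}) m f : bounded_measurable f ->
  \int[mscale k m]_x f x = k%:num * \int[m]_x f x.
Proof.
move=> bf; have [mf [M fM]] := bf.
(* Adding the bound [M] reduces to a nonnegative integrand, for which scaling the measure scales the
   integral. *)
have bM := @bounded_measurable_cst _ T R M.
have bfM := bounded_measurableD bf bM.
have fM0 x : 0 <= f x + M by have := fM x; rewrite ler_norml; lra.
have e : \int[mscale k m]_x (f x + M) = k%:num * \int[m]_x (f x + M).
  rewrite /Rintegral ge0_integral_mscale//=.
    by rewrite fineM// integrable_fin_num//; exact: bounded_measurable_integrable.
  by apply/measurable_EFinP; case: bfM.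
  by move=> x _; rewrite lee_fin.
move: e; rewrite !RintegralD_bounded// !Rintegral_cst// /mscale/= fineM ?fin_num_measure//=; lra.
Qed.

Lemma eq_measure_Rintegral m1 m2 f : (forall A, measurable A -> m1 A = m2 A) ->
  \int[m1]_x f x = \int[m2]_x f x.
Proof. by move=> e; congr fine; apply: eq_measure_integral => A mA _; exact: e. Qed.

(** If [nu = P - N] is the Jordan decomposition, then [P + m2 = m1 + N] as measures. Hence any
    decomposition computes the integral, which is how sums, multiples and images of charges are
    treated below. *)
Lemma charge_integral_diff nu m1 m2 f : bounded_measurable f ->
  (forall A, measurable A -> nu A = (m1 A - m2 A)%E) ->
  charge_integral nu f = \int[m1]_x f x - \int[m2]_x f x.
Proof.
move=> bf nuE; rewrite /charge_integral.
pose P : {finite_measure set T -> \bar R} := jordan_pos (hahn_posneg nu).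
pose N : {finite_measure set T -> \bar R} := jordan_neg (hahn_posneg nu).
rewrite -[X in X - _ = _]/(\int[P]_x f x) -[X in _ - X = _]/(\int[N]_x f x).
have e : \int[finite_add P m2]_x f x = \int[finite_add m1 N]_x f x.
  apply: eq_measure_Rintegral => A mA; rewrite /= !finite_addE.
  have := nuE A mA; rewrite (jordan_decomp (hahn_posneg nu) mA)/= /cadd/= /cscale/=.
  rewrite -/P -/N.
  rewrite -[P A]fineK ?fin_num_measure// -[N A]fineK ?fin_num_measure//.
  rewrite -[m1 A]fineK ?fin_num_measure// -[m2 A]fineK ?fin_num_measure//.
  by rewrite -!EFinB -!EFinM -!EFinD => -[h]; congr EFin; lra.
by move: e; rewrite !Rintegral_finite_add// => h; lra.
Qed.

Lemma jordan_difference nu : exists m1 m2 : {finite_measure set T -> \bar R},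
  forall A, measurable A -> nu A = (m1 A - m2 A)%E.
Proof.
exists (jordan_pos (hahn_posneg nu)), (jordan_neg (hahn_posneg nu)) => A mA.
by rewrite {1}(jordan_decomp (hahn_posneg nu) mA)/= /cadd/= cscaleN1.
Qed.

Lemma eq_charge_integral nu1 nu2 f : bounded_measurable f ->
  (forall A, measurable A -> nu1 A = nu2 A) ->
  charge_integral nu1 f = charge_integral nu2 f.
Proof.
move=> bf e; have [m1 [m2 h]] := jordan_difference nu1.
rewrite (charge_integral_diff bf h) (@charge_integral_diff nu2 m1 m2)// => A mA.
by rewrite -e// h.
Qed.

Lemma charge_integral_measure m f : bounded_measurable f ->
  charge_integral (charge_of_finite_measure m) f = \int[m]_x f x.
Proof.
move=> bf; rewrite (@charge_integral_diff _ m mzero)//.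
  by rewrite /Rintegral [X in _ - fine X]integral_measure_zero subr0.
by move=> A mA; rewrite /charge_of_finite_measure /mzero sube0.
Qed.

Lemma charge_integral_cadd nu1 nu2 f : bounded_measurable f ->
  charge_integral (cadd nu1 nu2) f = charge_integral nu1 f + charge_integral nu2 f.
Proof.
move=> bf; have [m1 [m2 h]] := jordan_difference nu1.
have [n1 [n2 k]] := jordan_difference nu2.
rewrite (charge_integral_diff bf h) (charge_integral_diff bf k).
rewrite (@charge_integral_diff _ (finite_add m1 n1) (finite_add m2 n2))//.
  by rewrite !Rintegral_finite_add//; ring.
move=> A mA; rewrite /= !finite_addE /cadd h// k//.
rewrite -[m1 A]fineK ?fin_num_measure// -[n1 A]fineK ?fin_num_measure//.
rewrite -[m2 A]fineK ?fin_num_measure// -[n2 A]fineK ?fin_num_measure//.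
by rewrite -!(EFinB, EFinD); congr EFin; ring.
Qed.

Lemma charge_integral_copp nu f : bounded_measurable f ->
  charge_integral (copp nu) f = - charge_integral nu f.
Proof.
move=> bf; have [m1 [m2 h]] := jordan_difference nu.
rewrite (charge_integral_diff bf h) (@charge_integral_diff _ m2 m1)//.
  by rewrite opprB.
move=> A mA; rewrite /= /copp/= h// fin_num_oppeB ?fin_num_measure//.
by rewrite addeC.
Qed.

Lemma charge_integral_cscale c nu f : bounded_measurable f ->
  charge_integral (cscale c nu) f = c * charge_integral nu f.
Proof.
move=> bf; wlog c0 : c / 0 <= c => [h|].
  have [c0|c0] := leP 0 c; first exact: h.
  have := h (- c); rewrite oppr_ge0 => /(_ (ltW c0)).
  rewrite (@eq_charge_integral (cscale (- c) nu) (copp (cscale c nu)))//.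
    by rewrite charge_integral_copp// mulNr => /oppr_inj.
  by move=> A mA; rewrite /= /copp/= /cscale EFinN mulNe.
have [m1 [m2 h]] := jordan_difference nu.
rewrite (charge_integral_diff bf h).
pose k := NngNum c0.
rewrite (@charge_integral_diff _ (mscale k m1) (mscale k m2))//.
  by rewrite !Rintegral_mscale// mulrBr.
move=> A mA; rewrite /= /cscale h// /mscale/= muleBr//.
by rewrite fin_num_adde_defr// fin_num_measure.
Qed.

Lemma charge_integralN nu f : bounded_measurable f ->
  charge_integral nu (fun x => - f x) = - charge_integral nu f.
Proof. by move=> bf; rewrite /charge_integral !RintegralN_bounded//; ring. Qed.

End charge_integral_theory.

(** The image of a Jordan decomposition need not be one, since masses of opposite sign may be
    merged; it is still a difference of finite measures. *)
Lemma charge_integral_image d d' (T : measurableType d) (T' : measurableType d')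
    (R : realType) (g : T -> T') (mg : measurable_fun setT g)
    (nu : {charge set T -> \bar R}) (f : T' -> R) : bounded_measurable f ->
  charge_integral (image_charge mg nu) f = charge_integral nu (fun x => f (g x)).
Proof.
move=> bf; have [m1 [m2 h]] := jordan_difference nu.
have bfg : bounded_measurable (fun x => f (g x)).
  case: bf => mf [M fM]; split; last by exists M => x; exact: fM.
  exact: measurableT_comp.
rewrite (charge_integral_diff bfg h) -!(Rintegral_image_measure mg)//.
apply: (@charge_integral_diff _ _ _ _ (image_measure mg m1) (image_measure mg m2)) => // A mA.
rewrite /= /image_charge /image_measure /pushforward h//.
by rewrite -[X in measurable X]setTI; exact: mg.
Qed.

(** * Densities of charges *)

Section radon_nikodym_theory.
Context d (T : measurableType d) (R : realType).
Variable mu : {finite_measure set T -> \bar R}.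
Implicit Types (nu : {charge set T -> \bar R}) (f : T -> R).

Lemma integrable_RN_bounded nu f : nu `<< mu -> bounded_measurable f ->
  mu.-integrable setT (fun x => (f x)%:E * Radon_Nikodym nu mu x)%E.
Proof.
move=> numu [mf [M fM]]; have iRN := Radon_Nikodym_integrable numu.
apply: (@le_integrable _ _ _ mu setT measurableT _
  (fun x => M%:E * Radon_Nikodym nu mu x)%E) => //.
- apply: emeasurable_funM; first exact/measurable_EFinP.
  exact: measurable_int iRN.
- move=> x _; rewrite !abseM lee_wpmul2r// lee_fin.
  by rewrite (le_trans (fM x))// ler_norm.
- exact: integrableZl.
Qed.

Lemma integrable_fine_RN nu : nu `<< mu ->
  mu.-integrable setT (EFin \o (fun x => fine (Radon_Nikodym nu mu x))).
Proof.
move=> numu; have := Radon_Nikodym_integrable numu; congr integrable.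
by apply/funext => x /=; rewrite fineK// Radon_Nikodym_fin_num.
Qed.

(** Both Jordan parts are dominated by [mu], and the density of [nu] is almost everywhere the
    difference of theirs, as all integrals over measurable sets agree. *)
Lemma charge_integral_RN nu f : nu `<< mu -> bounded_measurable f ->
  charge_integral nu f = \int[mu]_x (f x * fine (Radon_Nikodym nu mu x)).
Proof.
move=> numu bf; rewrite /charge_integral.
pose P : {finite_measure set T -> \bar R} := jordan_pos (hahn_posneg nu).
pose N : {finite_measure set T -> \bar R} := jordan_neg (hahn_posneg nu).
rewrite -[X in X - _ = _]/(\int[P]_x f x) -[X in _ - X = _]/(\int[N]_x f x).
have Pmu : P `<< mu by exact: jordan_pos_dominates.
have Nmu : N `<< mu by exact: jordan_neg_dominates.
have cPmu : charge_of_finite_measure P `<< mu by exact: Pmu.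
have cNmu : charge_of_finite_measure N `<< mu by exact: Nmu.
have iP := integrable_RN_bounded cPmu bf.
have iN := integrable_RN_bounded cNmu bf.
have ae : ae_eq mu setT (Radon_Nikodym nu mu)
    (Radon_Nikodym (charge_of_finite_measure P) mu \-
     Radon_Nikodym (charge_of_finite_measure N) mu)%E.
  apply: integral_ae_eq => //.
  - exact: Radon_Nikodym_integrable.
  - by apply: emeasurable_funB; exact: measurable_int (Radon_Nikodym_integrable _).
  - move=> A _ mA; rewrite integralB//; last 2 first.
    + by apply: integrableS (Radon_Nikodym_integrable cPmu).
    + by apply: integrableS (Radon_Nikodym_integrable cNmu).
    rewrite -!Radon_Nikodym_integral//.
    by rewrite {1}(jordan_decomp (hahn_posneg nu) mA)/= /cadd/= cscaleN1.
rewrite /Rintegral -fineB; last 2 first.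
- by apply: integrable_fin_num => //; exact: bounded_measurable_integrable.
- by apply: integrable_fin_num => //; exact: bounded_measurable_integrable.
rewrite -(Radon_Nikodym_change_of_variables Pmu)//; last exact: bounded_measurable_integrable.
rewrite -(Radon_Nikodym_change_of_variables Nmu)//; last exact: bounded_measurable_integrable.
rewrite -integralB//; congr fine.
apply: ae_eq_integral => //.
- by apply: emeasurable_funB; [exact: measurable_int iP|exact: measurable_int iN].
- apply/measurable_EFinP/measurable_funM; first by case: bf.
  exact/measurable_EFinP/(measurable_int mu)/integrable_fine_RN.
- apply: filterS ae => x /(_ I) e _.
  rewrite EFinM fineK ?Radon_Nikodym_fin_num// e muleBr//.
  by rewrite fin_num_adde_defr// Radon_Nikodym_fin_num.
Qed.

Lemma fine_RN_integral nu A : nu `<< mu -> measurable A ->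
  \int[mu]_(x in A) fine (Radon_Nikodym nu mu x) = fine (nu A).
Proof.
move=> numu mA; rewrite (Radon_Nikodym_integral numu mA); congr fine.
by apply: eq_integral => x _; rewrite fineK// Radon_Nikodym_fin_num.
Qed.

(** On the set where [f] is negative the hypothesis forces the integral of the absolute value to
    vanish. *)
Lemma integral_ge0_ae_ge0 f : mu.-integrable setT (EFin \o f) ->
  (forall A, measurable A -> 0 <= \int[mu]_(x in A) f x) ->
  {ae mu, forall x, 0 <= f x}.
Proof.
move=> If f0; have mf : measurable_fun setT f by exact/measurable_EFinP/(measurable_int mu).
pose A := [set x | f x < 0].
have mA : measurable A.
  rewrite (_ : A = setT `&` f @^-1` `]-oo, 0[%classic); first exact: mf.
  by rewrite setTI; apply/seteqP; split => x /=; rewrite in_itv.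
have IA : mu.-integrable A (EFin \o f) by exact: integrableS If.
have e : (\int[mu]_(x in A) `|(f x)%:E| = 0)%E.
  rewrite (_ : (\int[mu]_(x in A) `|(f x)%:E| = \int[mu]_(x in A) (- (f x)%:E))%E); last first.
    by apply: eq_integral => x; rewrite inE /A/= => fx; rewrite ltr0_norm.
  have fN : (0 <= \int[mu]_(x in A) (- (f x)%:E))%E.
    by apply: integral_ge0 => x; rewrite /A/= lee_fin oppr_ge0; exact: ltW.
  apply/eqP; rewrite eq_le fN andbT.
  rewrite integralN/=; last by rewrite integrable_add_def.
  rewrite leeNl oppe0 -[X in (_ <= X)%E]fineK; last exact: integrable_fin_num.
  by rewrite lee_fin; exact: f0.
have := (ae_eq_integral_abs mu mA (measurable_int mu IA)).1 e.
apply: filterS => x h; rewrite leNgt; apply/negP => fx.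
by have := h fx => -[f0x]; move: fx; rewrite f0x ltxx.
Qed.

Lemma ae_eq_fine_RN nu1 nu2 : nu1 `<< mu -> nu2 `<< mu ->
  (forall A, measurable A -> nu1 A = nu2 A) ->
  {ae mu, forall x, fine (Radon_Nikodym nu1 mu x) = fine (Radon_Nikodym nu2 mu x)}.
Proof.
move=> n1 n2 e.
suff : ae_eq mu setT (Radon_Nikodym nu1 mu) (Radon_Nikodym nu2 mu).
  by apply: filterS => x /(_ I) ->.
apply: integral_ae_eq => //.
- exact: Radon_Nikodym_integrable.
- by move=> A _ mA; rewrite -!Radon_Nikodym_integral// e.
Qed.

End radon_nikodym_theory.

(** * Uniqueness of Fourier coefficients *)

Section complex_uniqueness.
Context (R : realType) (nu : nat).
Implicit Types (G H : complex_measure (torus R nu) R) (p : 'rV[int]_nu).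

Lemma torus_char_cis p (x : torus R nu) :
  torus_char p x = cis (\sum_(k < nu) (p 0 k)%:~R * arc_val (tnth x k)).
Proof. by []. Qed.

Lemma torus_charN p (x : torus R nu) : torus_char (- p) x = conjc (torus_char p x).
Proof.
rewrite !torus_char_cis -cisN; congr cis; rewrite -sumrN.
by apply: eq_bigr => k _; rewrite mxE intrN mulNr.
Qed.

Let measurable_phase p :
  measurable_fun setT (fun x : torus R nu => \sum_(k < nu) (p 0 k)%:~R * arc_val (tnth x k)).
Proof.
apply: measurable_sum => k; apply: measurable_funM => //.
by apply: (measurableT_comp (@measurable_arc_val R)); exact: measurable_tnth.
Qed.

Lemma bounded_measurable_Re_char p :
  bounded_measurable (fun x : torus R nu => complex.Re (torus_char p x)).
Proof. exact: (bounded_measurable_cos measurable_phase p). Qed.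

Lemma bounded_measurable_Im_char p :
  bounded_measurable (fun x : torus R nu => complex.Im (torus_char p x)).
Proof. exact: (bounded_measurable_sin measurable_phase p). Qed.

Hint Resolve bounded_measurable_Re_char bounded_measurable_Im_char : core.

(** Writing [n1 = a1 - b1] and [n2 = a2 - b2] turns the claim into [a1 + b2 = a2 + b1], an equality
    of finite measures. *)
Lemma torus_charge_eq (n1 n2 : {charge set (torus R nu) -> \bar R}) :
  (forall p, charge_integral n1 (fun x => complex.Re (torus_char p x)) =
             charge_integral n2 (fun x => complex.Re (torus_char p x))) ->
  (forall p, charge_integral n1 (fun x => complex.Im (torus_char p x)) =
             charge_integral n2 (fun x => complex.Im (torus_char p x))) ->
  forall A, measurable A -> n1 A = n2 A.
Proof.
move=> eRe eIm A mA.
have [a1 [b1 h1]] := jordan_difference n1; have [a2 [b2 h2]] := jordan_difference n2.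
suff : finite_add a1 b2 A = finite_add a2 b1 A.
  rewrite !finite_addE h1// h2//.
  rewrite -[a1 A]fineK ?fin_num_measure// -[b1 A]fineK ?fin_num_measure//.
  rewrite -[a2 A]fineK ?fin_num_measure// -[b2 A]fineK ?fin_num_measure//.
  by rewrite -!(EFinD, EFinB) => -[h]; congr EFin; lra.
apply: (@torus_measure_eq R nu (finite_add a1 b2) (finite_add a2 b1)) => // p;
  rewrite !Rintegral_finite_add//.
  have := eRe p; rewrite (charge_integral_diff _ h1)// (charge_integral_diff _ h2)//; lra.
have := eIm p; rewrite (charge_integral_diff _ h1)// (charge_integral_diff _ h2)//; lra.
Qed.

Lemma complex_measure_eq G H :
  (forall p, complex_integral G (torus_char p) = complex_integral H (torus_char p)) ->
  forall A, measurable A -> G A = H A.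
Proof.
move=> e A mA.
have addsub (a b a' b' : R) : a - b = a' - b' -> a + b = a' + b' -> a = a' /\ b = b'.
  by move=> ? ?; split; lra.
(* The coefficient at [p] mixes the two charges. Cosine being even and sine odd in [p], sums and
   differences of the coefficients at [p] and [- p] separate them. *)
have sep p :
    [/\ charge_integral (cm_re G) (fun x => complex.Re (torus_char p x)) =
        charge_integral (cm_re H) (fun x => complex.Re (torus_char p x)),
        charge_integral (cm_re G) (fun x => complex.Im (torus_char p x)) =
        charge_integral (cm_re H) (fun x => complex.Im (torus_char p x)),
        charge_integral (cm_im G) (fun x => complex.Re (torus_char p x)) =
        charge_integral (cm_im H) (fun x => complex.Re (torus_char p x)) &
        charge_integral (cm_im G) (fun x => complex.Im (torus_char p x)) =
        charge_integral (cm_im H) (fun x => complex.Im (torus_char p x))].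
  have := e (- p); have := e p; rewrite /complex_integral => -[h1 h2] [].
  have reN : (fun x => complex.Re (torus_char (- p) x)) =
      (fun x => complex.Re (torus_char p x)) :> (torus R nu -> R).
    by apply/funext => x; rewrite torus_charN.
  have imN : (fun x => complex.Im (torus_char (- p) x)) =
      (fun x => - complex.Im (torus_char p x)) :> (torus R nu -> R).
    by apply/funext => x; rewrite torus_charN.
  rewrite reN imN !charge_integralN// opprK opprK => h3.
  rewrite addrC [X in _ = X -> _]addrC => h4.
  move: h2; rewrite addrC [X in _ = X -> _]addrC => h2.
  by have [-> ->] := addsub _ _ _ _ h1 h3; have [-> ->] := addsub _ _ _ _ h4 h2.
rewrite /cm_val; congr (fine _ +i* fine _).
  by apply: torus_charge_eq => // p; case: (sep p).
by apply: torus_charge_eq => // p; case: (sep p).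
Qed.

End complex_uniqueness.

(** * Measures on bit streams *)

Section bitstreams.

Definition bitstream_gen : set (set (nat -> bool)) :=
  [set [set c : nat -> bool | c n] | n in [set: nat]].

Definition bitstream := g_sigma_algebraType bitstream_gen.

(* The first [n] bits, most recent first. *)
Fixpoint prefix n (c : nat -> bool) : seq bool :=
  if n is m.+1 then c m :: prefix m c else [::].

Lemma size_prefix n c : size (prefix n c) = n.
Proof. by elim: n => //= n ->. Qed.

Lemma nth_prefix n c k : (k < n)%N -> nth false (rev (prefix n c)) k = c k.
Proof.
elim: n k => // n IH k; rewrite ltnS leq_eqVlt => /predU1P[->|kn] /=.
  by rewrite rev_cons nth_rcons size_rev size_prefix ltnn eqxx.
by rewrite rev_cons nth_rcons size_rev size_prefix kn IH.
Qed.

Lemma measurable_bit d (T : measurableType d) (f : T -> bitstream) n :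
  measurable_fun setT f -> measurable [set x | f x n].
Proof.
move=> mf; have := mf measurableT [set c | c n]; rewrite setTI; apply.
by apply: sub_sigma_algebra; exists n.
Qed.

Lemma measurable_fun_bitstream d (T : measurableType d) (f : T -> bitstream) :
  (forall n, measurable [set x | f x n]) -> measurable_fun setT f.
Proof.
move=> mf; apply: (@measurability _ _ _ _ setT f bitstream_gen) => //.
by move=> _ [_ [n _ <-] <-]; rewrite setTI; exact: mf.
Qed.

Lemma measurable_prefix n s : measurable [set c : bitstream | prefix n c = s].
Proof.
elim: n s => [|n IH] s /=.
  have [->|s0] := eqVneq s [::]; first by rewrite (_ : mkset _ = setT)//; apply/seteqP.
  rewrite (_ : mkset _ = set0)//; apply/seteqP; split => // c /= e.
  by move: s0; rewrite -e.
case: s => [|b s].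
  by rewrite (_ : mkset _ = set0)//; apply/seteqP; split.
have mn : measurable [set c : bitstream | c n] by exact: (@measurable_bit _ _ id).
rewrite (_ : mkset _ = (if b then [set c : bitstream | c n] else ~` [set c : bitstream | c n]) `&`
    [set c : bitstream | prefix n c = s]).
  by apply: measurableI => //; case: b => //; exact: measurableC.
apply/seteqP; split => c /=; first by move=> [<- <-]; split => //; case: ifPn => [|/negP].
by move=> [cb <-]; case: b cb => [->//|/negP/negbTE ->].
Qed.

(** Expansion into cylinder indicators, by which integrals of functions of finitely many bits depend
    on cylinder masses only. *)
Lemma prefix_sum (R : pzSemiRingType) n (h : seq bool -> R) c :
  h (prefix n c) = \sum_(s : n.-tuple bool) h s * (prefix n c == s)%:R.
Proof.
pose s0 : n.-tuple bool := Tuple (introT eqP (size_prefix n c)).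
rewrite (bigD1 s0)//= eqxx mulr1 big1 ?addr0// => s ss0.
rewrite (_ : _ == _ = false) ?mulr0//; apply/eqP => e; move/eqP: ss0; apply.
exact: val_inj.
Qed.

Lemma prefix_indicE (R : realType) n s :
  (fun c : bitstream => (prefix n c == s)%:R) =
  \1_[set c : bitstream | prefix n c = s] :> (bitstream -> R).
Proof.
by apply/funext => c; rewrite indicE; congr (nat_of_bool _)%:R; apply/eqP/idP; rewrite inE.
Qed.

Lemma bounded_measurable_prefix (R : realType) n (h : seq bool -> R) :
  bounded_measurable (fun c : bitstream => h (prefix n c)).
Proof.
rewrite (_ : (fun c => _) = fun c => \sum_(s : n.-tuple bool) h s * (prefix n c == s)%:R); last first.
  by apply/funext => c; exact: prefix_sum.
apply: bounded_measurable_sum => s; apply: bounded_measurableZ; rewrite prefix_indicE.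
by apply: (@bounded_measurable_indic _ bitstream R); exact: measurable_prefix.
Qed.

Lemma Rintegral_prefix (R : realType) (m : {finite_measure set bitstream -> \bar R})
    n (h : seq bool -> R) :
  \int[m]_c h (prefix n c) =
  \sum_(s : n.-tuple bool) h s * fine (m [set c | prefix n c = s]).
Proof.
under eq_Rintegral do rewrite prefix_sum.
have bi (s : seq bool) := bounded_measurable_indic R (measurable_prefix n s).
rewrite Rintegral_sum_bounded => [|s]; last first.
  by apply: bounded_measurableZ; rewrite prefix_indicE.
apply: eq_bigr => s _; rewrite RintegralZ_bounded ?prefix_indicE//.
by rewrite Rintegral_indic//; exact: measurable_prefix.
Qed.

End bitstreams.

(* Weights that are consistent under appending a bit are realised by repeatedly
   cutting the interval [0, w [::][: the strings of length [n] label consecutive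
   intervals, [s] having length [w s] and left end [cut s]. *)
Section subdivision.
Context (R : realType).
Variable w : seq bool -> R.
Hypothesis w_ge0 : forall s, 0 <= w s.
Hypothesis wD : forall s, w s = w (false :: s) + w (true :: s).

Fixpoint cut (s : seq bool) : R :=
  if s is b :: s' then cut s' + (if b then w (false :: s') else 0) else 0.

Fixpoint digits n (u : R) : seq bool :=
  if n is m.+1 then
    let s := digits m u in (cut s + w (false :: s) <= u) :: s
  else [::].

Definition subdivision (u : R) : bitstream := fun n => head false (digits n.+1 u).

Lemma prefix_subdivision n u : prefix n (subdivision u) = digits n u.
Proof. by elim: n => //= n ->. Qed.

(** Half-open intervals make the labels of one level a partition; a string of weight zero has an
    empty interval and is never read off. *)
Lemma digitsP n u s : 0 <= u < w [::] ->
  (digits n u = s) <-> (size s = n /\ cut s <= u < cut s + w s).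
Proof.
move=> u01; elim: n s => [|n IH] [|b s] /=.
- by rewrite add0r.
- by split => // -[].
- by split => // -[].
- have w0 := wD s; split.
    move=> [<- e]; have [-> /andP[h1 h2]] := (IH s).1 e; split=> //; rewrite e.
    have [h3|h3] := leP (cut s + w (false :: s)) u; first by rewrite h3 -addrA -w0.
    by rewrite addr0 h1.
  move=> [[sn]] /andP[h1 h2].
  have e : digits n u = s.
    apply/IH; split=> //; case: b h1 h2; rewrite ?addr0 => h1 h2; apply/andP; split.
    - by apply: le_trans h1; rewrite lerDl.
    - by rewrite w0 addrA.
    - by [].
    - by apply: lt_le_trans h2 _; rewrite lerD2l w0 lerDl.
  rewrite e; congr cons; case: b h1 h2; first by move=> -> _.
  by rewrite addr0 => _ h; apply/negbTE; rewrite -ltNge.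
Qed.

Lemma cut_ge0 s : 0 <= cut s.
Proof. by elim: s => //= b s IH; rewrite addr_ge0//; case: b. Qed.

Lemma cut_le s : cut s + w s <= w [::].
Proof.
elim: s => [|b s IH] /=; first by rewrite add0r.
by apply: le_trans IH; rewrite -addrA lerD2l (wD s); case: b; rewrite ?add0r ?lerDl.
Qed.

Lemma digits_itv n s : size s = n ->
  `[0, w [::][%classic `&` [set u | digits n u = s] = `[cut s, cut s + w s[%classic.
Proof.
move=> sn; apply/seteqP; split => u /=; rewrite !in_itv/=.
  by move=> [u01 /(digitsP _ _ u01)[]].
move=> /andP[h1 h2]; have u01 : 0 <= u < w [::].
  by rewrite (le_trans (cut_ge0 s))//= (lt_le_trans h2)// cut_le.
by split => //; apply/(digitsP n s u01); rewrite h1.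
Qed.

Lemma measurable_digits n s : measurable [set u | digits n u = s].
Proof.
elim: n s => [|n IH] s /=.
  have [->|s0] := eqVneq s [::]; first by rewrite (_ : mkset _ = setT)//; apply/seteqP.
  rewrite (_ : mkset _ = set0)//; apply/seteqP; split => // c /= e.
  by move: s0; rewrite -e.
case: s => [|b s].
  by rewrite (_ : mkset _ = set0)//; apply/seteqP; split.
rewrite (_ : mkset _ = (if b then `[cut s + w (false :: s), +oo[%classic else
    `]-oo, cut s + w (false :: s)[%classic) `&` [set u | digits n u = s]).
  by apply: measurableI => //; case: b => //; exact: measurable_itv.
apply/seteqP; split => u /=.
  by move=> [<- ->]; split=> //; case: leP => h; rewrite /= in_itv/= ?andbT.
move=> [h1 ->]; congr cons.
case: b h1; rewrite /= in_itv/= ?andbT => // h1.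
by apply/negbTE; rewrite -ltNge.
Qed.

Lemma measurable_subdivision : measurable_fun setT (subdivision : R -> bitstream).
Proof.
apply: measurable_fun_bitstream => n.
rewrite (_ : [set x | _] = \bigcup_(s in [set: n.-tuple bool]) [set u | digits n.+1 u = true :: s]).
  apply: fin_bigcup_measurable => //.
  by move=> s _; exact: measurable_digits.
apply/seteqP; split => u /=.
  rewrite /subdivision/= => h.
  exists (Tuple (introT eqP (etrans (congr1 size (esym (prefix_subdivision n u))) (size_prefix _ _)))) => //=.
  by rewrite h.
by move=> [s _] /= [h _].
Qed.

(** The intersection with [[0, w [::][] is there because points outside also receive digits: only
    false to the left, only true to the right. *)
Lemma lebesgue_subdivision s :
  (lebesgue_measure (`[0%R, w [::][%classic `&`
     [set u | prefix (size s) (subdivision u) = s]) = (w s)%:E)%E.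
Proof.
rewrite (_ : [set u | _] = [set u | digits (size s) u = s]); last first.
  by apply/seteqP; split => u /=; rewrite prefix_subdivision.
rewrite digits_itv// lebesgue_measure_itv/= lte_fin.
case: ltP => h; first by rewrite -EFinD addrAC subrr add0r.
by congr EFin; apply/eqP; rewrite eq_le w_ge0/=; move: h; rewrite gerDl.
Qed.

End subdivision.

Lemma fmap_ultra (T V : Type) (f : T -> V) (U : set_system T) :
  UltraFilter U -> UltraFilter (fmap f U).
Proof.
move=> UU; split; first exact: fmap_proper_filter.
move=> G PG UG; apply/seteqP; split => // A GA.
have [//|UA] := in_ultra_setVsetC (f @^-1` A) UU.
exfalso; apply: (@filter_not_empty _ G); rewrite -(setICr A).
by apply: filterI => //; exact: UG.
Qed.

Section bitstream_compactness.
Context (R : realType) (I : nat -> finType) (y : forall n, I n -> bitstream).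
Variables (om : forall n, I n -> R) (K : R).
Hypothesis om_ge0 : forall n i, 0 <= @om n i.
Hypothesis omK : forall n, \sum_i @om n i = K.

(** Cylinder masses of the discrete measure with weight [om n i] at [y n i]. *)
Let W n (s : seq bool) : R := \sum_i @om n i * (prefix (size s) (@y n i) == s)%:R.

Let W_ge0 n s : 0 <= W n s.
Proof. by apply: sumr_ge0 => i _; rewrite mulr_ge0. Qed.

Let W_leK n s : W n s <= K.
Proof.
rewrite -(omK n); apply: ler_sum => i _; rewrite ler_piMr//.
by case: (_ == _).
Qed.

Let WD n s : W n s = W n (false :: s) + W n (true :: s).
Proof.
rewrite /W -big_split/=; apply: eq_bigr => i _; rewrite -mulrDr; congr (_ * _).
rewrite !eqseq_cons; case: (y _ _); rewrite /= ?add0r ?addr0//.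
Qed.

(** Each cylinder mass stays in [0, K] and so converges along the ultrafilter; the limits are
    consistent weights, realised by [subdivision]. The measure is chosen before [F]: uniform
    approximation by functions of finitely many bits transfers every such integral to the limit. *)
Lemma bitstream_limit_measure : exists M : {finite_measure set bitstream -> \bar R},
  forall (F : bitstream -> R) (l : R), bounded_measurable F ->
    (forall e, 0 < e -> exists J (h : seq bool -> R), forall c, `|F c - h (prefix J c)| <= e) ->
    \sum_i @om n i * F (@y n i) @[n --> \oo] --> l ->
    \int[M]_c F c = l.
Proof.
have [U [UU oU]] := @ultraFilterLemma nat (nbhs \oo) _.
have wP s : exists l : R, W n s @[n --> U] --> l.
  have cK := @segment_compact R 0 K; rewrite compact_ultra in cK.
  have UW : (fmap (fun n => W n s) U) `[0, K]%classic.
    by apply: nearW => n; rewrite /= in_itv/= W_ge0 W_leK.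
  by have [l [_ Ul]] := cK (fmap (fun n => W n s) U) (fmap_ultra _ UU) UW; exists l.
pose w s := sval (cid (wP s)); have wE s : W n s @[n --> U] --> w s := svalP (cid (wP s)).
have w_ge0 s : 0 <= w s.
  rewrite -(cvg_lim (@Rhausdorff R) (wE s)); apply: limr_ge; first exact: cvgP (wE s).
  by apply: nearW => n; exact: W_ge0.
have wD s : w s = w (false :: s) + w (true :: s).
  rewrite -(cvg_lim (@Rhausdorff R) (wE s)); under eq_fun do rewrite WD.
  by apply: (cvg_lim (@Rhausdorff R)); exact: cvgD.
have mI : measurable `[0%R, w [::][%classic by exact: measurable_itv.
have foo : (@lebesgue_measure R `[0%R, w [::][%classic < +oo)%E.
  by rewrite lebesgue_measure_itv; case: ifP => // _; rewrite -EFinD ltry.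
pose M0 : {finite_measure set (measurableTypeR R) -> \bar R} :=
  @mfrestr _ _ R _ (@lebesgue_measure R : {measure set (measurableTypeR R) -> \bar R}) mI foo.
pose M : {finite_measure set bitstream -> \bar R} :=
  @image_measure _ _ (measurableTypeR R) _ _ _ (measurable_subdivision w) M0.
exists M => F l bF Fapp Fl.
have Mw s : M [set c | prefix (size s) c = s] = (w s)%:E.
  by rewrite -(lebesgue_subdivision w_ge0 wD) setIC.
have Ul : \sum_i @om n i * F (@y n i) @[n --> U] --> l.
  by apply: cvg_trans Fl; exact: cvg_app.
have MT : fine (M setT) = w [::].
  by have := Mw [::]; rewrite (_ : [set _ | _] = setT) => [->//|]; apply/seteqP.
(* Replacing [F] by a function of a prefix costs [e] times the mass [w [::]] in the integral and
   [e * K] in the discrete sums. *)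
have close e : 0 < e -> `|\int[M]_c F c - l| <= e * (w [::] + K).
  move=> e0; have [J [h Fh]] := Fapp e e0.
  have bh := bounded_measurable_prefix J h.
  pose a := \int[M]_c h (prefix J c).
  have Fa : `|\int[M]_c F c - a| <= e * w [::].
    rewrite -RintegralB_bounded//; have bd := bounded_measurableB bF bh.
    rewrite (le_trans (le_normr_Rintegral _ _))//; first exact: bounded_measurable_integrable.
    rewrite -MT -(Rintegral_cst M measurableT e); apply: le_Rintegral => //.
    - have bn : bounded_measurable (fun c => `|F c - h (prefix J c)|).
        case: bd => mb [B bB]; split; first by apply: measurableT_comp.
        by exists B => c; rewrite normr_id.
      exact: bounded_measurable_integrable.
    - exact: finite_measure_integrable_cst.
  have la : `|a - l| <= e * K.
    have Ua : \sum_i @om n i * h (prefix J (@y n i)) @[n --> U] --> a.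
      rewrite /a Rintegral_prefix.
      have -> : (fun n => \sum_i @om n i * h (prefix J (@y n i))) =
          (fun n => \sum_(s : J.-tuple bool) h s * W n s).
        apply/funext => n; under eq_bigr do rewrite (prefix_sum J h) mulr_sumr.
        rewrite exchange_big/=; apply: eq_bigr => s _.
        rewrite /W mulr_sumr; apply: eq_bigr => i _; rewrite size_tuple; ring.
      apply: (cvg_big (@add_continuous R)) => s _; apply: cvgMr.
      by have := Mw s; rewrite size_tuple => ->; exact: wE.
    have Uc : `|\sum_i @om n i * h (prefix J (@y n i)) - \sum_i @om n i * F (@y n i)|
        @[n --> U] --> `|a - l| by apply: cvg_norm; exact: cvgB.
    rewrite -(cvg_lim (@Rhausdorff R) Uc); apply: limr_le; first exact: cvgP Uc.
    apply: nearW => n; rewrite -sumrB -(omK n) mulr_sumr.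
    rewrite (le_trans (ler_norm_sum _ _ _))//; apply: ler_sum => i _.
    by rewrite -mulrBr normrM ger0_norm// mulrC ler_wpM2r// distrC.
  rewrite mulrDr (le_trans _ (lerD Fa la))// (le_trans _ (ler_normD _ _))//.
  by rewrite addrA subrK.
have K0 : 0 <= K by rewrite -(omK 0) sumr_ge0.
apply/eqP; rewrite -subr_eq0 -normr_le0; apply/ler_addgt0Pr => e e0; rewrite add0r.
(* The summand 1 keeps the divisor positive when all masses are zero. *)
have wK : 0 < w [::] + K + 1 by rewrite ltr_wpDl// addr_ge0.
have := close (e / (w [::] + K + 1)) (divr_gt0 e0 wK) => /le_trans; apply.
by rewrite mulrAC ler_pdivrMr// ler_pM2l// lerDl.
Qed.

End bitstream_compactness.

(** * Herglotz's theorem on the torus *)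

Section complex_parts.
Context (R : realType).
Implicit Types (z w : R[i]).

Lemma ReD z w : complex.Re (z + w) = complex.Re z + complex.Re w.
Proof. by case: z; case: w. Qed.

Lemma ImD z w : complex.Im (z + w) = complex.Im z + complex.Im w.
Proof. by case: z; case: w. Qed.

Lemma Re_sum (I : Type) (s : seq I) (F : I -> R[i]) :
  complex.Re (\sum_(i <- s) F i) = \sum_(i <- s) complex.Re (F i).
Proof. exact: (big_morph _ ReD erefl). Qed.

Lemma Im_sum (I : Type) (s : seq I) (F : I -> R[i]) :
  complex.Im (\sum_(i <- s) F i) = \sum_(i <- s) complex.Im (F i).
Proof. exact: (big_morph _ ImD erefl). Qed.

Lemma ReZ (c : R) z : complex.Re (c%:C * z) = c * complex.Re z.
Proof. by case: z => a b /=; rewrite mul0r subr0. Qed.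

Lemma ImZ (c : R) z : complex.Im (c%:C * z) = c * complex.Im z.
Proof. by case: z => a b /=; rewrite mul0r addr0. Qed.

Lemma complex_ge0 z : (0 <= z) = (complex.Im z == 0) && (0 <= complex.Re z).
Proof. by rewrite lecE. Qed.

End complex_parts.

Section trigonometric_estimates.
Context (R : realType).
Implicit Types (x y : R).

Lemma cos_lipschitz x y : `|cos x - cos y| <= `|x - y|.
Proof.
wlog xy : x y / y < x => [h|].
  have [->|] := eqVneq x y; first by rewrite !subrr.
  by rewrite neq_lt => /orP[|] h'; [rewrite distrC [leRHS]distrC|]; exact: h.
have [c _ ->] := @MVT R (@cos R) (fun x => - sin x) y x xy
  (fun c _ => is_derive_cos c) (continuous_subspaceT (@continuous_cos R)).
by rewrite normrM normrN ler_piMl// ler_norml sin_geN1 sin_le1.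
Qed.

Lemma sin_lipschitz x y : `|sin x - sin y| <= `|x - y|.
Proof.
wlog xy : x y / y < x => [h|].
  have [->|] := eqVneq x y; first by rewrite !subrr.
  by rewrite neq_lt => /orP[|] h'; [rewrite distrC [leRHS]distrC|]; exact: h.
have [c _ ->] := @MVT R (@sin R) (@cos R) y x xy
  (fun c _ => is_derive_sin c) (continuous_subspaceT (@continuous_sin R)).
by rewrite normrM ler_piMl// ler_norml cos_geN1 cos_le1.
Qed.

Lemma cis_neq1 x : 0 < `|x| < pi *+ 2 -> cis x != 1.
Proof.
move=> /andP[x0 xpi]; apply/eqP => -[cx _].
wlog x1 : x x0 xpi cx / 0 < x => [h|].
  have [|xN] := ltP 0 x; first exact: h.
  apply: (h (- x)); rewrite ?normrN ?cosN// oppr_gt0 lt_neqAle xN andbT.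
  by rewrite -normr_eq0 gt_eqF.
(* By the double angle formula [cos x = 1] forces [sin (x / 2) = 0], whereas [x / 2] lies in ]0,
   pi[. *)
have : 0 < sin (x / 2).
  apply: sin_gt0_pi; rewrite divr_gt0//= ltr_pdivrMr// mulr_natr.
  by rewrite gtr0_norm in xpi.
have := cos_mulr2n (x / 2); rewrite -(@mulr_natr _ (x / 2)) divfK// cx.
have := cos2Dsin2 (x / 2); nra.
Qed.

(** Geometric sum of powers of a root of unity, whose ratio differs from 1 for [0 < |z| < N].
    Starting the nodes at [- pi] only contributes a common factor. *)
Lemma sum_cis_grid (N : nat) (z : int) : (0 < N)%N -> (`|z| < N)%N ->
  \sum_(a < N) cis (z%:~R * (- pi + pi *+ 2 * (a%:R / N%:R))) =
  (if z == 0 then N%:R else 0) :> R[i].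
Proof.
move=> N0 zN; have [->|z0] := eqVneq.
  by rewrite (eq_bigr (fun=> 1)) => [|a _]; rewrite ?mul0r ?cis0// sumr_const card_ord.
pose zeta : R[i] := cis (z%:~R * (pi *+ 2) / N%:R).
have NR : N%:R != 0 :> R by rewrite pnatr_eq0 -lt0n.
have zN1 : zeta ^+ N = 1.
  by rewrite -cisMn -[X in cis X]mulr_natr divfK// cis2pi.
have zneq : zeta != 1.
  have pi2 : 0 < (pi : R) *+ 2 by rewrite pmulrn_lgt0 ?pi_gt0.
  apply: cis_neq1; rewrite !normrM normfV normr_nat (gtr0_norm pi2).
  have zR : 0 < `|z%:~R : R| < N%:R.
    rewrite normr_gt0 intr_eq0 z0/= -intr_norm -[N%:R]/((N%:Z)%:~R) ltr_int.
    by rewrite -abszE ltz_nat.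
  move: zR => /andP[z1 z2].
  by rewrite divr_gt0 ?mulr_gt0 ?ltr0n//= ltr_pdivrMr ?ltr0n// mulrC ltr_pM2l.
have -> : \sum_(a < N) cis (z%:~R * (- pi + pi *+ 2 * (a%:R / N%:R))) =
    cis (- (z%:~R * pi)) * \sum_(a < N) zeta ^+ a.
  rewrite mulr_sumr; apply: eq_bigr => a _; rewrite -cisMn -cisD; congr cis.
  by rewrite -mulr_natr; ring.
rewrite (_ : \sum_(a < N) zeta ^+ a = 0) ?mulr0//.
apply: (mulfI (_ : zeta - 1 != 0)); first by rewrite subr_eq0.
by rewrite -subrX1 zN1 subrr mulr0.
Qed.

End trigonometric_estimates.

(** * Binary digits, grid points and angles *)

Section dyadic_expansion.
Context (R : realType).
Implicit Types (b : nat -> bool).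

Definition dyadic_sum b J : R := \sum_(0 <= j < J) (b j)%:R / 2 ^+ j.+1.

Definition dyadic_value b : R := limn (dyadic_sum b).

Lemma dyadic_sum_le b J K : (J <= K)%N ->
  dyadic_sum b J <= dyadic_sum b K <= dyadic_sum b J + (2 ^- J - 2 ^- K).
Proof.
move=> JK; rewrite -(subnKC JK); elim: (K - J)%N => [|k /andP[h1 h2]].
  by rewrite addn0 subrr addr0 lexx.
rewrite /dyadic_sum in h1 h2 *; rewrite addnS big_nat_recr//=.
have := invr_gt0 (2 ^+ (J + k).+1 : R); rewrite exprn_gt0// => p0.
have e : 2 ^- (J + k) = 2 * 2 ^- (J + k).+1 :> R.
  by rewrite exprS invfM mulrA divff// mul1r.
rewrite e in h2.
by case: (b _); rewrite ?mul1r ?mul0r; apply/andP; split; lra.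
Qed.

Lemma cvg_dyadic_sum b : dyadic_sum b @ \oo --> dyadic_value b.
Proof.
apply: nondecreasing_is_cvgn.
  by move=> J K JK; have /andP[] := dyadic_sum_le b JK.
exists 1 => _ [K _ <-]; have /andP[_] := dyadic_sum_le b (leq0n K).
rewrite {2}/dyadic_sum big_nil add0r expr0 invr1 => /le_trans; apply.
by rewrite gerBl invr_ge0 exprn_ge0.
Qed.

(** The truncation error does not depend on the stream, whence uniform approximation of characters
    by functions of finitely many bits. *)
Lemma dyadic_value_le b J : dyadic_sum b J <= dyadic_value b <= dyadic_sum b J + 2 ^- J.
Proof.
have cv := @cvg_dyadic_sum b; apply/andP; split.
  apply: (limr_ge (cvgP _ cv)); near=> K.
  have JK : (J <= K)%N by near: K; exists J.
  by have /andP[] := dyadic_sum_le b JK.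
apply: (limr_le (cvgP _ cv)); near=> K.
have JK : (J <= K)%N by near: K; exists J.
have /andP[_ h] := dyadic_sum_le b JK; apply: le_trans h _.
by rewrite lerD2l gerBl invr_ge0 exprn_ge0.
Unshelve. all: by end_near. Qed.

(** The value 1 occurs, for the stream of ones; this is why angles fill a closed interval and pass
    through [wrap]. *)
Lemma dyadic_value_itv b : 0 <= dyadic_value b <= 1.
Proof.
by have := dyadic_value_le b 0; rewrite /dyadic_sum big_nil add0r expr0 invr1.
Qed.

Lemma dyadic_value_fin b J : (forall j, (J <= j)%N -> b j = false) ->
  dyadic_value b = dyadic_sum b J.
Proof.
move=> b0; apply: (cvg_lim (@Rhausdorff R)); apply: cvg_near_cst; exists J => // K /= JK.
rewrite /dyadic_sum (big_cat_nat (n := J))//= [X in _ + X]big1_seq ?addr0// => j.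
by rewrite mem_index_iota => /andP[_ /andP[Jj _]]; rewrite b0// mul0r.
Qed.

(** Digits are taken most significant first. In the induction the last digit is the parity of [m]
    and the earlier ones are the digits of [m %/ 2]. *)
Lemma dyadic_sum_digits L m : (m < 2 ^ L)%N ->
  dyadic_sum (fun j => odd (m %/ 2 ^ (L.-1 - j))) L = m%:R / 2 ^+ L.
Proof.
elim: L m => [|L IH] m; first by rewrite ltnS leqn0 => /eqP ->; rewrite /dyadic_sum big_nil mul0r.
move=> mL; rewrite /dyadic_sum big_nat_recr//= subnn divn1.
have m2 : (m %/ 2 < 2 ^ L)%N by rewrite ltn_divLR// mulnC -expnS.
rewrite (eq_big_nat _ _ (F2 := fun j => (odd ((m %/ 2) %/ 2 ^ (L.-1 - j)))%:R / 2 ^+ j.+1)).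
  rewrite -/(dyadic_sum (fun j => odd ((m %/ 2) %/ 2 ^ (L.-1 - j))) L) IH//.
  rewrite {3}(divn_eq m 2) modn2 natrD natrM exprS.
  have : (2 : R) ^+ L != 0 by rewrite expf_neq0.
  by move=> ?; field.
move=> j /andP[_ jL]; congr ((nat_of_bool (odd _))%:R / _).
by rewrite -divnMA -expnS; congr (_ %/ 2 ^ _)%N; case: L jL {IH mL m2} => // L; rewrite ltnS => jL; rewrite subSn.
Qed.

End dyadic_expansion.

Section grid.
Context (R : realType) (nu l : nat).
Hypothesis nu_gt0 : (0 < nu)%N.

Definition grid := {ffun 'I_nu -> 'I_(2 ^ l.+1)}.

(* Bit [j * nu + k] of a stream is the [j]-th binary digit of coordinate [k]. *)
Definition coord_bits (c : nat -> bool) (k : nat) : nat -> bool :=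
  fun j => c (j * nu + k)%N.

(** Interleaving the coordinates lets the first [J * nu] bits give [J] digits of each. Digits beyond
    [l] vanish, since the nodes have denominator [2 ^ l.+1]. *)
Definition grid_bits (m : grid) : bitstream := fun i =>
  let j := (i %/ nu)%N in
  (j <= l)%N && odd (m (Ordinal (ltn_pmod i nu_gt0)) %/ 2 ^ (l - j)).

Lemma dyadic_grid_bits (m : grid) (k : 'I_nu) :
  dyadic_value R (coord_bits (grid_bits m) k) = (m k)%:R / (2 ^ l.+1)%:R.
Proof.
have divE j : ((j * nu + k) %/ nu)%N = j by rewrite divnMDl// divn_small ?addn0.
have modE j : Ordinal (ltn_pmod (j * nu + k) nu_gt0) = k.
  by apply: val_inj; rewrite /= modnMDl modn_small.
rewrite (@dyadic_value_fin _ _ l.+1).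
  rewrite natrX -dyadic_sum_digits//; apply: eq_big_nat => j /andP[_ jl].
  by rewrite /coord_bits /grid_bits divE modE -ltnS jl.
by move=> j lj; rewrite /coord_bits /grid_bits divE leqNgt lj.
Qed.

End grid.

Section angles.
Context (R : realType) (nu : nat).

Definition wrap (y : R) : arc R := insubd (arc_base R) y.

Lemma arc_val_wrap (y : R) : arc_val (wrap y) = if - pi <= y < pi then y else - pi.
Proof. by rewrite /arc_val /wrap val_insubd. Qed.

(** Only the angle [pi] is moved, by a full turn, which integer frequencies do not see. *)
Lemma cis_wrap (z : int) (y : R) : - pi <= y <= pi ->
  cis (z%:~R * arc_val (wrap y)) = cis (z%:~R * y).
Proof.
move=> /andP[y1 y2]; rewrite arc_val_wrap y1/=; case: ltP => // y3.
have -> : y = pi by apply/eqP; rewrite eq_le y2.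
rewrite -(cisDM2pi (z%:~R * - pi) z); congr cis; rewrite mulr2n; ring.
Qed.

Lemma measurable_wrap : measurable_fun setT wrap.
Proof.
apply: measurable_fun_arcP; under eq_fun do rewrite arc_val_wrap.
have mI : measurable `[- pi, pi : R[%classic by exact: measurable_itv.
rewrite (_ : (fun x => _) = fun x : R => \1_`[- pi, pi[ x * (x + pi) - pi); last first.
  apply/funext => x; rewrite indicE mem_setE in_itv/=.
  by case: ifP; rewrite ?mul1r ?addrK// mul0r add0r.
apply: measurable_funB => //; apply: measurable_funM; first exact: measurable_indic.
exact: measurable_funD.
Qed.

Definition angle (c : nat -> bool) (k : nat) : R :=
  - pi + pi *+ 2 * dyadic_value R (coord_bits nu c k).

Lemma angle_itv c k : - pi <= angle c k <= pi.
Proof.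
have /andP[d0 d1] := dyadic_value_itv R (coord_bits nu c k).
have pi0 := pi_gt0 R; rewrite /angle mulr2n; apply/andP; split; nra.
Qed.

Lemma measurable_angle_coord k : measurable_fun setT (fun c : bitstream => angle c k).
Proof.
apply: measurable_funD => //; apply: measurable_funM => //.
apply: (@measurable_fun_cvg _ _ _ setT (fun (J : nat) (c : bitstream) => dyadic_sum R (coord_bits nu c k) J)).
  move=> J; apply: measurable_sum => j; apply: measurable_funM => //.
  rewrite (_ : (fun c : bitstream => _) = \1_[set c : bitstream | c (j * nu + k)%N]).
    by apply: measurable_indic; exact: (@measurable_bit _ _ id).
  by apply/funext => c; rewrite indicE; congr (nat_of_bool _)%:R; apply/idP/idP; rewrite inE.
by move=> c _; exact: cvg_dyadic_sum.
Qed.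

Definition stream_point (c : bitstream) : torus R nu :=
  [tuple wrap (angle c k) | k < nu].

Lemma measurable_stream_point : measurable_fun setT stream_point.
Proof.
apply/measurable_fun_tnthP => k.
rewrite (_ : _ \o _ = wrap \o (fun c => angle c k)).
  by apply: measurableT_comp; [exact: measurable_wrap|exact: measurable_angle_coord].
by apply/funext => c /=; rewrite tnth_mktuple.
Qed.

Lemma torus_char_stream_point (p : 'rV[int]_nu) c :
  torus_char p (stream_point c) = cis (\sum_(k < nu) (p 0 k)%:~R * angle c k).
Proof.
rewrite torus_char_cis !cis_sum; apply: eq_bigr => k _.
by rewrite tnth_mktuple cis_wrap// angle_itv.
Qed.

Lemma char_stream_approx (p : 'rV[int]_nu) (e : R) : 0 < e ->
  exists J (h : seq bool -> R), forall c,
    `|\sum_(k < nu) (p 0 k)%:~R * angle c k - h (prefix J c)| <= e.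
Proof.
(* [J] digits per coordinate determine the phase up to [C / 2^J]; as [2^J > J], any [J > C / e] is
   enough. *)
move=> e0; pose C : R := \sum_(k < nu) `|(p 0 k)%:~R| * (pi *+ 2).
have C0 : 0 <= C by apply: sumr_ge0 => k _; rewrite mulr_ge0// mulrn_wge0// pi_ge0.
pose J := Num.bound (C / e).
have J2 : C * 2 ^- J <= e.
  rewrite ler_pdivrMr ?exprn_gt0// mulrC -ler_pdivrMr//.
  have : C / e < J%:R by apply: archi_boundP; rewrite divr_ge0// ltW.
  by move=> /ltW/le_trans; apply; rewrite -natrX ler_nat ltnW// ltn_expl.
(* Prefixes list the latest bit first, so [rev] restores the order of the stream. *)
pose h (s : seq bool) := \sum_(k < nu) (p 0 k)%:~R *
  (- pi + pi *+ 2 * dyadic_sum R (coord_bits nu (nth false (rev s)) k) J).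
exists (J * nu)%N, h => c; rewrite /h -sumrB (le_trans (ler_norm_sum _ _ _))//.
apply: le_trans J2; rewrite mulr_suml; apply: ler_sum => k _.
rewrite -mulrBr normrM -mulrA ler_wpM2l//.
rewrite (_ : dyadic_sum _ _ J = dyadic_sum R (coord_bits nu c k) J); last first.
  apply: eq_big_nat => j /andP[_ jJ]; congr ((nat_of_bool _)%:R / _).
  rewrite /coord_bits nth_prefix// -ltn_divLR ?divnMDl ?divn_small ?addn0//.
  - by case: nu k => // -[].
  - by case: nu k => // -[].
have -> : angle c k - (- pi + pi *+ 2 * dyadic_sum R (coord_bits nu c k) J) =
    pi *+ 2 * (dyadic_value R (coord_bits nu c k) - dyadic_sum R (coord_bits nu c k) J).
  by rewrite /angle; ring.
have pi2 : 0 <= (pi : R) *+ 2 by rewrite mulrn_wge0// pi_ge0.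
rewrite normrM (ger0_norm pi2) ler_wpM2l//.
have /andP[h1 h2] := dyadic_value_le R (coord_bits nu c k) J.
by rewrite ger0_norm ?subr_ge0// lerBlDl.
Qed.

End angles.

(** * Fejer sums of a positive definite function *)

Section herglotz.
Context (R : realType) (nu : nat).
Hypothesis nu_gt0 : (0 < nu)%N.
Variable r : 'rV[int]_nu -> R[i].
Hypothesis r_psd : forall (I : finType) (x : I -> 'rV[int]_nu) (c : I -> R[i]),
  0 <= \sum_i \sum_j c i * conjc (c j) * r (x j - x i).

Let box l := {ffun 'I_nu -> 'I_(2 ^ l)}.

Let vec l (a : box l) : 'rV[int]_nu := \row_k (a k : int).

Let node l (m : grid nu l) (k : 'I_nu) : R :=
  - pi + pi *+ 2 * ((m k)%:R / (2 ^ l.+1)%:R).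

Let pairing l (p : 'rV[int]_nu) (m : grid nu l) : R :=
  \sum_(k < nu) (p 0 k)%:~R * node m k.

Let pairingD l p q (m : grid nu l) : pairing (p + q) m = pairing p m + pairing q m.
Proof. by rewrite -big_split/=; apply: eq_bigr => k _; rewrite mxE intrD mulrDl. Qed.

Let pairingN l p (m : grid nu l) : pairing (- p) m = - pairing p m.
Proof. by rewrite -sumrN; apply: eq_bigr => k _; rewrite mxE intrN mulNr. Qed.

(* The Fejer kernel attached to [r], sampled on a grid with [2 ^ l.+1] points
   per coordinate so that no frequency occurring in it is aliased. *)
Let fejer l (m : grid nu l) : R[i] :=
  ((2 ^ l)%:R * (2 ^ l.+1)%:R) ^- nu *
  \sum_(a : box l) \sum_(b : box l) r (vec b - vec a) * cis (- pairing (vec b - vec a) m).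

(** Positive definiteness at the points of the box, with the unimodular weights
    [cis (pairing (vec a) m)]. *)
Let fejer_ge0 l (m : grid nu l) : 0 <= fejer m.
Proof.
rewrite /fejer; apply: mulr_ge0; first by rewrite invr_ge0 exprn_ge0// mulr_ge0.
have := r_psd (@vec l) (fun a => cis (pairing (vec a) m)); congr (0 <= _).
apply: eq_bigr => a _; apply: eq_bigr => b _.
by rewrite mulrC pairingD pairingN opprD opprK cisD cisN [X in _ * X]mulrC.
Qed.

Let weight l (m : grid nu l) : R := complex.Re (fejer m).

Let weight_ge0 l (m : grid nu l) : 0 <= weight m.
Proof. by have := fejer_ge0 m; rewrite complex_ge0 => /andP[]. Qed.

Let weightE l (m : grid nu l) : (weight m)%:C = fejer m.
Proof.
have := fejer_ge0 m; rewrite complex_ge0 /weight => /andP[/eqP + _].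
by case: (fejer m) => u v /= ->.
Qed.

Let sum_cis_grid_vec l (p : 'rV[int]_nu) : (forall k, (`|p 0%R k|%N < 2 ^ l.+1)%N) ->
  \sum_(m : grid nu l) cis (pairing p m) =
  (if p == 0 then (2 ^ l.+1)%:R ^+ nu else 0) :> R[i].
Proof.
move=> pN; transitivity (\prod_(k < nu) \sum_(a < 2 ^ l.+1)
    (cis ((p 0 k)%:~R * (- pi + pi *+ 2 * (a%:R / (2 ^ l.+1)%:R))) : R[i])).
  rewrite (bigA_distr_bigA (fun k (a : 'I_(2 ^ l.+1)) =>
    (cis ((p 0 k)%:~R * (- pi + pi *+ 2 * (a%:R / (2 ^ l.+1)%:R))) : R[i]))).
  by apply: eq_bigr => m _; rewrite /pairing cis_sum.
under eq_bigr do rewrite sum_cis_grid ?expn_gt0//.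
have [->|p0] := eqVneq.
  by under eq_bigr do rewrite mxE eqxx; rewrite prodr_const card_ord.
have [k pk] : exists k, p 0 k != 0.
  apply/existsP; apply: contraNT p0; rewrite negb_exists => /forallP h.
  apply/eqP/matrixP => i k; rewrite ord1 mxE; apply/eqP.
  by have := h k; rewrite negbK.
by rewrite (bigD1 k)//= (negbTE pk) mul0r.
Qed.

Let hits l (z : int) : R := \sum_(a < 2 ^ l) \sum_(b < 2 ^ l) ((b : int) - (a : int) == z)%:R.

(** Fejer's multiplier: among [0, ..., 2^l - 1] there are [2^l - |t_k|] pairs with difference [t_k]
    if [|t_k| <= 2^l], so the factors are [1 - |t_k| / 2^l]. *)
Let kappa l (t : 'rV[int]_nu) : R := \prod_(k < nu) (hits l (t 0 k) / (2 ^ l)%:R).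

Let kappaE l t : kappa l t =
  (2 ^ l)%:R ^- nu * \sum_(a : box l) \sum_(b : box l) (vec b - vec a == t)%:R.
Proof.
rewrite /kappa prodf_div prodr_const card_ord mulrC; congr (_ * _).
rewrite /hits (bigA_distr_bigA (fun k (a : 'I_(2 ^ l)) =>
  \sum_(b < 2 ^ l) ((b : int) - (a : int) == t 0 k)%:R)).
apply: eq_bigr => a _.
rewrite (bigA_distr_bigA (fun k (b : 'I_(2 ^ l)) => ((b : int) - (a k : int) == t 0 k)%:R)).
apply: eq_bigr => b _; have [/rowP e|e] := eqVneq.
  by rewrite big1// => k _; have := e k; rewrite !mxE => ->; rewrite eqxx.
have [k ek] : exists k, (vec b - vec a) 0 k != t 0 k.
  apply/existsP; apply: contraNT e; rewrite negb_exists => /forallP h.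
  by apply/eqP/rowP => k; apply/eqP; have := h k; rewrite negbK.
by rewrite (bigD1 k)//=; move: ek; rewrite !mxE => /negbTE ->; rewrite mul0r.
Qed.

(** Summing over the nodes first leaves only the pairs with [vec b - vec a = t], by orthogonality on
    the grid. This requires frequencies below [2 ^ l.+1], which [|t_k| <= 2^l] and
    [|b_k - a_k| < 2^l] provide. The prefactor of [fejer] cancels the number of nodes and normalises
    [kappa]. *)
Let sum_fejer l (t : 'rV[int]_nu) : (forall k, (`|t 0%R k|%N <= 2 ^ l)%N) ->
  \sum_(m : grid nu l) fejer m * cis (pairing t m) = (kappa l t)%:C * r t.
Proof.
move=> tl; pose n : R[i] := (2 ^ l)%:R; pose N : R[i] := (2 ^ l.+1)%:R.
have n0 : n != 0 :> R[i] by rewrite pnatr_eq0 expn_eq0.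
have N0 : N != 0 :> R[i] by rewrite pnatr_eq0 expn_eq0.
transitivity ((n * N) ^- nu * \sum_(a : box l) \sum_(b : box l) r (vec b - vec a) *
    \sum_(m : grid nu l) cis (pairing (t - (vec b - vec a)) m)).
  under eq_bigr do rewrite -mulrA mulr_suml; rewrite -mulr_sumr exchange_big/=.
  congr (_ * _); apply: eq_bigr => a _.
  under eq_bigr do rewrite mulr_suml; rewrite exchange_big/=; apply: eq_bigr => b _.
  rewrite mulr_sumr; apply: eq_bigr => m _.
  rewrite -mulrA -cisD; congr (_ * cis _).
  by rewrite (pairingD t (- (vec b - vec a))) (pairingN (vec b - vec a)) [RHS]addrC.
have -> : \sum_(a : box l) \sum_(b : box l) r (vec b - vec a) *
    \sum_(m : grid nu l) cis (pairing (t - (vec b - vec a)) m) =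
    N ^+ nu * r t * \sum_(a : box l) \sum_(b : box l) (vec b - vec a == t)%:R.
  rewrite mulr_sumr; apply: eq_bigr => a _; rewrite mulr_sumr; apply: eq_bigr => b _.
  rewrite sum_cis_grid_vec; last first.
    move=> k; rewrite !mxE expnS mul2n -addnn.
    have arith (x : int) (y z w : nat) : (z < w)%N -> (y < w)%N -> (`|x|%N <= w)%N ->
      (`|(x - (z%:Z - y%:Z))%R|%N < w + w)%N by lia.
    exact: arith.
  rewrite subr_eq0 eq_sym; have [->|] := eqVneq; last by rewrite !mulr0.
  by rewrite mulr1 mulrC.
rewrite kappaE rmorphM fmorphV rmorphXn rmorph_nat raddf_sum/=.
under [in RHS]eq_bigr do rewrite raddf_sum/=.
under [in RHS]eq_bigr do under eq_bigr do rewrite rmorph_nat.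
rewrite exprMn invfM; field.
by rewrite !expf_neq0.
Qed.

Let hitsE l z :
  hits l z = \sum_(a < 2 ^ l) ((0 <= (a : int) + z) && ((a : int) + z < (2 ^ l)%N))%:R.
Proof.
apply: eq_bigr => a _; have [/andP[h1 h2]|h] := boolP (_ && _).
  have bP : (`|((a : int) + z)%R|%N < 2 ^ l)%N by lia.
  rewrite (bigD1 (Ordinal bP))//= big1 ?addr0 => [|b bb].
    by rewrite (_ : _ == _ = true)//; apply/eqP; lia.
  rewrite (_ : _ == _ = false)//; apply/negP => /eqP e; case/eqP: bb.
  by apply: val_inj => /=; lia.
rewrite big1// => b _; rewrite (_ : _ == _ = false)//; apply/negP => /eqP e.
by case/negP: h; have := ltn_ord b; lia.
Qed.

Let hits0 l : hits l 0 = (2 ^ l)%:R.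
Proof.
rewrite hitsE (eq_bigr (fun=> 1)) ?sumr_const ?card_ord// => a _.
by rewrite addr0 (_ : _ && _ = true)//; have := ltn_ord a; lia.
Qed.

(** At most [|z|] values of [a] send [a + z] out of range: the last ones if [z >= 0], where the
    index is reversed, and the first ones if [z < 0]. *)
Let hits_le l z : (2 ^ l)%:R - `|z|%N%:R <= hits l z <= (2 ^ l)%:R.
Proof.
have count n k : (\sum_(a < n) (a < k)%N <= k)%N.
  suff -> : (\sum_(a < n) (a < k)%N = minn n k)%N by lia.
  by elim: n => [|n IH]; rewrite ?big_ord0 ?min0n// big_ord_recr/= IH; lia.
have card1 : (2 ^ l)%:R = \sum_(a < 2 ^ l) (1 : R) by rewrite sumr_const card_ord.
rewrite hitsE; apply/andP; split; last first.
  by rewrite [leRHS]card1; apply: ler_sum => a _; case: (_ && _).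
rewrite lerBlDr {1}card1 -lerBlDl -sumrB.
rewrite (@le_trans _ _ (\sum_(a < 2 ^ l) (a < `|z|)%N)%:R)//; last by rewrite ler_nat.
rewrite natr_sum; case: (leP 0 z) => z0.
  rewrite (reindex_inj rev_ord_inj)/=; apply: ler_sum => a _.
  have al := ltn_ord a; case: (ltnP a `|z|%N) => az; first by rewrite lerBlDr lerDl.
  by rewrite (_ : _ && _ = true) ?subrr//; lia.
apply: ler_sum => a _.
have al := ltn_ord a; case: (ltnP a `|z|%N) => az; first by rewrite lerBlDr lerDl.
by rewrite (_ : _ && _ = true) ?subrr//; lia.
Qed.

Let cvg_hits z : hits l z / (2 ^ l)%:R @[l --> \oo] --> (1 : R).
Proof.
apply: (@squeeze_cvgr _ _ _ _ (fun l => (1 : R) - `|z|%N%:R * l.+1%:R^-1) (fun=> (1 : R))).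
- apply: nearW => l; have /andP[h1 h2] := hits_le l z.
  have p0 : 0 < (2 ^ l)%:R :> R by rewrite ltr0n expn_gt0.
  rewrite ler_pdivrMr// mul1r h2 andbT ler_pdivlMr// (le_trans _ h1)//.
  rewrite mulrBl mul1r lerD2l lerN2 -mulrA ler_peMr// mulrC ler_pdivlMr// mul1r.
  by rewrite ler_nat ltn_expl.
- rewrite -[X in _ --> X]subr0; apply: cvgB; first exact: cvg_cst.
  by rewrite -(mulr0 `|z|%N%:R); apply: cvgMr; exact: cvg_harmonic.
- exact: cvg_cst.
Qed.

Let cvg_kappa (t : 'rV[int]_nu) : kappa l t @[l --> \oo] --> (1 : R).
Proof.
rewrite [X in _ --> X](_ : _ = \prod_(k < nu) (1 : R)); last by rewrite big1.
apply: (cvg_big (@mul_continuous R)) => k _; exact: cvg_hits.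
Qed.

(** The case [t = 0], where [kappa] is 1: all the discrete measures have one common mass, as
    [bitstream_limit_measure] demands. *)
Let sum_weight l : \sum_(m : grid nu l) weight m = complex.Re (r 0).
Proof.
rewrite -Re_sum; congr complex.Re.
have t0 (k : 'I_nu) : (`|(0%R : 'rV[int]_nu) 0%R k|%N <= 2 ^ l)%N by rewrite mxE.
have k1 : kappa l 0 = 1.
  by rewrite /kappa big1// => k _; rewrite mxE hits0 divff// pnatr_eq0 expn_eq0.
have := sum_fejer t0; rewrite k1 mul1r => <-.
by apply: eq_bigr => m _; rewrite /pairing big1 ?cis0 ?mulr1// => k _; rewrite mxE mul0r.
Qed.

Let angle_grid_bits l (m : grid nu l) (k : 'I_nu) :
  angle R nu (grid_bits nu_gt0 m) k = node m k.
Proof. by rewrite /angle dyadic_grid_bits. Qed.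

Lemma herglotz : exists mu : {finite_measure set (torus R nu) -> \bar R},
  forall p, r p = (\int[mu]_x complex.Re (torus_char p x)) +i*
                  (\int[mu]_x complex.Im (torus_char p x)).
Proof.
have [M HM] := @bitstream_limit_measure R (fun l => grid nu l)
  (fun l => grid_bits nu_gt0) (fun l => @weight l) (complex.Re (r 0))
  (fun l m => weight_ge0 m) sum_weight.
exists (image_measure (@measurable_stream_point R nu) M) => p.
(* [f] stands for the real and the imaginary part. The sums equal [kappa l p * f (r p)] once [2^l]
   exceeds every [|p_k|]. *)
have lim_char (f : R[i] -> R) : (forall (c : R) z, f (c%:C * z) = c * f z) ->
    (forall I (s : seq I) F, f (\sum_(i <- s) F i) = \sum_(i <- s) f (F i)) ->
    \sum_(m : grid nu l) weight m * f (torus_char p (stream_point R nu (grid_bits nu_gt0 m)))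
      @[l --> \oo] --> f (r p).
  move=> fZ fsum; have : kappa l p * f (r p) @[l --> \oo] --> 1 * f (r p).
    by apply: cvgMl; exact: cvg_kappa.
  rewrite mul1r; apply: cvg_trans; apply: near_eq_cvg; near=> l.
  have hl : (\sum_(k < nu) `|p 0%R k|%N <= l)%N.
    by near: l; exists (\sum_(k < nu) `|p 0%R k|%N)%N.
  rewrite -fZ -sum_fejer; last first.
    move=> k; apply: ltnW; apply: leq_ltn_trans (ltn_expl l (isT : 1 < 2)%N).
    by apply: leq_trans hl; rewrite (bigD1 k)//= leq_addr.
  rewrite fsum; apply: eq_bigr => m _; rewrite -weightE fZ torus_char_stream_point.
  by congr (_ * f (cis _)); apply: eq_bigr => k _; rewrite angle_grid_bits.
have approx (g : R -> R) (e : R) : (forall x y, `|g x - g y| <= `|x - y|) -> 0 < e ->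
    exists J (h : seq bool -> R), forall c,
      `|g (\sum_(k < nu) (p 0 k)%:~R * angle R nu c k) - h (prefix J c)| <= e.
  move=> gl e0; have [J [h hP]] := char_stream_approx p e0.
  by exists J, (g \o h) => c; exact: le_trans (gl _ _) (hP c).
have bcomp (g : torus R nu -> R) : bounded_measurable g ->
    bounded_measurable (fun c => g (stream_point R nu c)).
  move=> [mg [B gB]]; split; last by exists B => c; exact: gB.
  by apply: measurableT_comp => //; exact: measurable_stream_point.
have bRe := @bounded_measurable_Re_char R nu p.
have bIm := @bounded_measurable_Im_char R nu p.
rewrite !Rintegral_image_measure//.
rewrite (HM _ (complex.Re (r p)))//; last 3 first.
- exact: (bcomp _ bRe).
- move=> e e0; have [J [h hP]] := approx (@cos R) e (@cos_lipschitz R) e0.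
  by exists J, h => c; rewrite torus_char_stream_point; exact: hP.
- exact: (lim_char _ (@ReZ R) (@Re_sum R)).
rewrite (HM _ (complex.Im (r p)))//; last 3 first.
- exact: (bcomp _ bIm).
- move=> e e0; have [J [h hP]] := approx (@sin R) e (@sin_lipschitz R) e0.
  by exists J, h => c; rewrite torus_char_stream_point; exact: hP.
- exact: (lim_char _ (@ImZ R) (@Im_sum R)).
by case: (r p).
Unshelve. all: by end_near. Qed.

End herglotz.

(** * Complex measures *)

Section complex_measure_algebra.
Context d (T : measurableType d) (R : realType).
Implicit Types (G H : complex_measure T R) (z : R[i]) (f : T -> R[i]).

Definition cm_zero : complex_measure T R := ComplexMeasure czero czero.

Definition cm_of_measure (m : {finite_measure set T -> \bar R}) : complex_measure T R :=
  ComplexMeasure (charge_of_finite_measure m) czero.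

(** This is [z G + H], the one operation from which linear combinations are folded. *)
Definition cm_lin z G H : complex_measure T R := ComplexMeasure
  (cadd (cadd (cscale (complex.Re z) (cm_re G)) (cscale (- complex.Im z) (cm_im G))) (cm_re H))
  (cadd (cadd (cscale (complex.Re z) (cm_im G)) (cscale (complex.Im z) (cm_re G))) (cm_im H)).

Definition cm_sum (I : Type) (s : seq I) (z : I -> R[i]) (G : I -> complex_measure T R) :=
  foldr (fun i H => cm_lin (z i) (G i) H) cm_zero s.

Definition cm_conj G : complex_measure T R := ComplexMeasure (cm_re G) (copp (cm_im G)).

Definition bounded_complex f := bounded_measurable (fun x => complex.Re (f x)) /\
  bounded_measurable (fun x => complex.Im (f x)).

Lemma charge_integral_czero (g : T -> R) : bounded_measurable g ->
  charge_integral czero g = 0.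
Proof.
move=> bg; rewrite -[RHS](mul0r (charge_integral czero g)) -charge_integral_cscale//.
by apply: eq_charge_integral => // A mA; rewrite /= /cscale mul0e.
Qed.

Lemma complex_integral_measure m f : bounded_complex f ->
  complex_integral (cm_of_measure m) f =
  (\int[m]_x complex.Re (f x)) +i* (\int[m]_x complex.Im (f x)).
Proof.
move=> [bR bI]; rewrite /complex_integral/= !charge_integral_measure//.
by rewrite !charge_integral_czero// subr0 addr0.
Qed.

Lemma complex_integral_lin z G H f : bounded_complex f ->
  complex_integral (cm_lin z G H) f = z * complex_integral G f + complex_integral H f.
Proof.
move=> [bR bI]; rewrite /complex_integral/= !charge_integral_cadd//.
rewrite !charge_integral_cscale//; case: z => a b.
by apply/eqP; rewrite eq_complex/=; apply/andP; split; apply/eqP; ring.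
Qed.

Lemma complex_integral_sum (I : Type) (s : seq I) (z : I -> R[i]) (G : I -> complex_measure T R) f : bounded_complex f ->
  complex_integral (cm_sum s z G) f = \sum_(i <- s) z i * complex_integral (G i) f.
Proof.
move=> bf; elim: s => [|i s IH] /=.
  case: bf => bR bI; rewrite big_nil /complex_integral/= !charge_integral_czero//.
  by rewrite subr0 addr0.
by rewrite big_cons complex_integral_lin// IH.
Qed.

Lemma cm_lin_val z G H (A : set T) : measurable A ->
  cm_lin z G H A = z * G A + H A.
Proof.
move=> mA; rewrite /cm_val/= /cadd/= /cscale/=.
rewrite !fineD ?fin_numD ?fin_numM ?fin_num_measure//.
rewrite !fineM ?fin_num_measure//; case: z => a b /=; simpc.
by congr (_ +i* _); ring.
Qed.

Lemma cm_sum_val (I : Type) (s : seq I) (z : I -> R[i]) (G : I -> complex_measure T R) (A : set T) : measurable A ->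
  cm_sum s z G A = \sum_(i <- s) z i * G i A.
Proof.
move=> mA; elim: s => [|i s IH] /=; first by rewrite big_nil.
by rewrite big_cons cm_lin_val// IH.
Qed.

Lemma cm_conj_val G (A : set T) : cm_conj G A = conjc (G A).
Proof. by rewrite /cm_val /cm_conj/= /copp/= fineN. Qed.

Lemma complex_integral_conj G f : bounded_complex f ->
  complex_integral (cm_conj G) f = conjc (complex_integral G (fun x => conjc (f x))).
Proof.
move=> [bR bI].
have e1 : (fun x => complex.Re (conjc (f x))) = (fun x => complex.Re (f x)).
  by apply/funext => x; case: (f x).
have e2 : (fun x => complex.Im (conjc (f x))) = (fun x => - complex.Im (f x)).
  by apply/funext => x; case: (f x).
rewrite /complex_integral/= e1 e2 !charge_integral_copp// !charge_integralN//.
by congr (_ +i* _); ring.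
Qed.

Lemma finite_total_variation_any G : finite_total_variation G.
Proof. by split; exact: jordan_difference. Qed.

(** Positive and negative parts of all the charges are added up; a null set of a sum of measures is
    null for each summand. *)
Lemma exists_dominating_measure (I : finType) (G : I -> complex_measure T R) :
  exists mu : {finite_measure set T -> \bar R}, forall i, cm_dominated (G i) mu.
Proof.
have dom1 (n : {charge set T -> \bar R}) : exists mu : {finite_measure set T -> \bar R}, n `<< mu.
  have [m1 [m2 h]] := jordan_difference n.
  exists (finite_add m1 m2); apply/null_content_dominatesP => A mA.
  rewrite /= finite_addE => /eqP; rewrite padde_eq0 ?measure_ge0// => /andP[/eqP e1 /eqP e2].
  by rewrite h// e1 e2 sube0.
have domD (n : {charge set T -> \bar R}) (m1 m2 : {finite_measure set T -> \bar R}) :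
    n `<< m1 \/ n `<< m2 -> n `<< finite_add m1 m2.
  move=> h; apply/null_content_dominatesP => A mA.
  rewrite /= finite_addE => /eqP; rewrite padde_eq0 ?measure_ge0// => /andP[/eqP e1 /eqP e2].
  by case: h => /null_content_dominatesP; apply.
suff [mu h] : exists mu : {finite_measure set T -> \bar R},
    forall i, i \in enum I -> cm_dominated (G i) mu.
  by exists mu => i; apply: h; rewrite mem_enum.
elim: (enum I) => [|i s [mu IH]]; first by exists mzero.
have [m1 h1] := dom1 (cm_re (G i)); have [m2 h2] := dom1 (cm_im (G i)).
exists (finite_add (finite_add m1 m2) mu) => j; rewrite inE => /predU1P[->|js].
  by split; apply: (domD _ _ _); left; apply: (domD _ _ _); [left|right].
by have [? ?] := IH j js; split; apply: (domD _ _ _); right.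
Qed.

End complex_measure_algebra.

Lemma bounded_complex_char (R : realType) nu (p : 'rV[int]_nu) :
  bounded_complex (@torus_char R nu p).
Proof. by split; [exact: bounded_measurable_Re_char|exact: bounded_measurable_Im_char]. Qed.

(** * Reflection of the torus *)

Section torus_opposite.
Context (R : realType) (nu : nat).

Lemma arc_val_opp (x : arc R) :
  arc_val (arc_opp x) = if arc_val x == - pi then - pi else - arc_val x.
Proof.
rewrite /arc_val /arc_opp val_insubd.
have /andP[b1 b2] := arc_bound x; rewrite /arc_val in b1 b2 *.
have [->|h] := eqVneq; first by rewrite opprK ltxx andbF.
by rewrite lerN2 ltrNl (ltW b2) lt_neqAle eq_sym h b1.
Qed.

Lemma arc_oppK : involutive (@arc_opp R).
Proof.
move=> x; apply: val_inj; rewrite -!/(arc_val _) !arc_val_opp.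
have [->|h] := eqVneq (arc_val x); first by rewrite eqxx.
have /andP[_ b2] := arc_bound x.
by rewrite eqr_opp (lt_eqF b2) opprK.
Qed.

Lemma torus_oppK : involutive (@torus_opp R nu).
Proof. by move=> x; apply: eq_from_tnth => k; rewrite !tnth_mktuple arc_oppK. Qed.

Lemma torus_opp_image (A : set (torus R nu)) : @torus_opp R nu @` A = @torus_opp R nu @^-1` A.
Proof.
apply/seteqP; split => x /=; first by move=> [y Ay <-]; rewrite torus_oppK.
by move=> Ax; exists (torus_opp x) => //; rewrite torus_oppK.
Qed.

Lemma measurable_torus_opp : measurable_fun setT (@torus_opp R nu).
Proof.
apply/measurable_fun_tnthP => k.
rewrite (_ : _ \o _ = @arc_opp R \o (fun x => tnth x k)); last first.
  by apply/funext => x /=; rewrite tnth_mktuple.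
apply: measurableT_comp; last exact: measurable_tnth.
apply: measurable_fun_arcP.
have mpi : measurable [set - pi : R] by exact: measurable_set1.
(* At [- pi] the correction by a full turn brings [pi] back to [- pi]. *)
rewrite (_ : (fun x => _) = (fun y : R => - y - \1_[set - pi] y * (pi *+ 2)) \o @arc_val R).
  apply: measurableT_comp; last exact: measurable_arc_val.
  apply: measurable_funB; first exact: measurable_funN.
  by apply: measurable_funM => //; exact: measurable_indic.
apply/funext => x /=; rewrite arc_val_opp indicE; have [->|h] := eqVneq.
  by rewrite mem_set// mul1r mulr2n; ring.
by rewrite memNset ?mul0r ?subr0//=; exact/eqP.
Qed.

Lemma torus_char_opp (p : 'rV[int]_nu) (x : torus R nu) :
  torus_char p (torus_opp x) = conjc (torus_char p x).
Proof.
rewrite -torus_charN !torus_char_cis !cis_sum; apply: eq_bigr => k _.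
rewrite tnth_mktuple arc_val_opp mxE intrN; have [->|h] := eqVneq.
  rewrite -(cisDM2pi _ (p 0 k)); congr cis; rewrite mulr2n; ring.
by congr cis; ring.
Qed.

Lemma charge_integral_opp (n : {charge set (torus R nu) -> \bar R}) (p : 'rV[int]_nu) :
  (charge_integral (image_charge measurable_torus_opp n)
     (fun x => complex.Re (torus_char p x)) =
   charge_integral n (fun x => complex.Re (torus_char p x))) /\
  (charge_integral (image_charge measurable_torus_opp n)
     (fun x => complex.Im (torus_char p x)) =
   - charge_integral n (fun x => complex.Im (torus_char p x))).
Proof.
have [bR bI] := bounded_complex_char R p; rewrite !charge_integral_image//.
have e1 : (fun x => complex.Re (torus_char p (torus_opp x))) =
    (fun x : torus R nu => complex.Re (torus_char p x)).
  by apply/funext => x; rewrite torus_char_opp.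
have e2 : (fun x => complex.Im (torus_char p (torus_opp x))) =
    (fun x : torus R nu => - complex.Im (torus_char p x)).
  by apply/funext => x; rewrite torus_char_opp.
by rewrite e1 e2 charge_integralN.
Qed.

End torus_opposite.

(** For [z = a + i b] the real part is the form at [a] plus the form at [b]; the imaginary part is
    antisymmetric in the two indices and cancels because [C] is symmetric. *)
Lemma complex_psd (R : realType) (K : finType) (C : K -> K -> R) :
  (forall k k', C k k' = C k' k) ->
  (forall a : K -> R, 0 <= \sum_k \sum_k' a k * a k' * C k k') ->
  forall z : K -> R[i], 0 <= \sum_k \sum_k' z k * conjc (z k') * (C k k')%:C.
Proof.
move=> Csym Cpsd z; rewrite complex_ge0 Re_sum Im_sum.
have ReE k k' : complex.Re (z k * conjc (z k') * (C k k')%:C) =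
    complex.Re (z k) * complex.Re (z k') * C k k' + complex.Im (z k) * complex.Im (z k') * C k k'.
  by case: (z k) => a b; case: (z k') => a' b' /=; ring.
have ImE k k' : complex.Im (z k * conjc (z k') * (C k k')%:C) =
    complex.Im (z k) * complex.Re (z k') * C k k' - complex.Re (z k) * complex.Im (z k') * C k k'.
  by case: (z k) => a b; case: (z k') => a' b' /=; ring.
apply/andP; split.
  under eq_bigr do (rewrite Im_sum; under eq_bigr do rewrite ImE; rewrite sumrB).
  rewrite sumrB subr_eq0; apply/eqP; rewrite exchange_big/=.
  by apply: eq_bigr => k _; apply: eq_bigr => k' _; rewrite Csym; ring.
under eq_bigr do (rewrite Re_sum; under eq_bigr do rewrite ReE; rewrite big_split/=).
by rewrite big_split/= addr_ge0.
Qed.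

Section laws.
Context d (T : measurableType d) (R : realType) (P : probability T R).

Lemma eq_law_integral (Y Y' : T -> R) (f : R -> \bar R) :
  measurable_fun setT Y -> measurable_fun setT Y' ->
  (forall A, measurable A -> P (Y @^-1` A) = P (Y' @^-1` A)) ->
  measurable_fun setT f ->
  P.-integrable setT (f \o Y) -> P.-integrable setT (f \o Y') ->
  (\int[P]_w f (Y w) = \int[P]_w f (Y' w))%E.
Proof.
move=> mY mY' e mf iY iY'.
have := @integral_pushforward _ _ _ _ R Y mY P setT f mf.
rewrite preimage_setT => /(_ iY measurableT) <-.
have := @integral_pushforward _ _ _ _ R Y' mY' P setT f mf.
rewrite preimage_setT => /(_ iY' measurableT) <-.
by apply: eq_measure_integral => A mA _; exact: e.
Qed.

End laws.

Lemma Rintegral_sum d (T : measurableType d) (R : realType) (m : {measure set T -> \bar R})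
    (D : set T) (I : Type) (s : seq I) (F : I -> T -> R) : measurable D ->
  (forall i, m.-integrable D (EFin \o F i)) ->
  \int[m]_(x in D) (\sum_(i <- s) F i x) = \sum_(i <- s) \int[m]_(x in D) F i x.
Proof.
move=> mD iF; elim: s => [|i s IH].
  by rewrite big_nil /Rintegral integral0_eq// => x _; rewrite big_nil.
rewrite big_cons -IH -RintegralD//.
  by apply: eq_Rintegral => x _; rewrite big_cons.
rewrite (_ : EFin \o _ = fun x => (\sum_(j <- s) (F j x)%:E)%E); last first.
  by apply/funext => x /=; rewrite sumEFin.
by apply: integrable_sum => // j _; exact: iF.
Qed.

(** * Spectral measures of a matrix valued covariance *)

Section density.
Context disp (T : measurableType disp) (R : realType) (d : nat).
Variable G : 'I_d -> 'I_d -> complex_measure T R.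
Hypothesis G_herm : hermitian_measure G.
Hypothesis G_ge0 : forall (v : 'I_d -> R[i]) A, measurable A ->
  0 <= \sum_j \sum_j' v j * conjc (v j') * G j j' A.
Variable mu : {finite_measure set T -> \bar R}.
Hypothesis dom : forall j j', cm_dominated (G j j') mu.

Let g j j' x := cm_RN (G j j') mu x.

(** Real part of the Hermitian form of the densities, expanded into real terms so that integrability
    and linearity apply termwise. *)
Let q (v : 'I_d -> R[i]) x : R := \sum_j \sum_j'
  (complex.Re (v j * conjc (v j')) * complex.Re (g j j' x) -
   complex.Im (v j * conjc (v j')) * complex.Im (g j j' x)).

Let qE v x : q v x = complex.Re (\sum_j \sum_j' v j * conjc (v j') * g j j' x).
Proof.
rewrite Re_sum; apply: eq_bigr => j _; rewrite Re_sum; apply: eq_bigr => j' _.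
by case: (v j * _) => a b; case: (g _ _ _).
Qed.

(** The integral of [q v] over [A] is the real part of the form of the values [G j j' A],
    nonnegative by [G_ge0]. *)
Let q_ge0_ae v : {ae mu, forall x, 0 <= q v x}.
Proof.
have iRe j j' : mu.-integrable setT (EFin \o (fun x => complex.Re (g j j' x))).
  by apply: integrable_fine_RN; case: (dom j j').
have iIm j j' : mu.-integrable setT (EFin \o (fun x => complex.Im (g j j' x))).
  by apply: integrable_fine_RN; case: (dom j j').
have iterm (k : 'I_d * 'I_d) : mu.-integrable setT (EFin \o (fun x =>
    complex.Re (v k.1 * conjc (v k.2)) * complex.Re (g k.1 k.2 x) -
    complex.Im (v k.1 * conjc (v k.2)) * complex.Im (g k.1 k.2 x))).
  rewrite (_ : _ \o _ = (fun x => (complex.Re (v k.1 * conjc (v k.2)))%:E * (complex.Re (g k.1 k.2 x))%:E -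
    (complex.Im (v k.1 * conjc (v k.2)))%:E * (complex.Im (g k.1 k.2 x))%:E)%E)//.
  by apply: integrableB => //; apply: integrableZl => //; [exact: iRe|exact: iIm].
have qsum x : q v x = \sum_(k : 'I_d * 'I_d)
    (complex.Re (v k.1 * conjc (v k.2)) * complex.Re (g k.1 k.2 x) -
     complex.Im (v k.1 * conjc (v k.2)) * complex.Im (g k.1 k.2 x)).
  by rewrite /q pair_bigA.
apply: integral_ge0_ae_ge0.
  rewrite (_ : EFin \o q v = fun x => (\sum_(k : 'I_d * 'I_d)
    (complex.Re (v k.1 * conjc (v k.2)) * complex.Re (g k.1 k.2 x) -
     complex.Im (v k.1 * conjc (v k.2)) * complex.Im (g k.1 k.2 x))%:E)%E); last first.
    by apply/funext => x /=; rewrite qsum sumEFin.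
  by apply: integrable_sum => // k _; exact: iterm.
move=> A mA; have := G_ge0 v mA; rewrite complex_ge0 => /andP[_]; congr (0 <= _).
transitivity (\sum_(k : 'I_d * 'I_d) \int[mu]_(x in A)
    (complex.Re (v k.1 * conjc (v k.2)) * complex.Re (g k.1 k.2 x) -
     complex.Im (v k.1 * conjc (v k.2)) * complex.Im (g k.1 k.2 x))); last first.
  rewrite -Rintegral_sum//; first by apply: eq_Rintegral => x _; rewrite qsum.
  by move=> k; exact: integrableS (iterm k).
rewrite pair_bigA/= Re_sum; apply: eq_bigr => k _.
have iReA : mu.-integrable A (EFin \o (fun x => complex.Re (g k.1 k.2 x))).
  exact: integrableS (iRe _ _).
have iImA : mu.-integrable A (EFin \o (fun x => complex.Im (g k.1 k.2 x))).
  exact: integrableS (iIm _ _).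
rewrite RintegralB//; last 2 first.
- rewrite (_ : _ \o _ = fun x => ((complex.Re (v k.1 * conjc (v k.2)))%:E *
    (complex.Re (g k.1 k.2 x))%:E)%E)//; exact: integrableZl.
- rewrite (_ : _ \o _ = fun x => ((complex.Im (v k.1 * conjc (v k.2)))%:E *
    (complex.Im (g k.1 k.2 x))%:E)%E)//; exact: integrableZl.
rewrite !RintegralZl//; have [dre dim] := dom k.1 k.2.
rewrite [X in _ * X - _](fine_RN_integral dre mA) [X in _ - _ * X](fine_RN_integral dim mA).
by rewrite /cm_val; case: (v k.1 * _).
Qed.

Let herm_ae j j' : {ae mu, forall x, g j' j x = conjc (g j j' x)}.
Proof.
have [dre dim] := dom j j'; have [dre' dim'] := dom j' j.
have h A : measurable A -> G j' j A = conjc (G j j' A).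
  exact: G_herm.
have fin2 (n1 n2 : {charge set T -> \bar R}) A : measurable A ->
    fine (n1 A) = fine (n2 A) -> n1 A = n2 A.
  by move=> mA e; rewrite -[LHS]fineK ?fin_num_measure// e fineK ?fin_num_measure.
have dN : cscale (-1) (cm_im (G j j')) `<< mu by exact: dominates_cscalel.
have aeR := ae_eq_fine_RN dre' dre _.
have {}aeR : {ae mu, forall x, complex.Re (g j' j x) = complex.Re (g j j' x)}.
  apply: aeR => A mA; apply: fin2 => //; have := h A mA.
  by rewrite /cm_val => -[].
have aeI : {ae mu, forall x, complex.Im (g j' j x) = - complex.Im (g j j' x)}.
  have : {ae mu, forall x, fine (Radon_Nikodym (cm_im (G j' j)) mu x) =
      fine (Radon_Nikodym (cscale (-1) (cm_im (G j j'))) mu x)}.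
    apply: ae_eq_fine_RN => // A mA; apply: fin2 => //; have := h A mA.
    rewrite /cm_val => -[_ ->]; rewrite /= /cscale fineM ?fin_num_measure//=.
    by rewrite mulN1r.
  have := @Radon_Nikodym_cscale _ _ _ mu (cm_im (G j j')) (-1) setT measurableT dim.
  apply: filterS2 => x /(_ I) e1 e2; rewrite /g /cm_RN/= e2 e1.
  by rewrite fineM ?Radon_Nikodym_fin_num//= mulN1r.
apply: filterS2 aeR aeI => x e1 e2.
by move: e1 e2; case: (g j' j x) => a b; case: (g j j' x) => a' b' /= -> ->.
Qed.

Lemma spectral_density_psd : {ae mu, forall x, psdmx (RN_matrix G mu x)}.
Proof.
have hall : {ae mu, forall x, forall j j', g j' j x = conjc (g j j' x)}.
  (* Countably many almost everywhere statements are joined by indexing them with natural numbers; a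
     number that codes nothing contributes [True]. *)
  have : {ae mu, forall x, forall n : nat, if unpickle n is Some k
      then g (k : 'I_d * 'I_d).2 k.1 x = conjc (g k.1 k.2 x) else True}.
    by apply: ae_foralln => n; case: (unpickle n) => [k|]; [exact: herm_ae|exact: aeW].
  by apply: filterS => x h j j'; have := h (pickle (j, j')); rewrite pickleK.
pose dec (f : {ffun 'I_d -> rat * rat}) (j : 'I_d) : R[i] := ratr (f j).1 +i* ratr (f j).2.
have qall : {ae mu, forall x, forall f, 0 <= q (dec f) x}.
  have : {ae mu, forall x, forall n : nat, if unpickle n is Some f then is_true (0 <= q (dec f) x) else True}.
    apply: ae_foralln => n; case: (unpickle n) => [f|]; first exact: q_ge0_ae.
    exact: aeW.
  by apply: filterS => x h f; have := h (pickle f); rewrite pickleK.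
apply: filterS2 hall qall => x gH q0.
have q_ge0 v : 0 <= q v x.
  (* At the fixed point [x] the form is continuous in [v], so the sign passes from rational to all
     complex vectors without a further null set. *)
  have approx (y : R) (n : nat) : exists a : rat, y < ratr a < y + n.+1%:R^-1.
    have [|a] := @rat_in_itvoo R y (y + n.+1%:R^-1); first by rewrite ltrDl invr_gt0.
    by rewrite in_itv/=; exists a.
  pose rapp y n := sval (cid (approx y n)).
  have rappP y : (ratr (rapp y n) : R) @[n --> \oo] --> y.
    apply: (@squeeze_cvgr _ _ _ _ (fun=> y) (fun n : nat => y + n.+1%:R^-1)).
    - by apply: nearW => n; have /andP[h1 h2] := svalP (cid (approx y n)); rewrite !ltW.
    - exact: cvg_cst.
    - by rewrite -[X in _ --> X]addr0; apply: cvgD; [exact: cvg_cst|exact: cvg_harmonic].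
  pose f n := [ffun j => (rapp (complex.Re (v j)) n, rapp (complex.Im (v j)) n)].
  have qE2 u : q u x = \sum_j \sum_j'
     ((complex.Re (u j) * complex.Re (u j') + complex.Im (u j) * complex.Im (u j')) * complex.Re (g j j' x) -
      (complex.Im (u j) * complex.Re (u j') - complex.Re (u j) * complex.Im (u j')) * complex.Im (g j j' x)).
    apply: eq_bigr => j _; apply: eq_bigr => j' _.
    by case: (u j) => a b; case: (u j') => a' b' /=; ring.
  have qc : q (dec (f n)) x @[n --> \oo] --> q v x.
    under eq_fun do rewrite qE2; rewrite qE2.
    apply: (cvg_big (@add_continuous R)) => j _; apply: (cvg_big (@add_continuous R)) => j' _.
    have cRe k : complex.Re (dec (f n) k) @[n --> \oo] --> complex.Re (v k).
      by under eq_fun do rewrite /dec ffunE; exact: rappP.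
    have cIm k : complex.Im (dec (f n) k) @[n --> \oo] --> complex.Im (v k).
      by under eq_fun do rewrite /dec ffunE; exact: rappP.
    by apply: cvgB; apply: cvgMl; [apply: cvgD|apply: cvgB]; apply: cvgM.
  rewrite -(cvg_lim (@Rhausdorff R) qc); apply: limr_ge; first exact: cvgP qc.
  by apply: nearW => n; exact: q0.
split.
  apply/is_hermitianmxP; rewrite expr0 scale1r; apply/matrixP => j j'.
  by rewrite !mxE; exact: gH.
move=> v; rewrite complex_ge0.
have -> : (v *m RN_matrix G mu x *m (map_mx Num.conj v)^T) 0 0 =
    \sum_j \sum_j' v 0 j * conjc (v 0 j') * g j j' x.
  rewrite mxE exchange_big/=; apply: eq_bigr => j' _.
  rewrite mxE mulr_suml; apply: eq_bigr => j _; rewrite !mxE -/(g j j' x).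
  by rewrite -[Num.conj _]/(conjc _); ring.
rewrite -qE q_ge0 andbT.
(* Hermitian symmetry makes the form self-conjugate, so its imaginary part vanishes. *)
set S := \sum_j _; suff : conjc S = S by case: S => a b [h]; apply/eqP => /=; lra.
rewrite /S rmorph_sum/=; under eq_bigr do rewrite rmorph_sum/=.
rewrite exchange_big/=; apply: eq_bigr => j _; apply: eq_bigr => j' _.
rewrite gH; case: (v 0 j) => a b; case: (v 0 j') => a' b'; case: (g j j' x) => a'' b''.
by apply/eqP; rewrite eq_complex/=; apply/andP; split; apply/eqP; ring.
Qed.

End density.

Section matrix_herglotz.
Context (R : realType) (d nu : nat).
Hypothesis nu_gt0 : (0 < nu)%N.
Variable r : 'I_d -> 'I_d -> 'rV[int]_nu -> R.
Hypothesis r_sym : forall j j' p, r j' j p = r j j' (- p).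
Hypothesis r_psd : forall (K : finType) (x : K -> 'rV[int]_nu) (i : K -> 'I_d) (a : K -> R),
  0 <= \sum_k \sum_k' a k * a k' * r (i k) (i k') (x k' - x k).

Definition contraction (v : 'I_d -> R[i]) (p : 'rV[int]_nu) : R[i] :=
  \sum_j \sum_j' v j * conjc (v j') * (r j j' p)%:C.

(** The weights [c i * v j] on the pairs [(i, j)] reduce the claim to positivity of a single real
    symmetric kernel. *)
Lemma contraction_psd v (I : finType) (x : I -> 'rV[int]_nu) (c : I -> R[i]) :
  0 <= \sum_i \sum_i' c i * conjc (c i') * contraction v (x i' - x i).
Proof.
pose C (k k' : I * 'I_d) := r k.2 k'.2 (x k'.1 - x k.1).
have Csym k k' : C k k' = C k' k by rewrite /C r_sym opprB.
have Cpsd a : 0 <= \sum_k \sum_k' a k * a k' * C k k'.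
  exact: (r_psd (fun k : I * 'I_d => x k.1) (fun k => k.2) a).
have := complex_psd Csym Cpsd (fun k => c k.1 * v k.2); congr (0 <= _).
rewrite -(pair_bigA _ (fun i j => \sum_k' c i * v j * conjc (c k'.1 * v k'.2) *
  (C (i, j) k')%:C))/=; apply: eq_bigr => i _.
under eq_bigr do rewrite -(pair_bigA _ (fun i' j' => c i * v _ * conjc (c i' * v j') *
  (C (i, _) (i', j'))%:C))/=.
rewrite exchange_big/=; apply: eq_bigr => i' _.
rewrite /contraction mulr_sumr; apply: eq_bigr => j _.
rewrite mulr_sumr; apply: eq_bigr => j' _; rewrite /C/= rmorphM/=; ring.
Qed.

Lemma contraction_measure v : exists mu : {finite_measure set (torus R nu) -> \bar R},
  forall p, complex_integral (cm_of_measure mu) (torus_char p) = contraction v p.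
Proof.
have [mu h] := herglotz nu_gt0 (@contraction_psd v); exists mu => p.
by rewrite complex_integral_measure ?h//; exact: bounded_complex_char.
Qed.

Let mu_ v := sval (cid (contraction_measure v)).

Let mu_E v p : complex_integral (cm_of_measure (mu_ v)) (torus_char p) = contraction v p.
Proof. exact: (svalP (cid (contraction_measure v))). Qed.

Let e_ (j j' : 'I_d) (s : R[i]) (a : 'I_d) : R[i] := (a == j)%:R + s * (a == j')%:R.

Let contraction_e j j' s p : contraction (e_ j j' s) p =
  (r j j p)%:C + conjc s * (r j j' p)%:C + s * (r j' j p)%:C + s * conjc s * (r j' j' p)%:C.
Proof.
have delta (k : 'I_d) (f : 'I_d -> R[i]) : \sum_a (a == k)%:R * f a = f k.
  rewrite (bigD1 k)//= eqxx mul1r big1 ?addr0// => a /negbTE ->; exact: mul0r.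
transitivity (\sum_a (a == j)%:R * ((r a j p)%:C + conjc s * (r a j' p)%:C) +
    s * \sum_a (a == j')%:R * ((r a j p)%:C + conjc s * (r a j' p)%:C)).
  rewrite mulr_sumr -big_split/=; apply: eq_bigr => a _.
  rewrite -(delta j (fun b => (r a b p)%:C)) -(delta j' (fun b => (r a b p)%:C)).
  rewrite mulr_sumr -big_split/= !mulr_sumr -big_split/=.
  apply: eq_bigr => b _; rewrite /e_ rmorphD rmorphM !rmorph_nat/=; ring.
by rewrite !delta; ring.
Qed.

Let units4 : seq R[i] := [:: 1; -1; 'i%C; - 'i%C].

(* Polarization. *)
Lemma exists_spectral_measure j j' : exists G : complex_measure (torus R nu) R,
  forall p, complex_integral G (torus_char p) = (r j j' p)%:C.
Proof.
(* The form at [e_ j j' s] has terms with factors 1, [conjc s], [s] and [s * conjc s]. With the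
   weights [s / 4] on the fourth roots of unity only the second survives, since the sums of [s] and
   of [s^2] vanish. *)
exists (cm_sum units4 (fun s => s / 4) (fun s => cm_of_measure (mu_ (e_ j j' s)))) => p.
rewrite complex_integral_sum; last exact: bounded_complex_char.
rewrite /units4 !big_cons big_nil !mu_E !contraction_e.
have i2 : 'i%C * 'i%C = -1 :> R[i].
  by apply/eqP; rewrite eq_complex/=; apply/andP; split; apply/eqP; ring.
have c1 : conjc (1 : R[i]) = 1 by apply/eqP; rewrite eq_complex/= oppr0 !eqxx.
have cN1 : conjc (-1 : R[i]) = -1 by apply/eqP; rewrite eq_complex/= !oppr0 !eqxx.
have ci : conjc ('i%C : R[i]) = - 'i%C by apply/eqP; rewrite eq_complex/= oppr0 !eqxx.
have cNi : conjc (- 'i%C : R[i]) = 'i%C by apply/eqP; rewrite eq_complex/= oppr0 opprK !eqxx.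
rewrite c1 cN1 ci cNi.
move: ('i%C : R[i]) i2 {c1 cN1 ci cNi} => i i2.
have four : (4 : R[i]) != 0 by rewrite pnatr_eq0.
apply: (mulfI four).
set x := (r j j p)%:C; set y := (r j j' p)%:C; set z := (r j' j p)%:C; set t := (r j' j' p)%:C.
transitivity (2 * y - 2 * (i * i) * y + (2 * z + 2 * (i * i) * z)); last by rewrite i2; ring.
by field.
Qed.

Variable G : 'I_d -> 'I_d -> complex_measure (torus R nu) R.
Hypothesis GE : forall j j' p, complex_integral (G j j') (torus_char p) = (r j j' p)%:C.

(** Conjugating a measure conjugates its coefficients and changes [p] to [- p]; as [r] is real,
    [r_sym] identifies the result. *)
Lemma spectral_measure_hermitian : hermitian_measure G.
Proof.
move=> j j' A mA; rewrite -cm_conj_val; apply: complex_measure_eq => // p; apply/esym.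
rewrite complex_integral_conj; last exact: bounded_complex_char.
rewrite (_ : (fun x => conjc (torus_char p x)) = torus_char (- p)).
  by rewrite !GE (r_sym j j' p); apply/eqP; rewrite eq_complex/= oppr0 !eqxx.
by apply/funext => x; rewrite torus_charN.
Qed.

(** Reflection and conjugation together conjugate every coefficient, and [r] is real. *)
Lemma spectral_measure_even : even_measure G.
Proof.
move=> j j' A mA; rewrite torus_opp_image.
pose H := ComplexMeasure (image_charge (@measurable_torus_opp R nu) (cm_re (G j j')))
  (copp (image_charge (@measurable_torus_opp R nu) (cm_im (G j j')))).
have HA : H A = conjc (G j j' (@torus_opp R nu @^-1` A)).
  by rewrite /H /cm_val/= /copp/= /image_charge /pushforward fineN.
rewrite -[LHS]conjcK -HA; congr conjc; apply: complex_measure_eq => // p; rewrite /complex_integral/=.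
have [bR bI] := bounded_complex_char R p.
rewrite !charge_integral_copp//.
have [-> ->] := charge_integral_opp (cm_re (G j j')) p.
have [-> ->] := charge_integral_opp (cm_im (G j j')) p.
have := congr1 (@complex.Im R) (GE j j' p).
by rewrite /complex_integral/= => h; congr (_ +i* _); lra.
Qed.

(** Both sides are complex measures with coefficients [contraction v], so uniqueness applies;
    positivity of [mu_ v] thereby passes to any [G] that represents [r]. *)
Let contraction_val v A : measurable A ->
  \sum_j \sum_j' v j * conjc (v j') * G j j' A = (fine (mu_ v A))%:C.
Proof.
move=> mA; pose H := cm_sum (index_enum ('I_d * 'I_d)%type)
  (fun k => v k.1 * conjc (v k.2)) (fun k => G k.1 k.2).
have -> : (fine (mu_ v A))%:C = cm_of_measure (mu_ v) A.
  by rewrite /cm_val/= /charge_of_finite_measure.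
have -> : \sum_j \sum_j' v j * conjc (v j') * G j j' A = H A.
  by rewrite cm_sum_val// pair_bigA.
apply: complex_measure_eq => // p; rewrite mu_E complex_integral_sum; last first.
  exact: bounded_complex_char.
rewrite /contraction pair_bigA/=; apply: eq_bigr => k _.
by rewrite GE.
Qed.

Lemma spectral_measure_ge0 (v : 'I_d -> R[i]) A : measurable A ->
  0 <= \sum_j \sum_j' v j * conjc (v j') * G j j' A.
Proof. by move=> mA; rewrite contraction_val// complex_ge0/= eqxx fine_ge0. Qed.

End matrix_herglotz.

(** * Spectral representation of a stationary field *)

Section stationary_covariance.
Context (R : realType) (d nu : nat) dO (Omega : measurableType dO) (P : probability Omega R).
Variable X : 'rV[int]_nu -> 'I_d -> {RV P >-> R}.
Hypothesis X2 : finite_second_moments X.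

Let r j j' p := fine 'E_P[(X 0 j : Omega -> R) \* X p j'].

Lemma integrable_field_mul p q j j' :
  P.-integrable setT (EFin \o (fun w => X p j w * X q j' w)).
Proof. by apply/Lfun1_integrable; apply: Lfun2_mul_Lfun1; exact: X2. Qed.

Hypothesis Xstat : stationary X.

(** Translation by [- p] moves [(p, q)] to [(0, q - p)]; equal laws of two-point samples give equal
    laws of the products, hence equal means. *)
Lemma stationary_covariance p q j j' : \int[P]_w (X p j w * X q j' w) = r j j' (q - p).
Proof.
rewrite /r unlock /Rintegral; congr fine.
pose Y (p q : 'rV[int]_nu) w : R := X p j w * X q j' w.
have mY p' q' : measurable_fun setT (Y p' q') by exact: measurable_funM.
have law A : measurable A -> P (Y p q @^-1` A) = P (Y 0 (q - p) @^-1` A).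
  move=> mA; pose B := [set t : 2.-tuple (d.-tuple R) |
    A (tnth (tnth t ord0) j * tnth (tnth t (lift ord0 ord0)) j')].
  have mB : measurable B.
    rewrite -[B]setTI; apply: (_ : measurable_fun setT
      (fun t : 2.-tuple (d.-tuple R) => tnth (tnth t ord0) j * tnth (tnth t (lift ord0 ord0)) j')) => //.
    by apply: measurable_funM;
      apply: (measurableT_comp (@measurable_tnth _ _ _ _)); exact: measurable_tnth.
  have := @Xstat (- p) 2 [tuple p; q] B mB.
  rewrite (_ : sample X [tuple p; q] @^-1` B = Y p q @^-1` A); last first.
    by apply/seteqP; split => w /=; rewrite /B/= /sample !tnth_mktuple.
  move=> <-; congr (P _).
  by apply/seteqP; split => w /=; rewrite /B/= /sample !tnth_mktuple !(tnth_nth 0)/= subrr.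
apply: (@eq_law_integral _ _ _ P (Y p q) (Y 0 (q - p)) EFin) => //.
- exact: (integrable_field_mul p q j j').
- exact: (integrable_field_mul 0 (q - p) j j').
Qed.

Lemma covariance_sym j j' p : r j' j p = r j j' (- p).
Proof.
rewrite -{1}(subr0 p) -(sub0r p) -!stationary_covariance.
by apply: eq_Rintegral => w _; rewrite mulrC.
Qed.

(** The form is the second moment of [\sum_k a k * X (x k) (i k)]. *)
Lemma covariance_psd (K : finType) (x : K -> 'rV[int]_nu) (i : K -> 'I_d) (a : K -> R) :
  0 <= \sum_k \sum_k' a k * a k' * r (i k) (i k') (x k' - x k).
Proof.
rewrite (_ : \sum_k _ = \int[P]_w ((\sum_k a k * X (x k) (i k) w) ^+ 2)).
  by apply: Rintegral_ge0 => w _; exact: sqr_ge0.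
have iterm k k' : P.-integrable setT
    (EFin \o (fun w => a k * a k' * (X (x k) (i k) w * X (x k') (i k') w))).
  rewrite (_ : _ \o _ = fun w => ((a k * a k')%:E * (X (x k) (i k) w * X (x k') (i k') w)%:E)%E)//.
  by apply: integrableZl => //; exact: integrable_field_mul.
transitivity (\int[P]_w (\sum_(k : K * K) a k.1 * a k.2 * (X (x k.1) (i k.1) w * X (x k.2) (i k.2) w))).
  have iterm2 (k : K * K) := iterm k.1 k.2.
  rewrite pair_bigA/= Rintegral_sum//.
  apply: eq_bigr => k _; rewrite RintegralZl//; last exact: integrable_field_mul.
  by rewrite stationary_covariance.
apply: eq_Rintegral => w _; rewrite expr2 mulr_suml.
under [in RHS]eq_bigr do rewrite mulr_sumr.
rewrite pair_bigA/=; apply: eq_bigr => k _; ring.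
Qed.

End stationary_covariance.

Lemma spectral_representation (R : realType) (d nu : nat) (nu_gt0 : (0 < nu)%N)
    (dO : measure_display) (Omega : measurableType dO) (P : probability Omega R)
    (X : 'rV[int]_nu -> 'I_d -> {RV P >-> R}) :
  finite_second_moments X -> stationary X ->
  let r j j' p := fine 'E_P[(X 0 j : Omega -> R) \* X p j'] in
  exists G : 'I_d -> 'I_d -> complex_measure (torus R nu) R,
    [/\ (forall j j', finite_total_variation (G j j')) /\
        (forall j j' p,
           (r j j' p)%:C = complex_integral (G j j') (torus_char p)),
        forall j j' (H : complex_measure (torus R nu) R),
          finite_total_variation H ->
          (forall p, (r j j' p)%:C = complex_integral H (torus_char p)) ->
          forall A : set (torus R nu), measurable A -> H A = G j j' A,
        hermitian_measure G,
        even_measure G &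
        (exists mu : {finite_measure set (torus R nu) -> \bar R},
           forall j j', cm_dominated (G j j') mu) /\
        (forall mu : {finite_measure set (torus R nu) -> \bar R},
           (forall j j', cm_dominated (G j j') mu) ->
           {ae mu, forall x, psdmx (RN_matrix G mu x)})].
Proof.
move=> X2 Xstat r.
have r_sym := covariance_sym X2 Xstat.
have r_psd := covariance_psd X2 Xstat.
pose G j j' := sval (cid (exists_spectral_measure nu_gt0 r_sym r_psd j j')).
have GE j j' p : complex_integral (G j j') (torus_char p) = (r j j' p)%:C.
  exact: (svalP (cid (exists_spectral_measure nu_gt0 r_sym r_psd j j'))).
have Gherm := spectral_measure_hermitian r_sym GE.
exists G; split.
- by split=> // j j'; exact: finite_total_variation_any.
- by move=> j j' H _ HE A mA; apply: complex_measure_eq => // p; rewrite -HE GE.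
- exact: Gherm.
- exact: (spectral_measure_even GE).
- split.
    have [mu h] := exists_dominating_measure (fun k : 'I_d * 'I_d => G k.1 k.2).
    by exists mu => j j'; exact: (h (j, j')).
  move=> mu dom; apply: (spectral_density_psd Gherm _ dom) => v A mA.
  exact: (spectral_measure_ge0 nu_gt0 r_sym r_psd GE).
Qed.

(** * The normal law *)

Section affine_lebesgue.
Context (R : realType).
Notation mu := (@lebesgue_measure R).

(** Lebesgue measure is determined by its values on intervals []a, b]]; for negative [c] the
    preimage is closed at the other end, which leaves its length unchanged. *)
Lemma lebesgue_measure_affine (c m : R) (A : set R) : c != 0 -> measurable A ->
  mu A = (`|c|%:E * mu [set z | A (c * z + m)%R])%E.
Proof.
move=> c0 mA; have cpos : 0 < `|c| by rewrite normr_gt0.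
have mf : measurable_fun setT ((fun z => c * z + m) : measurableTypeR R -> measurableTypeR R).
  by apply: measurable_funD => //; exact: measurable_funM.
pose k := NngNum (ltW cpos).
pose M : {measure set (measurableTypeR R) -> \bar R} := mscale k (image_measure mf mu).
suff : mu A = M A by [].
apply: lebesgue_measure_unique => // _ [[a b] _ <-].
have MX (X : set R) : M X = (`|c|%:E * mu ((fun z : R => (c * z + m)%R) @^-1` X))%E by [].
rewrite MX lebesgue_measure_itv/= lte_fin.
have pre : ((fun z => c * z + m) @^-1` `]a, b]%classic) =
    if 0 < c then `](a - m) / c, (b - m) / c]%classic else `[(b - m) / c, (a - m) / c[%classic.
  apply/seteqP; split=> z /=; rewrite in_itv/=; have [cp|cn] := ltP 0 c; rewrite /= in_itv/=.
  - by rewrite ltr_pdivrMr// ler_pdivlMr// => /andP[h1 h2]; apply/andP; split; lra.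
  - have {}cn : c < 0 by rewrite lt_neqAle c0.
    by rewrite ltr_ndivlMr// ler_ndivrMr// => /andP[h1 h2]; apply/andP; split; lra.
  - by rewrite ltr_pdivrMr// ler_pdivlMr// => /andP[h1 h2]; apply/andP; split; lra.
  - have {}cn : c < 0 by rewrite lt_neqAle c0.
    by rewrite ltr_ndivlMr// ler_ndivrMr// => /andP[h1 h2]; apply/andP; split; lra.
rewrite pre; have [cp|cn] := ltP 0 c.
  rewrite lebesgue_measure_itv/= lte_fin ltr_pM2r ?invr_gt0// ltrD2r.
  case: ifP => _; last by rewrite mule0.
  by rewrite -EFinD -EFinM gtr0_norm//; congr EFin; field.
have {}cn : c < 0 by rewrite lt_neqAle c0.
rewrite lebesgue_measure_itv/= lte_fin ltr_nM2r ?invr_lt0// ltrD2r.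
case: ifP => _; last by rewrite mule0.
by rewrite -EFinD -EFinM ltr0_norm//; congr EFin; field.
Qed.

Lemma ge0_integral_affine (c m : R) (g : R -> \bar R) : c != 0 ->
  measurable_fun setT g -> (forall x, 0 <= g x)%E ->
  (\int[mu]_u g u = `|c|%:E * \int[mu]_z g (c * z + m)%R)%E.
Proof.
move=> c0 mg g0; have cpos : 0 < `|c| by rewrite normr_gt0.
have mf : measurable_fun setT ((fun z => c * z + m) : measurableTypeR R -> measurableTypeR R).
  by apply: measurable_funD => //; exact: measurable_funM.
pose k := NngNum (ltW cpos).
pose M : {measure set (measurableTypeR R) -> \bar R} := mscale k (image_measure mf mu).
transitivity (\int[M]_u g u)%E.
  by apply: eq_measure_integral => A mA _; exact: (lebesgue_measure_affine m c0 mA).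
rewrite ge0_integral_mscale//; congr (_ * _)%E.
by rewrite [LHS](ge0_integral_pushforward mf).
Qed.

End affine_lebesgue.

Section density.
Context (R : realType).
Notation mu := (@lebesgue_measure R).

Lemma integral_normal_prob (m s : R) (f : R -> \bar R) :
  measurable_fun setT f -> (forall x, 0 <= f x)%E ->
  (\int[normal_prob m s]_x f x = \int[mu]_x (f x * (normal_pdf m s x)%:E))%E.
Proof.
move=> mf f0.
have nmu : normal_prob m s `<< mu by exact: normal_prob_dominates.
rewrite -(Radon_Nikodym_SigmaFinite.change_of_variables nmu)//.
apply: ae_eq_integral => //.
- apply: emeasurable_funM => //.
  exact: measurable_int (Radon_Nikodym_SigmaFinite.f_integrable nmu).
- by apply: emeasurable_funM => //; apply/measurable_EFinP; exact: measurable_normal_pdf.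
apply: ae_eqe_mul2l; apply: integral_ae_eq => //.
- exact: Radon_Nikodym_SigmaFinite.f_integrable.
- by apply/measurable_EFinP; exact: measurable_normal_pdf.
- by move=> E _ mE; rewrite -Radon_Nikodym_SigmaFinite.f_integral.
Qed.

Lemma normal_pdf_affine (m s : R) x : s != 0 ->
  normal_pdf m s x = `|s|^-1 * normal_pdf 0 1 ((x - m) / s).
Proof.
move=> s0; rewrite !normal_pdfE// ?oner_eq0// /normal_peak /normal_fun.
rewrite mulrA; congr (_ * expR _).
  have -> : s ^+ 2 * pi *+ 2 = s ^+ 2 * (1 ^+ 2 * pi *+ 2) by rewrite expr1n; ring.
  by rewrite sqrtrM ?sqr_ge0// sqrtr_sqr invfM.
rewrite subr0 expr1n; field.
exact: s0.
Qed.

Lemma normal_prob_affine (c m : R) (B : set R) : c != 0 -> measurable B ->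
  normal_prob 0 1 [set z | B (c * z + m)] = normal_prob m `|c| B.
Proof.
move=> c0 mB; rewrite /normal_prob.
have mpdf (x y : R) : measurable_fun setT (EFin \o normal_pdf x y).
  by apply/measurable_EFinP; exact: measurable_normal_pdf.
have indicE' (A : set R) (f : R -> R) : (\int[mu]_(x in A) (f x)%:E = \int[mu]_x ((\1_A x)%:E * (f x)%:E))%E.
  rewrite integral_mkcond; apply: eq_integral => x _; rewrite patchE indicE.
  by case: (x \in A); rewrite ?mul1e ?mul0e.
rewrite (indicE' B) (indicE' [set z | B (c * z + m)]) [RHS](@ge0_integral_affine R c m)//; last 2 first.
- apply: emeasurable_funM; first by apply/measurable_EFinP; exact: measurable_indic.
  exact: mpdf.
- by move=> x; rewrite mule_ge0// lee_fin ?normal_pdf_ge0.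
have cn : `|c| != 0 by rewrite normr_eq0.
have mA : measurable [set z | B (c * z + m)].
  rewrite -[[set _ | _]]setTI.
  by apply: (_ : measurable_fun setT (fun z : R => c * z + m)) => //; apply: measurable_funD => //; exact: measurable_funM.
have maff : measurable_fun setT (fun z : R => c * z + m).
  by apply: measurable_funD => //; exact: measurable_funM.
rewrite -ge0_integralZl_EFin//; last first.
- apply: emeasurable_funM.
    apply/measurable_EFinP; apply: (@measurableT_comp _ _ _ _ _ _ (\1_B : R -> R)) => //.
  exact: (measurableT_comp (mpdf _ _) maff).
- by move=> x _; rewrite mule_ge0// lee_fin ?normal_pdf_ge0.
apply: eq_integral => z _.
rewrite (normal_pdf_affine m _ cn) normr_id -!EFinM; congr EFin.
have -> : \1_B (c * z + m) = \1_[set z | B (c * z + m)] z :> R.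
  by rewrite !indicE; congr (nat_of_bool _)%:R; apply/idP/idP; rewrite !inE.
rewrite addrK mulrCA; congr (_ * _); rewrite mulrA divff// mul1r.
rewrite !normal_pdfE ?oner_eq0//; congr (_ * expR _).
rewrite !subr0; congr (- _ / _); rewrite exprMn exprVn real_normK ?num_real// exprMn mulrAC divff ?mul1r//.
by rewrite expf_eq0 (negbTE c0).
Qed.

(* Completing the square in [y]. *)
Lemma normal_pdf_convolution (a b u y : R) : 0 < a ->
  let rho := Num.sqrt (a ^+ 2 + b ^+ 2) in
  normal_pdf (b * y) a u * normal_pdf 0 1 y =
  normal_pdf 0 rho u * normal_pdf (b * u / rho ^+ 2) (a / rho) y.
Proof.
move=> a0 rho; have r2 : rho ^+ 2 = a ^+ 2 + b ^+ 2.
  by rewrite sqr_sqrtr// addr_ge0// sqr_ge0.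
have rp : 0 < rho by rewrite sqrtr_gt0 ltr_wpDr ?sqr_ge0 ?exprn_gt0.
have rn : rho != 0 by rewrite gt_eqF.
have an : a != 0 by rewrite gt_eqF.
rewrite !normal_pdfE ?oner_eq0 ?mulf_neq0 ?invr_eq0// /normal_peak /normal_fun.
rewrite [LHS]mulrACA [RHS]mulrACA -!expRD; congr (_ * expR _).
  rewrite -!invfM -!sqrtrM; last 2 first.
  - by rewrite mulrn_wge0// mulr_ge0 ?sqr_ge0 ?pi_ge0.
  - by rewrite mulrn_wge0// mulr_ge0 ?sqr_ge0 ?pi_ge0.
  congr (Num.sqrt _)^-1; field; exact: rn.
rewrite subr0 expr1n !expr_div_n r2.
have q0 : a ^+ 2 + b ^+ 2 != 0 by rewrite -r2 expf_neq0.
field.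
by rewrite an q0.
Qed.

(** The law of [a Z + b Y] for independent standard normal [Z] and [Y], as an iterated integral.
    After Tonelli's theorem and completing the square, the inner integral in [y] is that of a normal
    density and equals 1. *)
Lemma normal_prob_convolution (a b : R) (B : set R) : 0 <= b -> measurable B ->
  (\int[normal_prob 0 1]_y normal_prob 0 1 [set z | B (a * z + b * y)%R] =
   normal_prob 0 1 [set z | B (Num.sqrt (a ^+ 2 + b ^+ 2) * z)%R])%E.
Proof.
move=> b0 mB; have [->|a0] := eqVneq a 0.
  (* For [a = 0] the inner law has no density: its value is 0 or 1. *)
  rewrite expr0n add0r sqrtr_sqr ger0_norm//.
  have mb : measurable [set y : R | B (b * y)].
    rewrite -[[set _ | _]]setTI.
    by apply: (_ : measurable_fun setT (fun z : R => b * z)) => //; exact: measurable_funM.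
  transitivity (\int[normal_prob 0 1]_y (\1_[set y : R | B (b * y)] y)%:E)%E; last first.
    by rewrite integral_indic// setIT.
  apply: eq_integral => y _; rewrite indicE; have [By|nBy] := pselect (B (b * y)).
    rewrite mem_set// (_ : [set z | _] = setT) ?probability_setT//.
    by apply/seteqP; split => // z _ /=; rewrite mul0r add0r.
  rewrite memNset// (_ : [set z | _] = set0) ?measure0//.
  by apply/seteqP; split => // z /=; rewrite mul0r add0r.
have ap : 0 < `|a| by rewrite normr_gt0.
pose rho := Num.sqrt (a ^+ 2 + b ^+ 2).
have rp : 0 < rho by rewrite sqrtr_gt0 ltr_wpDr ?sqr_ge0 ?exprn_even_gt0.
have rn : rho != 0 by rewrite gt_eqF.
rewrite -/rho; have := @normal_prob_affine rho 0 B rn mB.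
under eq_set do rewrite addr0; rewrite (gtr0_norm rp) => ->.
transitivity (\int[normal_prob 0 1]_y normal_prob (b * y)%R `|a|%R B)%E.
  by apply: eq_integral => y _; rewrite normal_prob_affine.
have an : `|a| != 0 by rewrite gt_eqF.
have mpdf2 : measurable_fun setT
    (fun p : measurableTypeR R * measurableTypeR R => (\1_B p.2 * (normal_pdf (b * p.1) `|a| p.2 * normal_pdf 0 1 p.1))%:E).
  apply/measurable_EFinP.
  apply: measurable_funM.
    by apply: (@measurableT_comp _ _ _ _ _ _ (\1_B : R -> R)) => //; exact: measurable_indic.
  apply: measurable_funM; last first.
    exact: (measurableT_comp (@measurable_normal_pdf R 0 1)).
  under eq_fun do rewrite normal_pdfE//.
  apply: measurable_funM => //.
  apply: (measurableT_comp (@measurable_expR R)).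
  apply: measurable_funM => //; apply: measurableT_comp => //; apply: measurable_funX.
  by apply: measurable_funB => //; exact: measurable_funM.
have mpdf (x y : R) : measurable_fun setT (EFin \o normal_pdf x y).
  by apply/measurable_EFinP; exact: measurable_normal_pdf.
have m1B : measurable_fun setT (\1_B : R -> R) by exact: measurable_indic.
have indicE' (f : R -> R) : (\int[lebesgue_measure]_(x in B) (f x)%:E = \int[lebesgue_measure]_x ((\1_B x)%:E * (f x)%:E))%E.
  rewrite integral_mkcond; apply: eq_integral => x _; rewrite patchE indicE.
  by case: (x \in B); rewrite ?mul1e ?mul0e.
have mBp (x y : R) : measurable_fun setT (fun u : R => (\1_B u)%:E * (normal_pdf x y u)%:E)%E.
  by apply: emeasurable_funM; [exact/measurable_EFinP|exact: mpdf].
rewrite integral_normal_prob//; last first.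
  rewrite (_ : (fun y => _) =
      normal_prob 0 1 \o xsection [set p : measurableTypeR R * measurableTypeR R | B (a * p.2 + b * p.1)]).
    apply: measurable_fun_xsection; rewrite -[X in measurable X]setTI.
    apply: (_ : measurable_fun setT (fun p : measurableTypeR R * measurableTypeR R => a * p.2 + b * p.1)) => //.
    by apply: measurable_funD; exact: measurable_funM.
  apply/funext => y; rewrite -normal_prob_affine//=; congr normal_prob.
  by apply/seteqP; split=> z /=; rewrite /xsection/= inE.
transitivity (\int[mu]_y \int[mu]_u (\1_B u * (normal_pdf (b * y) `|a| u * normal_pdf 0 1 y))%:E)%E.
  apply: eq_integral => y _.
  rewrite /normal_prob indicE' muleC.
  have ge0Bp : forall u, setT u -> (0 <= (\1_B u)%:E * (normal_pdf (b * y) `|a| u)%:E)%E.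
    by move=> u _; rewrite mule_ge0// lee_fin ?normal_pdf_ge0.
  have <- := ge0_integralZl_EFin mu measurableT ge0Bp (mBp _ _) (normal_pdf_ge0 0 1 y).
  apply: eq_integral => u _; rewrite -!EFinM; congr EFin.
  by rewrite mulrCA; congr (_ * _); exact: mulrC.
rewrite (@fubini_tonelli _ _ (measurableTypeR R) (measurableTypeR R) R mu mu _ mpdf2); last first.
  by move=> p; rewrite lee_fin !mulr_ge0 ?normal_pdf_ge0.
rewrite /normal_prob indicE'; apply: eq_integral => u _ /=.
under eq_integral do rewrite (normal_pdf_convolution _ _ _ ap) real_normK ?num_real// -/rho mulrA EFinM.
rewrite ge0_integralZl_EFin ?integral_normal_pdf ?mule1 -?EFinM//.
- by move=> y _; rewrite lee_fin normal_pdf_ge0.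
- exact: mpdf.
- by rewrite mulr_ge0 ?normal_pdf_ge0.
Qed.

End density.

Section second_moment.
Context (R : realType).
Notation mu := (@lebesgue_measure R).

(** Integration by parts: [(x^2 - 1) phi] is the derivative of [- x phi], so on [[- n - 1, n + 1]]
    the second moment and the mass differ by a boundary term that tends to 0. *)
Lemma normal_second_moment : (\int[normal_prob 0 1]_x (x ^+ 2)%:E = 1 :> \bar R)%E.
Proof.
pose c : R := normal_peak 1.
pose phi (x : R) : R := c * expR (- x ^+ 2 / 2).
have c0 : 0 <= c by exact: normal_peak_ge0.
have phiE : normal_pdf 0 1 = phi.
  apply/funext => x; rewrite normal_pdfE ?oner_eq0// /normal_fun /phi -/c.
  by rewrite subr0 expr1n.
have phi0 x : 0 <= phi x by rewrite mulr_ge0 ?expR_ge0.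
have dphi (x : R) : is_derive x 1 (fun x => - (x * phi x)) ((x ^+ 2 - 1) * phi x).
  apply: is_derive_eq.
  rewrite /phi /GRing.scale/=; field => //.
have cphi : continuous phi by rewrite -phiE; exact: continuous_normal_pdf (oner_neq0 _).
have csq : continuous (fun x : R => x ^+ 2) by exact: exprn_continuous.
pose I (n : nat) : set R := `[- n.+1%:R, n.+1%:R]%classic.
have step (n : nat) : (\int[mu]_(x in I n) (x ^+ 2 * phi x)%:E =
    \int[mu]_(x in I n) (phi x)%:E - (n.+1%:R * phi n.+1%:R *+ 2)%R%:E)%E.
  have int (g : R -> R) : continuous g -> mu.-integrable (I n) (EFin \o g).
    move=> cg; apply: continuous_compact_integrable; first exact: segment_compact.
    by apply: continuous_subspaceT.
  have -> : (- (n.+1%:R * phi n.+1%:R *+ 2)%R%:E = \int[mu]_(x in I n) ((x ^+ 2 - 1) * phi x)%:E)%E.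
    rewrite (@continuous_FTC2 _ _ (fun x => - (x * phi x))).
    - rewrite -EFinN -EFinB; congr EFin.
      have -> : phi (- n.+1%:R) = phi n.+1%:R by rewrite /phi sqrrN.
      ring.
    - by rewrite gtrN// ltr0n.
    - apply: continuous_subspaceT => x.
      apply: cvgM; last exact: cphi.
      by apply: cvgB; [exact: csq|exact: cvg_cst].
    - have cF : continuous (fun x : R => - (x * phi x)) => [x|].
          by apply: cvgN; apply: cvgM; [exact: cvg_id|exact: cphi].
      split; first by move=> x _; exact: ex_derive.
        by apply: cvg_at_right_filter; exact: cF.
      by apply: cvg_at_left_filter; exact: cF.
    - by move=> x _; rewrite derive1E; exact: derive_val.
  rewrite -integralD_EFin//.
  - by apply: eq_integral => x _; congr EFin; rewrite mulrBl mul1r addrC subrK.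
  - exact: measurable_itv.
  - exact: int.
  - apply: int => x; apply: cvgM; last exact: cphi.
    by apply: cvgB; [exact: csq|exact: cvg_cst].
rewrite integral_normal_prob//; last 2 first.
- by apply/measurable_EFinP; exact: measurable_funX.
- by move=> x; rewrite lee_fin sqr_ge0.
rewrite phiE.
have UI : \bigcup_n I n = setT.
  apply/seteqP; split=> // x _; exists (Num.bound `|x|) => //=.
  rewrite /I/= in_itv/= -ler_norml (le_trans (ltW (archi_boundP _)))// ler_nat; exact: leqnSn.
have cvI (g : R -> R) : continuous g -> (forall x, 0 <= g x) ->
    (\int[mu]_(x in I n) (g x)%:E @[n --> \oo] --> \int[mu]_x (g x)%:E)%E.
  move=> cg g0; rewrite -UI; apply: ge0_nondecreasing_set_cvg_integral.
  - move=> m n mn; apply/subsetPset => x; rewrite /I/= !in_itv/= => /andP[x1 x2].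
    have h : m.+1%:R <= n.+1%:R :> R by rewrite ler_nat.
    by rewrite (le_trans _ x1) ?lerN2// (le_trans x2).
  - by move=> n; exact: measurable_itv.
  - move=> n; apply/measurable_EFinP; apply: measurable_funTS.
    exact: continuous_measurable_fun.
  - by move=> n x _; rewrite lee_fin.
have cq : continuous (fun x : R => x ^+ 2 * phi x).
  by move=> x; apply: cvgM; [exact: csq|exact: cphi].
have c1 := cvI _ cq (fun x => mulr_ge0 (sqr_ge0 x) (phi0 x)).
have c2 := cvI _ cphi phi0.
(* With [t = x^2 / 2], the inequality [t * expR (- t) <= 1] bounds [2 * x * phi x] by
   [4 * c / x]. *)
have lim0 : (n.+1%:R * phi n.+1%:R *+ 2) @[n --> \oo] --> (0 : R).
  have cv : 4 * c * harmonic n @[n --> \oo] --> (0 : R).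
    rewrite -(mulr0 (4 * c)); apply: cvgM; first exact: cvg_cst.
    exact: cvg_harmonic.
  apply: squeeze_cvgr (cvg_cst 0) cv; apply: nearW => n.
  rewrite mulrn_wge0 ?mulr_ge0//= -[in leRHS](mulr1 (4 * c)) /harmonic.
  set x : R := n.+1%:R; have x0 : 0 < x by rewrite ltr0n.
  have : x ^+ 2 / 2 * expR (- x ^+ 2 / 2) <= 1.
    rewrite -[leRHS](expRxMexpNx_1 (x ^+ 2 / 2)) mulNr ler_wpM2r ?expR_ge0//.
    by rewrite (le_trans _ (expR_ge1Dx _))// lerDr.
  move=> h; rewrite -(ler_pM2l x0).
  have -> : x * (x * phi x *+ 2) = 4 * c * (x ^+ 2 / 2 * expR (- x ^+ 2 / 2)) by rewrite /phi; field.
  have -> : x * (4 * c * 1 / x) = 4 * c by field; rewrite gt_eqF.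
  by rewrite -[leRHS]mulr1 ler_wpM2l// mulr_ge0.
have mass : (\int[mu]_x (phi x)%:E = 1)%E by rewrite -phiE integral_normal_pdf.
rewrite mass in c2.
have c4 : ((n.+1%:R * phi n.+1%:R *+ 2)%R%:E @[n --> \oo] --> (0 : R)%:E)%E.
  by apply: cvg_EFin lim0; exact: nearW.
rewrite (_ : (fun n => _) = (fun n => \int[mu]_(x in I n) (phi x)%:E - (n.+1%:R * phi n.+1%:R *+ 2)%R%:E)%E) in c1; last first.
  by apply/funext => n; exact: step.
by rewrite (cvg_unique _ c1 (cvgeB _ c2 c4))// sube0.
Qed.

End second_moment.

(** * White noise on the unit interval *)

Section coding.
Context (R : realType).

(** Lebesgue measure on [0, 1[, kept as a measure on R so that maps defined on R compose without
    restriction. *)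
Definition unit_measure : set (measurableTypeR R) -> \bar R :=
  @mrestr _ (measurableTypeR R) R `[0, 1[%classic (@lebesgue_measure R) (measurable_itv _).

HB.instance Definition _ := Measure.on unit_measure.

Let unit_setT : unit_measure setT = 1%E.
Proof. by rewrite /unit_measure /mrestr setTI lebesgue_measure_itv/= lte01 sube0. Qed.

HB.instance Definition _ := @Measure_isProbability.Build _ _ R unit_measure unit_setT.

Lemma drop_prefix n m c : (n <= m)%N -> drop (m - n) (prefix m c) = prefix n c.
Proof.
elim: m => [|m IH]; first by rewrite leqn0 => /eqP ->.
rewrite leq_eqVlt => /predU1P[->|nm]; first by rewrite subnn drop0.
by rewrite subSn//= IH.
Qed.

(** Functions of finitely many bits are closed under products, so the uniqueness theorem applies to
    them as it does to trigonometric functions. *)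
Lemma bitstream_measure_eq (m1 m2 : {finite_measure set bitstream -> \bar R}) :
  (forall s, m1 [set c | prefix (size s) c = s] = m2 [set c | prefix (size s) c = s]) ->
  forall B, measurable B -> m1 B = m2 B.
Proof.
move=> m12 B mB.
pose A := [set f : bitstream -> R | exists n h, f = fun c => h (prefix n c)].
apply: (@measure_eq_generated _ _ R m1 m2 A).
- by move=> _ [n [h ->]]; exact: bounded_measurable_prefix.
- by exists 0, (fun=> 1).
- move=> _ _ [n [h ->]] [m [k ->]]; have [nm|mn] := leqP n m.
    exists (fun c => h (drop (m - n) (prefix m c)) * k (prefix m c)), (fun=> 0); split.
    + by exists m, (fun s => h (drop (m - n) s) * k s).
    + by exists 0, (fun=> 0).
    + by move=> c; rewrite drop_prefix// addr0.
  exists (fun c => h (prefix n c) * k (drop (n - m) (prefix n c))), (fun=> 0); split.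
  + by exists n, (fun s => h s * k (drop (n - m) s)).
  + by exists 0, (fun=> 0).
  + by move=> c; rewrite drop_prefix ?addr0// ltnW.
- move=> _ [n [h ->]]; rewrite !Rintegral_prefix; apply: eq_bigr => s _.
  by have := m12 s; rewrite size_tuple => ->.
- apply: smallest_sub mB; first exact: smallest_sigma_algebra.
  move=> _ [n _ <-]; apply: sub_sigma_algebra.
  (* Generators are sets [f < c], so the cylinder of a true bit comes from the negated bit with
     threshold 1. *)
  exists (fun c => (~~ head false (prefix n.+1 c))%:R); first by exists n.+1, (fun s => (~~ head false s)%:R).
  exists 1 => //; apply/seteqP; split => c /=; case: (c n) => //=; rewrite ?ltxx ?ltr01//.
Qed.

(** The cylinder probabilities of [e] are consistent weights of total mass 1; cutting [0, 1[
    accordingly reproduces the law of [e]. *)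
Lemma bitstream_code d (T : measurableType d) (Q : probability T R) (e : T -> bitstream) :
  measurable_fun setT e ->
  exists2 phi : measurableTypeR R -> bitstream, measurable_fun setT phi &
    forall A : set bitstream, measurable A -> unit_measure (phi @^-1` A) = Q (e @^-1` A).
Proof.
move=> me; pose E s := [set x | prefix (size s) (e x) = s].
have mE s : measurable (E s).
  by have := me measurableT _ (measurable_prefix (size s) s); rewrite setTI.
pose w s := fine (Q (E s)).
have w_ge0 s : 0 <= w s by rewrite fine_ge0.
have wD s : w s = w (false :: s) + w (true :: s).
  rewrite /w -fineD ?fin_num_measure// -measureU//.
    congr (fine (Q _)); apply/seteqP; split => x /=.
      rewrite /E/= => ->; case: (e x _); [by right|by left].
    by rewrite /E/= => -[] [].
  by apply/seteqP; split => // x /= [] [+ _] [+ _]; rewrite /= => ->.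
have w1 : w [::] = 1.
  rewrite /w (_ : E [::] = setT) ?probability_setT//.
  by apply/seteqP; split.
have mphi : measurable_fun setT (subdivision w : measurableTypeR R -> bitstream).
  exact: measurable_subdivision.
exists (subdivision w) => // A mA.
suff: forall B, measurable B -> image_measure mphi unit_measure B = image_measure me Q B.
  by move=> /(_ A mA).
apply: bitstream_measure_eq => s; rewrite /= /image_measure /pushforward /unit_measure /mrestr.
have := lebesgue_subdivision w_ge0 wD s; rewrite w1 setIC => -> .
by rewrite /w fineK ?fin_num_measure//; exact: mE.
Qed.

Definition rational_threshold (j : nat) : R := ratr (odflt 0 (unpickle j)).

(** The upper Dedekind cut of [x] along an enumeration of the rationals; numbers coding no rational
    repeat the threshold 0. *)
Definition threshold_code (x : R) : bitstream := fun j => x < rational_threshold j.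

Definition threshold_decode (c : bitstream) : R := inf [set rational_threshold j | j in [set j | c j]].

Lemma threshold_codeK : cancel threshold_code threshold_decode.
Proof.
move=> x; rewrite /threshold_decode; set S := [set _ | _ in _].
have lb : lbound S x by move=> _ [j /= h <-]; exact: ltW.
have above y : x < y -> exists2 z, S z & z < y.
  move=> /rat_in_itvoo[q]; rewrite in_itv/= => /andP[xq qy].
  exists (ratr q) => //; exists (pickle q); rewrite /= /threshold_code /rational_threshold pickleK//.
have S0 : S !=set0 by have [|z Sz _] := above (x + 1); [rewrite ltrDl|exists z].
apply/eqP; rewrite eq_le lb_le_inf// andbT leNgt; apply/negP => /above[z Sz].
by rewrite ltNge ge_inf//; exists x.
Qed.

Lemma measurable_threshold_code : measurable_fun setT (threshold_code : measurableTypeR R -> bitstream).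
Proof.
apply: measurable_fun_bitstream => j.
rewrite (_ : [set x | _] = `]-oo, rational_threshold j[%classic); first exact: measurable_itv.
by apply/seteqP; split => x /=; rewrite in_itv.
Qed.

(** Where the infimum exists, it is below [t] exactly when some selected threshold is; elsewhere
    [inf] takes its default value 0. Existence is a countable condition: some bit is set, and some
    [- m] bounds the selected thresholds below. *)
Lemma measurable_threshold_decode : measurable_fun setT (threshold_decode : bitstream -> R).
Proof.
apply: measurable_fun_ray => t.
pose bit j := [set c : bitstream | c j].
have mbit j : measurable (bit j) by exact: (@measurable_bit _ _ id).
pose S (c : bitstream) := [set rational_threshold j | j in [set j | c j]].
have mrng (P : nat -> bool) : measurable (\bigcup_(j in [set j | P j]) bit j).
  by apply: bigcup_measurable => j _; exact: mbit.
pose hasinf := [set c | has_inf (S c)].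
have mhas : measurable hasinf.
  rewrite (_ : hasinf = (\bigcup_(j in [set: nat]) bit j) `&`
     \bigcup_(m in [set: nat]) ~` (\bigcup_(j in [set j | rational_threshold j < - m%:R]) bit j)).
    apply: measurableI; first by apply: bigcup_measurable => j _; exact: mbit.
    apply: bigcup_measurable => m _; apply: measurableC; exact: mrng.
  apply/seteqP; split => c /=.
    move=> [[_ [j cj _]] [l lS]]; split; first by exists j.
    exists (Num.bound `|l|) => //= -[i /= jl ci].
    have : l <= rational_threshold i by apply: lS; exists i.
    apply/negP; rewrite -ltNge (lt_trans jl)// ltrNl.
    by rewrite (le_lt_trans _ (archi_boundP (normr_ge0 l)))// -normrN ler_norm.
  move=> [[j _ cj] [m _ h]]; split; first by exists (rational_threshold j); exists j.
  exists (- m%:R) => _ [i ci <-]; rewrite leNgt; apply/negP => im; apply: h.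
  by exists i.
rewrite (_ : [set c | _] = (hasinf `&` \bigcup_(j in [set j | rational_threshold j < t]) bit j) `|`
    (~` hasinf `&` if 0 < t then setT else set0)).
  apply: measurableU; first by apply: measurableI => //; exact: mrng.
  by apply: measurableI; [exact: measurableC|case: ifP].
apply/seteqP; split => c /=; rewrite /threshold_decode -/(S c).
  have [hi|nhi] := pselect (has_inf (S c)); last by rewrite inf_out// => ->; right.
  move=> /inf_lt => /(_ hi.1) [_ [j cj <-] jt]; left; split => //; by exists j.
move=> [[hi [j /= jt cj]]|[nhi]].
  by apply: le_lt_trans jt; apply: ge_inf; [exact: hi.2|exists j].
by rewrite inf_out//; case: ifP.
Qed.

(** Interleaving two cuts gives a measurable injection [e] into streams with measurable left inverse
    [D]. If [phi] has the law of [e], then [D \o phi] has the law of [D \o e], which is the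
    identity. *)
Lemma square_code (Q : probability (measurableTypeR R * measurableTypeR R)%type R) :
  exists2 h : measurableTypeR R -> measurableTypeR R * measurableTypeR R, measurable_fun setT h &
    forall A, measurable A -> unit_measure (h @^-1` A) = Q A.
Proof.
pose e (p : measurableTypeR R * measurableTypeR R) : bitstream :=
  fun j => if odd j then threshold_code p.2 j./2 else threshold_code p.1 j./2.
pose D (c : bitstream) : measurableTypeR R * measurableTypeR R :=
  (threshold_decode (fun j => c j.*2), threshold_decode (fun j => c j.*2.+1)).
have eK : cancel e D.
  move=> [x y]; rewrite /D /e/=; congr (_, _).
    rewrite -[RHS]threshold_codeK; congr threshold_decode; apply/funext => j.
    by rewrite odd_double doubleK.
  rewrite -[RHS]threshold_codeK; congr threshold_decode; apply/funext => j.
  by rewrite /= odd_double/= uphalf_double.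
have me : measurable_fun setT e.
  apply: measurable_fun_bitstream => j; rewrite /e.
  case: (odd j).
    apply: (@measurable_bit _ _ (fun p : measurableTypeR R * measurableTypeR R => threshold_code p.2) j./2).
    exact: (measurableT_comp measurable_threshold_code).
  apply: (@measurable_bit _ _ (fun p : measurableTypeR R * measurableTypeR R => threshold_code p.1) j./2).
  exact: (measurableT_comp measurable_threshold_code).
have mD : measurable_fun setT D.
  apply: measurable_fun_pair.
    apply: (measurableT_comp measurable_threshold_decode).
    by apply: measurable_fun_bitstream => j; exact: (@measurable_bit _ _ id).
  apply: (measurableT_comp measurable_threshold_decode).
  by apply: measurable_fun_bitstream => j; exact: (@measurable_bit _ _ id).
have [phi mphi phiQ] := bitstream_code Q me.
exists (D \o phi); first exact: measurableT_comp.
move=> A mA; rewrite comp_preimage phiQ; last by rewrite -[X in measurable X]setTI; exact: mD.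
by rewrite -comp_preimage; congr (Q _); apply/seteqP; split => p /=; rewrite eK.
Qed.

End coding.

Section laws_of_functions.
Context (R : realType).

Lemma preimage_cst_law d (T : measurableType d) (m : probability T R) (f : T -> R) a B :
  (forall x, f x = a) -> m (f @^-1` B) = \d_a B.
Proof.
move=> fa; rewrite diracE; have [Ba|nBa] := pselect (B a).
  rewrite mem_set// (_ : _ @^-1` _ = setT); first exact: probability_setT.
  by apply/seteqP; split => // x _ /=; rewrite fa.
rewrite memNset// (_ : _ @^-1` _ = set0); first exact: measure0.
by apply/seteqP; split => // x /=; rewrite fa.
Qed.

Lemma ge0_integral_law d d' (T : measurableType d) (T' : measurableType d')
    (m : {measure set T -> \bar R}) (m' : {measure set T' -> \bar R})
    (f : T -> R) (f' : T' -> R) (g : R -> \bar R) :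
  measurable_fun setT f -> measurable_fun setT f' ->
  (forall B, measurable B -> m (f @^-1` B) = m' (f' @^-1` B)) ->
  measurable_fun setT g -> (forall x, 0 <= g x)%E ->
  (\int[m]_x g (f x) = \int[m']_x g (f' x))%E.
Proof.
move=> mf mf' e mg g0.
transitivity (\int[image_measure mf m]_y g y)%E.
  by rewrite [RHS](ge0_integral_pushforward mf).
transitivity (\int[image_measure mf' m']_y g y)%E.
  by apply: eq_measure_integral => B mB _; exact: e.
by rewrite [LHS](ge0_integral_pushforward mf').
Qed.

Lemma bounded_integral_law d d' (T : measurableType d) (T' : measurableType d')
    (m : {finite_measure set T -> \bar R}) (m' : {finite_measure set T' -> \bar R})
    (f : T -> R) (f' : T' -> R) (g : R -> R) :
  measurable_fun setT f -> measurable_fun setT f' ->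
  (forall B, measurable B -> m (f @^-1` B) = m' (f' @^-1` B)) ->
  bounded_measurable g ->
  \int[m]_x g (f x) = \int[m']_x g (f' x).
Proof.
move=> mf mf' e bg.
rewrite -(Rintegral_image_measure mf)// -(Rintegral_image_measure mf')//.
exact: eq_measure_Rintegral.
Qed.

Lemma sqr_integrable_Lfun2 d (T : measurableType d) (m : {measure set T -> \bar R}) (f : T -> R) :
  measurable_fun setT f -> (\int[m]_x (f x ^+ 2)%:E < +oo)%E -> f \in Lfun m 2%:E.
Proof.
move=> mf lty; rewrite inE; apply/andP; split; rewrite inE//= /finite_norm unlock /Lnorm.
rewrite poweR_lty//; apply: le_lt_trans lty; rewrite le_eqVlt; apply/predU1P; left.
by apply: eq_integral => x _; rewrite -[LHS]/((powR `|f x| 2%:R)%:E) powR_mulrn// real_normK ?num_real.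
Qed.

End laws_of_functions.

Section white_noise.
Context (R : realType).
Notation P := (@unit_measure R).
Notation N := (@normal_prob R 0 1).

Definition split_point : measurableTypeR R -> measurableTypeR R * measurableTypeR R :=
  s2val (cid2 (square_code (P \x N)%E)).

Lemma measurable_split_point : measurable_fun setT split_point.
Proof. exact: s2valP (cid2 (square_code (P \x N)%E)). Qed.

Lemma split_point_law A : measurable A -> P (split_point @^-1` A) = (P \x N)%E A.
Proof. exact: s2valP' (cid2 (square_code (P \x N)%E)) A. Qed.

(** The components of [split_point] are independent, uniform and standard normal; the normal one is
    kept and the uniform one is split again. *)
Fixpoint white k (u : measurableTypeR R) : R :=
  if k is m.+1 then white m (split_point u).1 else (split_point u).2.

Lemma measurable_white k : measurable_fun setT (white k).
Proof.
elim: k => [|k IH] /=.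
  exact: (measurableT_comp measurable_snd measurable_split_point).
apply: (measurableT_comp IH).
exact: (measurableT_comp measurable_fst measurable_split_point).
Qed.

Definition white_sum n (c : nat -> R) (u : measurableTypeR R) : R := \sum_(k < n) c k * white k u.

Definition sumsq n (c : nat -> R) := \sum_(k < n) c k ^+ 2.

Lemma sumsq_ge0 n c : 0 <= sumsq n c.
Proof. by apply: sumr_ge0 => k _; exact: sqr_ge0. Qed.

Lemma measurable_white_sum n c : measurable_fun setT (white_sum n c).
Proof.
apply: measurable_sum => k; apply: measurable_funM => //; exact: measurable_white.
Qed.

(** Induction on [n] for all [c]: the sum is [c 0] times the normal component of [split_point] plus
    a shorter white sum of the uniform component, and [normal_prob_convolution] combines the two
    laws. Independence enters only through the product law of [split_point]. *)
Lemma white_sum_law n c (B : set R) : measurable B ->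
  P (white_sum n c @^-1` B) = N [set z | B (Num.sqrt (sumsq n c) * z)].
Proof.
elim: n c B => [|n IH] c B mB.
  rewrite /sumsq big_ord0 sqrtr0.
  rewrite [LHS](@preimage_cst_law _ _ _ P _ 0) => [|u]; last by rewrite /white_sum big_ord0.
  by rewrite [RHS](@preimage_cst_law _ _ _ N (fun z => 0 * z) 0)// => z; rewrite mul0r.
pose c' k := c k.+1; pose rho := Num.sqrt (sumsq n c').
pose A : set (measurableTypeR R * measurableTypeR R) := [set p | B (c 0%N * p.2 + p.1)].
have mA : measurable A.
  rewrite -[A]setTI.
  apply: (_ : measurable_fun setT (fun p : measurableTypeR R * measurableTypeR R => c 0%N * p.2 + p.1)) => //.
  by apply: measurable_funD => //; exact: measurable_funM.
pose A' : set (measurableTypeR R * measurableTypeR R) := [set p | A (white_sum n c' p.1, p.2)].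
have mA' : measurable A'.
  rewrite -[A']setTI.
  apply: (_ : measurable_fun setT (fun p : measurableTypeR R * measurableTypeR R => (white_sum n c' p.1, p.2))) => //.
  apply: measurable_fun_pair => //.
  exact: (measurableT_comp (measurable_white_sum n c')).
have -> : white_sum n.+1 c @^-1` B = split_point @^-1` A'.
  by apply/seteqP; split => u; rewrite /white_sum/= big_ord_recl.
rewrite split_point_law// /product_measure1.
have mg : measurable_fun setT (N \o xsection A) by exact: measurable_fun_xsection.
have mrho : measurable_fun setT (fun z : measurableTypeR R => rho * z) by exact: measurable_funM.
transitivity (\int[P]_x (N \o xsection A) (white_sum n c' x))%E.
  by apply: eq_integral => x _ /=; congr normal_prob; apply/seteqP; split => z; rewrite /xsection/= !inE.
rewrite (ge0_integral_law (measurable_white_sum n c') mrho (IH c') mg)//.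
have := @normal_prob_convolution R (c 0%N) rho B (sqrtr_ge0 _) mB.
rewrite sqr_sqrtr ?sumsq_ge0// => h.
transitivity (\int[N]_y N [set z | B (c 0%N * z + rho * y)%R])%E.
  by apply: eq_integral => y _ /=; congr normal_prob; apply/seteqP; split => z; rewrite /xsection/= !inE.
have -> : sumsq n.+1 c = c 0%N ^+ 2 + sumsq n c' by rewrite /sumsq big_ord_recl.
exact: h.
Qed.

Lemma ge0_integral_white_sum n c (g : R -> \bar R) : measurable_fun setT g ->
  (forall x, 0 <= g x)%E ->
  (\int[P]_u g (white_sum n c u) = \int[N]_z g (Num.sqrt (sumsq n c) * z)%R)%E.
Proof.
move=> mg g0.
apply: ge0_integral_law => //; first exact: measurable_white_sum.
exact: white_sum_law.
Qed.

Lemma white_sum_sqr n c : (\int[P]_u (white_sum n c u ^+ 2)%:E = (sumsq n c)%:E)%E.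
Proof.
rewrite (@ge0_integral_white_sum n c (fun x => (x ^+ 2)%:E)); last 2 first.
- by apply/measurable_EFinP; exact: measurable_funX.
- by move=> x; rewrite lee_fin sqr_ge0.
under eq_integral do rewrite exprMn sqr_sqrtr ?sumsq_ge0// EFinM.
rewrite ge0_integralZl_EFin ?sumsq_ge0//.
- by rewrite normal_second_moment mule1.
- by move=> x _; rewrite lee_fin sqr_ge0.
- by apply/measurable_EFinP; exact: measurable_funX.
Qed.

Lemma white_sum_Lfun n c : white_sum n c \in Lfun P 2%:E.
Proof.
apply: sqr_integrable_Lfun2; first exact: measurable_white_sum.
by rewrite [X in (X < _)%E]white_sum_sqr ltry.
Qed.

Lemma white_sumD n c c' u : white_sum n c u + white_sum n c' u = white_sum n (fun k => c k + c' k) u.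
Proof. by rewrite /white_sum -big_split/=; apply: eq_bigr => k _; rewrite mulrDl. Qed.

Lemma white_sumN n c u : - white_sum n c u = white_sum n (fun k => - c k) u.
Proof. by rewrite /white_sum -sumrN; apply: eq_bigr => k _; rewrite mulNr. Qed.

(** The law depends on [c] through [sumsq] only, hence is the same for the opposite coefficients,
    and the mean equals its own opposite. *)
Lemma white_sum_expectation n c : ('E_P[white_sum n c] = 0)%E.
Proof.
have i1 c' : P.-integrable setT (EFin \o white_sum n c').
  apply/Lfun1_integrable; apply: (Lfun_subset12 _ (white_sum_Lfun _ _)).
  exact: fin_num_measure.
rewrite unlock; have fin := integrable_fin_num measurableT (i1 c).
have law B : measurable B -> P (white_sum n c @^-1` B) = P (white_sum n (fun k => - c k) @^-1` B).
  move=> mB; rewrite !white_sum_law// /sumsq.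
  by under [in RHS]eq_bigr do rewrite sqrrN.
have mE : measurable_fun setT (@EFin R) by [].
have := @eq_law_integral _ _ _ P _ _ EFin (measurable_white_sum n c)
  (measurable_white_sum n _) law mE (i1 c) (i1 _).
under [X in _ = X -> _]eq_integral do rewrite -white_sumN EFinN.
rewrite integralN; last exact: integrable_add_def (i1 c).
move: fin; rewrite -[in X in X -> _]/(\int[P]_w (white_sum n c w)%:E)%E.
case: (\int[P]_w _)%E => // r _ [rr]; congr EFin; lra.
Qed.

(** Polarization of second moments, [4 x y = (x + y)^2 - (x - y)^2]; sums and differences of white
    sums are white sums. *)
Lemma white_sum_covariance n c c' :
  ('E_P[white_sum n c \* white_sum n c'] = (\sum_(k < n) c k * c' k)%:E)%E.
Proof.
have i1 a b : P.-integrable setT (EFin \o (white_sum n a \* white_sum n b)).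
  by apply/Lfun1_integrable; apply: Lfun2_mul_Lfun1; exact: white_sum_Lfun.
have sq a : \int[P]_u (white_sum n a u * white_sum n a u) = sumsq n a.
  by rewrite -[RHS]/(fine (sumsq n a)%:E) -white_sum_sqr /Rintegral; congr fine; apply: eq_integral => u _; rewrite expr2.
rewrite unlock -[LHS]fineK; last exact: integrable_fin_num (i1 c c').
congr EFin.
have pol : 4 * \int[P]_u (white_sum n c u * white_sum n c' u) =
    sumsq n (fun k => c k + c' k) - sumsq n (fun k => c k - c' k).
  rewrite -!sq -RintegralZl//; last exact: i1.
  rewrite -RintegralB//; try exact: i1.
  apply: eq_Rintegral => u _; rewrite -!white_sumD -!white_sumN; ring.
apply: (@mulfI _ 4) => //; rewrite pol /sumsq -sumrB mulr_sumr; apply: eq_bigr => k _; ring.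
Qed.

Lemma white_sum_gaussian n c : gaussian_rv P (white_sum n c).
Proof.
have [r0|r0] := eqVneq (sumsq n c) 0.
  right; exists 0 => B mB; apply: etrans (white_sum_law n c mB) _.
  by apply: (@preimage_cst_law _ _ _ N) => z; rewrite r0 sqrtr0 mul0r.
left; exists 0, (Num.sqrt (sumsq n c)); split.
  by rewrite sqrtr_gt0 lt_neqAle eq_sym r0 sumsq_ge0.
move=> B mB; apply: etrans (white_sum_law n c mB) _.
have s0 : 0 < Num.sqrt (sumsq n c) by rewrite sqrtr_gt0 lt_neqAle eq_sym r0 sumsq_ge0.
rewrite -[in RHS](gtr0_norm s0) -normal_prob_affine ?gt_eqF//.
by congr normal_prob; apply/seteqP; split => z /=; rewrite addr0.
Qed.

Lemma bounded_integral_white_sum n c (g : R -> R) : bounded_measurable g ->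
  \int[P]_u g (white_sum n c u) = \int[N]_z g (Num.sqrt (sumsq n c) * z).
Proof.
move=> bg; apply: bounded_integral_law => //; first exact: measurable_white_sum.
exact: white_sum_law.
Qed.

End white_noise.

(** * Gaussian families with a given covariance *)

Section cholesky.
Context (R : realType).
Implicit Type K : nat -> nat -> R.

(** Lists of weighted points may repeat a point, so the condition is stable under pullback along any
    map of index sets. *)
Definition psd_kernel (T : Type) (K : T -> T -> R) :=
  (forall n m, K n m = K m n) /\
  (forall s : seq (R * T), 0 <= \sum_(u <- s) \sum_(v <- s) u.1 * v.1 * K u.2 v.2).

Lemma psd_kernel_diag (T : Type) (K : T -> T -> R) k : psd_kernel K -> 0 <= K k k.
Proof.
by move=> [_ /(_ [:: (1, k)])]; rewrite !big_seq1 !mul1r.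
Qed.

Lemma psd_kernel_cons (T : Type) (K : T -> T -> R) t k (s : seq (R * T)) : psd_kernel K ->
  0 <= t ^+ 2 * K k k + 2 * t * (\sum_(u <- s) u.1 * K u.2 k) +
       \sum_(u <- s) \sum_(v <- s) u.1 * v.1 * K u.2 v.2.
Proof.
move=> [K_sym /(_ ((t, k) :: s))]; rewrite big_cons/= big_cons/=.
under [X in _ + X]eq_bigr do rewrite big_cons/=.
rewrite big_split/=.
have -> : \sum_(v <- s) t * v.1 * K k v.2 = t * \sum_(u <- s) u.1 * K u.2 k.
  by rewrite mulr_sumr; apply: eq_bigr => v _; rewrite (K_sym k) mulrA.
have -> : \sum_(v <- s) v.1 * t * K v.2 k = t * \sum_(u <- s) u.1 * K u.2 k.
  by rewrite mulr_sumr; apply: eq_bigr => v _; rewrite mulrA (mulrC t).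
by congr (0 <= _); rewrite expr2; ring.
Qed.

Lemma psd_kernel_eq0 (T : Type) (K : T -> T -> R) n k : psd_kernel K -> K k k = 0 -> K n k = 0.
Proof.
move=> psdK Kk; apply/eqP; apply: contraT => Knk.
(* When [K k k = 0] the form is affine in the weight of [k]; this weight gives it the value -1. *)
have := psd_kernel_cons (- (K n n + 1) / (2 * K n k)) k [:: (1, n)] psdK.
rewrite !big_seq1 Kk mulr0 add0r/= !mul1r.
have -> : 2 * (- (K n n + 1) / (2 * K n k)) * K n k + K n n = -1 by field.
by rewrite oppr_ge0 ler10.
Qed.

(* Where [K k k = 0], division gives [0] and [K] is unchanged. *)
Definition schur K k n m := K n m - K n k * K m k / K k k.

(** For a nonzero pivot, giving [k] the weight [- B / K k k] minimises the form of [K] over that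
    weight, and the minimum is the form of the Schur complement. *)
Lemma psd_schur K k : psd_kernel K -> psd_kernel (schur K k).
Proof.
move=> psdK; split=> [n m|s]; first by rewrite /schur psdK.1 (mulrC (K n k)).
pose B := \sum_(u <- s) u.1 * K u.2 k.
have -> : \sum_(u <- s) \sum_(v <- s) u.1 * v.1 * schur K k u.2 v.2 =
    \sum_(u <- s) \sum_(v <- s) u.1 * v.1 * K u.2 v.2 - B ^+ 2 / K k k.
  rewrite expr2 /B mulr_suml mulr_suml -sumrB; apply: eq_bigr => u _.
  rewrite mulr_sumr mulr_suml -sumrB; apply: eq_bigr => v _; rewrite /schur; ring.
have [K0|K0] := eqVneq (K k k) 0; first by rewrite K0 invr0 mulr0 subr0; exact: psdK.2.
have := psd_kernel_cons (- B / K k k) k s psdK; rewrite -/B.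
by congr (0 <= _); rewrite addrC; congr (_ + _); field.
Qed.

Fixpoint schur_iter K k := if k is k'.+1 then schur (schur_iter K k') k' else K.

(** Column [k] is read from the kernel left after [k] eliminations; a zero pivot yields a zero
    column by the convention on division. *)
Definition cholesky_factor K n k := schur_iter K k n k / Num.sqrt (schur_iter K k k k).

Lemma psd_schur_iter K k : psd_kernel K -> psd_kernel (schur_iter K k).
Proof. by move=> psdK; elim: k => //= k; exact: psd_schur. Qed.

Lemma schur_iter_eq0 K k n m : psd_kernel K -> (n < k)%N -> schur_iter K k n m = 0.
Proof.
move=> psdK; elim: k n m => // k IH n m; rewrite ltnS leq_eqVlt => /predU1P[->|nk] /=.
  have psdk := psd_schur_iter k psdK; rewrite /schur.
  have [K0|K0] := eqVneq (schur_iter K k k k) 0.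
    by rewrite psdk.1 (psd_kernel_eq0 m psdk K0) mulr0 mul0r subrr.
  by rewrite mulrAC divff// mul1r psdk.1 subrr.
by rewrite /schur !(IH n _ nk) !mul0r subrr.
Qed.

Lemma cholesky_factor_eq0 K n k : psd_kernel K -> (n < k)%N -> cholesky_factor K n k = 0.
Proof. by move=> psdK nk; rewrite /cholesky_factor schur_iter_eq0// mul0r. Qed.

(** After [N] eliminations the remainder vanishes in every row of index less than [N], so finitely
    many columns give equality, whatever [m] is. *)
Lemma cholesky K n m N : psd_kernel K -> (n < N)%N ->
  K n m = \sum_(k < N) cholesky_factor K n k * cholesky_factor K m k.
Proof.
move=> psdK nN.
suff : forall N, K n m = \sum_(k < N) cholesky_factor K n k * cholesky_factor K m k + schur_iter K N n m.
  by move=> /(_ N); rewrite schur_iter_eq0// addr0.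
elim=> [|k IH]; first by rewrite big_ord0 add0r.
rewrite big_ord_recr/= IH -addrA; congr (_ + _); rewrite /schur /cholesky_factor.
have d0 := psd_kernel_diag k (psd_schur_iter k psdK).
by rewrite mulrACA -invfM -expr2 sqr_sqrtr// addrC subrK.
Qed.

End cholesky.

Section gaussian_family.
Context (R : realType) (I : countType) (i0 : I) (C : I -> I -> R).
Hypothesis psdC : psd_kernel C.
Notation P := (@unit_measure R).

(** An enumeration of [I] that repeats [i0] at numbers coding nothing; kernels tolerate such
    repetitions. *)
Let at_index n := odflt i0 (unpickle n).
Let K n m := C (at_index n) (at_index m).

Let psdK : psd_kernel K.
Proof.
split=> [n m|s]; first exact: psdC.1.
have := psdC.2 [seq (u.1, at_index u.2) | u <- s]; rewrite big_map.
by under eq_bigr do rewrite big_map.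
Qed.

Let coef (i : I) : nat -> R := cholesky_factor K (pickle i).

(** The factor is triangular, so the columns up to [pickle i] already carry the whole row. *)
Definition gaussian_family (i : I) : measurableTypeR R -> R := white_sum (pickle i).+1 (coef i).

Lemma gaussian_family_white_sum i N u : (pickle i < N)%N ->
  gaussian_family i u = white_sum N (coef i) u.
Proof.
move=> iN; rewrite /gaussian_family /white_sum.
rewrite (big_ord_widen _ (fun k => coef i k * white k u) iN) big_mkcond/=.
by apply: eq_bigr => k _; case: ifPn => //; rewrite -leqNgt => ik; rewrite /coef cholesky_factor_eq0 ?mul0r.
Qed.

Lemma coef_covariance i i' N : (pickle i < N)%N ->
  \sum_(k < N) coef i k * coef i' k = C i i'.
Proof.
move=> iN; rewrite -(cholesky _ psdK iN) /K /at_index !pickleK//.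
Qed.

Lemma gaussian_family_covariance i i' :
  ('E_P[gaussian_family i \* gaussian_family i'] = (C i i')%:E)%E.
Proof.
pose N := (maxn (pickle i) (pickle i')).+1.
have iN : (pickle i < N)%N by rewrite ltnS leq_maxl.
have i'N : (pickle i' < N)%N by rewrite ltnS leq_maxr.
rewrite -(coef_covariance i' iN) -white_sum_covariance; congr ('E_P[_])%E.
by apply/funext => u; rewrite /= !(@gaussian_family_white_sum _ N).
Qed.

(** All indices fit under a common [N], so a combination is again a white sum, whose law depends on
    [C] only. *)
Lemma gaussian_family_combination (J : finType) (x : J -> I) (a : J -> R) :
  exists N c, (forall u, \sum_j a j * gaussian_family (x j) u = white_sum N c u) /\
    sumsq N c = \sum_j \sum_j' a j * a j' * C (x j) (x j').
Proof.
pose N := (\max_j pickle (x j)).+1.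
have xN j : (pickle (x j) < N)%N by rewrite ltnS (leq_bigmax j).
exists N, (fun k => \sum_j a j * coef (x j) k); split=> [u|].
  rewrite /white_sum; under [RHS]eq_bigr do rewrite mulr_suml.
  rewrite exchange_big/=; apply: eq_bigr => j _.
  by rewrite (gaussian_family_white_sum u (xN j)) /white_sum mulr_sumr; apply: eq_bigr => k _; rewrite mulrA.
rewrite /sumsq.
under eq_bigr do rewrite expr2 mulr_suml.
rewrite exchange_big/=; apply: eq_bigr => j _.
under eq_bigr do rewrite mulr_sumr.
rewrite exchange_big/=; apply: eq_bigr => j' _.
rewrite -(coef_covariance (x j') (xN j)) mulr_sumr; apply: eq_bigr => k _; ring.
Qed.

Lemma gaussian_family_vector (J : finType) (x : J -> I) :
  gaussian_vector P (fun j => gaussian_family (x j)).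
Proof.
move=> a; have [N [c [e _]]] := gaussian_family_combination x a.
by rewrite (_ : (fun w => _) = white_sum N c); [exact: white_sum_gaussian|apply/funext].
Qed.

Lemma integral_gaussian_family (J : finType) (x : J -> I) (a : J -> R) (g : R -> R) :
  bounded_measurable g ->
  \int[P]_u g (\sum_j a j * gaussian_family (x j) u) =
  \int[normal_prob 0 1]_z
    g (Num.sqrt (\sum_j \sum_j' a j * a j' * C (x j) (x j')) * z).
Proof.
move=> bg; have [N [c [e <-]]] := gaussian_family_combination x a.
by rewrite -bounded_integral_white_sum//; apply: eq_Rintegral => u _; rewrite e.
Qed.

End gaussian_family.

(** * The field with a given spectral measure *)

Section spectral_covariance.
Context (R : realType) (nu d : nat).
Variable G : 'I_d -> 'I_d -> complex_measure (torus R nu) R.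

Definition spectral_covariance (k k' : 'rV[int]_nu * 'I_d) : R :=
  complex.Re (complex_integral (G k.2 k'.2) (torus_char (k.1 - k'.1))).

(** Under reflection the real charge is symmetric and the imaginary one antisymmetric; the sine
    integral of the former and the cosine integral of the latter, which make up the imaginary part,
    are their own opposites. *)
Lemma even_spectral_covariance k k' : even_measure G ->
  complex_integral (G k.2 k'.2) (torus_char (k.1 - k'.1)) = (spectral_covariance k k')%:C.
Proof.
case: k k' => [p j] [q j'] Geven; rewrite /spectral_covariance/=; set r := p - q.
have mopp A : measurable A -> measurable (@torus_opp R nu @^-1` A).
  by move=> mA; rewrite -[X in measurable X]setTI; exact: measurable_torus_opp.
have fineI (y z : \bar R) : y \is a fin_num -> z \is a fin_num -> fine y = fine z -> y = z.
  by move=> fy fz e; rewrite -(fineK fy) e fineK.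
have reE A : measurable A -> image_charge (@measurable_torus_opp R nu) (cm_re (G j j')) A = cm_re (G j j') A.
  move=> mA; have [h _] := Geven j j' A mA; rewrite torus_opp_image in h.
  by apply: fineI => //; rewrite fin_num_measure//; exact: mopp.
have imE A : measurable A -> image_charge (@measurable_torus_opp R nu) (cm_im (G j j')) A = copp (cm_im (G j j')) A.
  move=> mA; have [_ h] := Geven j j' A mA; rewrite torus_opp_image -fineN in h.
  by apply: fineI => //; rewrite ?fin_numN fin_num_measure//; exact: mopp.
have [bR bI] := bounded_complex_char R r.
have [_ h1] := charge_integral_opp (cm_re (G j j')) r.
rewrite (eq_charge_integral bI reE) in h1.
have [h2 _] := charge_integral_opp (cm_im (G j j')) r.
rewrite (eq_charge_integral bR imE) charge_integral_copp// in h2.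
rewrite [LHS]/complex_integral/=; congr (_ +i* _); lra.
Qed.

(** Weights carried by the same index are added up, which turns the list into a vector. *)
Lemma complex_psd_pullback (A : 'I_d -> 'I_d -> R[i]) :
  (forall v : 'I_d -> R[i], 0 <= \sum_j \sum_j' v j * conjc (v j') * A j j') ->
  forall s : seq (R[i] * 'I_d),
  0 <= \sum_(u <- s) \sum_(w <- s) u.1 * conjc w.1 * A u.2 w.2.
Proof.
move=> A0 s; have := A0 (fun j => \sum_(u <- s | u.2 == j) u.1); congr (0 <= _).
rewrite [RHS](partition_big (fun u => u.2) predT)//=; apply: eq_bigr => j _.
under [RHS]eq_bigr => u _ do rewrite (partition_big (fun w => w.2) predT)//=.
rewrite [RHS]exchange_big/=; apply: eq_bigr => j' _.
rewrite rmorph_sum big_distrlr/= mulr_suml; apply: eq_bigr => u /eqP <-.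
by rewrite mulr_suml; apply: eq_bigr => w /eqP <-.
Qed.

Variable mu : {finite_measure set (torus R nu) -> \bar R}.
Hypothesis dom : forall j j', cm_dominated (G j j') mu.
Hypothesis psdG : {ae mu, forall x, psdmx (RN_matrix G mu x)}.

Let F (k k' : 'rV[int]_nu * 'I_d) x : R :=
  complex.Re (torus_char (k.1 - k'.1) x * cm_RN (G k.2 k'.2) mu x).

Let FE k k' : F k k' = fun x =>
  complex.Re (torus_char (k.1 - k'.1) x) * fine (Radon_Nikodym (cm_re (G k.2 k'.2)) mu x) -
  complex.Im (torus_char (k.1 - k'.1) x) * fine (Radon_Nikodym (cm_im (G k.2 k'.2)) mu x).
Proof. by apply/funext => x; rewrite /F /cm_RN; case: (torus_char _ x). Qed.

Let integrable_RN (f : torus R nu -> R) (n : {charge set (torus R nu) -> \bar R}) :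
  n `<< mu -> bounded_measurable f ->
  mu.-integrable setT (EFin \o (fun x => f x * fine (Radon_Nikodym n mu x))).
Proof.
move=> dn bf; have := integrable_RN_bounded dn bf; congr integrable.
by apply/funext => x /=; rewrite EFinM fineK// Radon_Nikodym_fin_num.
Qed.

Let integrable_F k k' : mu.-integrable setT (EFin \o F k k').
Proof.
have [bR bI] := bounded_complex_char R (k.1 - k'.1).
have [d1 d2] := dom k.2 k'.2.
by rewrite FE; exact: integrableB (integrable_RN d1 bR) (integrable_RN d2 bI).
Qed.

Let spectral_covarianceE k k' : spectral_covariance k k' = \int[mu]_x F k k' x.
Proof.
have [bR bI] := bounded_complex_char R (k.1 - k'.1).
have [d1 d2] := dom k.2 k'.2.
rewrite FE RintegralB//; [|exact: integrable_RN|exact: integrable_RN].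
rewrite -(charge_integral_RN d1 bR) -(charge_integral_RN d2 bI)//.
Qed.

Let psd_ae : {ae mu, forall x,
  (forall j j', cm_RN (G j' j) mu x = conjc (cm_RN (G j j') mu x)) /\
  (forall v : 'I_d -> R[i], 0 <= \sum_j \sum_j' v j * conjc (v j') * cm_RN (G j j') mu x)}.
Proof.
apply: filterS psdG => x [/is_hermitianmxP herm pos]; split=> [j j'|v].
  rewrite expr0 scale1r in herm.
  by have := congr1 (fun M : 'M[R[i]]_d => M j' j) herm; rewrite !mxE.
have := pos (\row_j v j); congr (0 <= _).
rewrite mxE exchange_big/=; apply: eq_bigr => j' _.
rewrite mxE mulr_suml; apply: eq_bigr => j _; rewrite !mxE.
by rewrite -[Num.conj _]/(conjc _); ring.
Qed.

Let torus_charB p q (x : torus R nu) : torus_char (p - q) x = torus_char p x * conjc (torus_char q x).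
Proof.
rewrite -torus_charN !torus_char_cis -cisD -big_split/=; congr cis.
by apply: eq_bigr => k _; rewrite !mxE intrD mulrDl.
Qed.

(** As [torus_char (p - q)] is [torus_char p] times the conjugate of [torus_char q], the integrand
    at almost every [x] is the Hermitian form of the densities with the real weights multiplied by
    characters. *)
Lemma spectral_covariance_psd : psd_kernel spectral_covariance.
Proof.
split=> [k k'|s].
  rewrite !spectral_covarianceE /Rintegral; congr fine; apply: ae_eq_integral => //.
  - exact: measurable_int (integrable_F k k').
  - exact: measurable_int (integrable_F k' k).
  apply: filterS psd_ae => x [herm _] _; congr EFin; rewrite /F herm !torus_charB.
  case: (torus_char _ x) => a b; case: (torus_char _ x) => a' b'; case: (cm_RN _ _ _) => a'' b'' /=; ring.
pose H (k : (R * ('rV[int]_nu * 'I_d)) * (R * ('rV[int]_nu * 'I_d))) x : R := k.1.1 * k.2.1 * F k.1.2 k.2.2 x.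
have iH k : mu.-integrable setT (EFin \o H k).
  rewrite (_ : _ \o _ = fun x => ((k.1.1 * k.2.1)%:E * (EFin \o F k.1.2 k.2.2) x)%E)//.
  by apply: integrableZl => //; exact: integrable_F.
pose S := [seq (u, v) | u <- s, v <- s].
have -> : \sum_(u <- s) \sum_(v <- s) u.1 * v.1 * spectral_covariance u.2 v.2 = \int[mu]_x (\sum_(k <- S) H k x).
  rewrite Rintegral_sum// /S big_allpairs; apply: eq_bigr => u _; apply: eq_bigr => v _ /=.
  by rewrite spectral_covarianceE -RintegralZl//; exact: integrable_F.
rewrite /Rintegral fine_ge0//.
have mS : measurable_fun setT (fun x => (\sum_(k <- S) H k x)%:E).
  apply/measurable_EFinP; apply: measurable_sum => k; apply/measurable_EFinP.
  exact: measurable_int (iH k).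
(* The integrand is nonnegative only almost everywhere; passing to its absolute value makes the
   integral visibly nonnegative. *)
rewrite (@ae_eq_integral _ _ _ mu setT (fun x => `|(\sum_(k <- S) H k x)%:E|)%E)//.
- by apply: integral_ge0.
- exact: measurableT_comp.
apply: filterS psd_ae => x [_ pos] _; rewrite gee0_abs// lee_fin.
have := complex_psd_pullback pos [seq ((u.1)%:C * torus_char u.2.1 x, u.2.2) | u <- s].
rewrite complex_ge0 => /andP[_]; congr (0 <= _).
rewrite /S big_allpairs big_map Re_sum; apply: eq_bigr => u _.
rewrite big_map Re_sum; apply: eq_bigr => v _; rewrite /H /F torus_charB.
rewrite -[LHS]/(complex.Re (((u.1)%:C * torus_char u.2.1 x) * conjc ((v.1)%:C * torus_char v.2.1 x) *
  cm_RN (G u.2.2 v.2.2) mu x)).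
rewrite -[RHS]/(u.1 * v.1 * complex.Re (torus_char u.2.1 x * conjc (torus_char v.2.1 x) *
  cm_RN (G u.2.2 v.2.2) mu x)).
move: (torus_char u.2.1 x) (torus_char v.2.1 x) (cm_RN _ _ _) => [a b] [a' b'] [a'' b''] /=; ring.
Qed.

End spectral_covariance.

(** * Laws of real random tuples *)

Section sine_limit.
Context (R : realType).

(** By the mean value theorem the error is [(cos c - 1) * h] with [c] between 0 and [h], and cosine
    is 1-Lipschitz. *)
Lemma sin_sub_id_bound (h : R) : `|sin h - h| <= h ^+ 2.
Proof.
wlog h0 : h / 0 < h => [hyp|].
  have [->|] := eqVneq h 0; first by rewrite sin0 subrr normr0 sqr_ge0.
  rewrite neq_lt => /orP[hn|]; last exact: hyp.
  have := hyp (- h); rewrite oppr_gt0 => /(_ hn).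
  by rewrite sinN sqrrN -opprD normrN.
have [c /= + e] := @MVT R (@sin R) (@cos R) 0 h h0
  (fun c _ => is_derive_sin c) (continuous_subspaceT (@continuous_sin R)).
rewrite in_itv/= => /andP[c0 ch].
rewrite sin0 !subr0 in e; rewrite e -[X in _ - X]mul1r -mulrBl normrM expr2 (gtr0_norm h0).
apply: ler_wpM2r; first exact: ltW.
by rewrite -cos0 (le_trans (cos_lipschitz _ _))// subr0 gtr0_norm// ltW.
Qed.

Lemma cvg_scaled_sin (y : R) : n.+1%:R * sin (n.+1%:R^-1 * y) @[n --> \oo] --> y.
Proof.
have bnd (n : nat) : `|n.+1%:R * sin (n.+1%:R^-1 * y) - y| <= y ^+ 2 * harmonic n.
  have n0 : 0 < n.+1%:R :> R by rewrite ltr0n.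
  have n1 : n.+1%:R != 0 :> R by rewrite gt_eqF.
  have -> : n.+1%:R * sin (n.+1%:R^-1 * y) - y = n.+1%:R * (sin (n.+1%:R^-1 * y) - n.+1%:R^-1 * y).
    by rewrite mulrBr mulVKf.
  rewrite normrM gtr0_norm// (le_trans (ler_wpM2l (ltW n0) (sin_sub_id_bound _)))//.
  rewrite /harmonic/=; move: (n.+1%:R : R) n1 => x x0.
  by rewrite le_eqVlt; apply/predU1P; left; field.
have c0 : y ^+ 2 * harmonic n @[n --> \oo] --> (0 : R).
  rewrite -(mulr0 (y ^+ 2)); apply: cvgM; first exact: cvg_cst.
  exact: cvg_harmonic.
apply/cvgrPdist_le => e e0.
have /cvgrPdist_le /(_ e e0) := c0; apply: filterS => n.
rewrite sub0r normrN distrC => h; apply: le_trans (bnd n) _.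
exact: le_trans (ler_norm _) h.
Qed.

(** One sine does not determine a real number, but [n sin (y / n)] tends to [y]; so real frequencies
    recover the coordinates where the torus used a bounded angle. *)
Lemma measurable_fun_sin_scaled d (T : measurableType d) (f : T -> R) :
  (forall n : nat, measurable_fun setT (fun x => sin (n.+1%:R^-1 * f x))) -> measurable_fun setT f.
Proof.
move=> mf; apply: (@measurable_fun_cvg _ _ _ setT (fun n x => n.+1%:R * sin (n.+1%:R^-1 * f x))).
- by move=> n; apply: measurable_funM => //; exact: mf.
- by move=> x _; exact: cvg_scaled_sin.
Qed.

Lemma tuple_measure_eq k d (m1 m2 : {finite_measure set (k.-tuple (d.-tuple R)) -> \bar R}) :
  let phi (a : 'I_k * 'I_d -> R) (x : k.-tuple (d.-tuple R)) :=
    \sum_(ij : 'I_k * 'I_d) a ij * tnth (tnth x ij.1) ij.2 in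
  (forall a, \int[m1]_x cos (phi a x) = \int[m2]_x cos (phi a x)) ->
  (forall a, \int[m1]_x sin (phi a x) = \int[m2]_x sin (phi a x)) ->
  forall B, measurable B -> m1 B = m2 B.
Proof.
move=> phi eC eS B mB.
have phi0 x : phi (fun=> 0) x = 0 by rewrite /phi big1// => ij _; rewrite mul0r.
have phiD a b x : phi (fun ij => a ij + b ij) x = phi a x + phi b x.
  by rewrite -big_split/=; apply: eq_bigr => ij _; rewrite mulrDl.
have phiB a b x : phi (fun ij => a ij - b ij) x = phi a x - phi b x.
  by rewrite -sumrB; apply: eq_bigr => ij _; rewrite mulrBl.
have mphi a : measurable_fun setT (phi a).
  apply: measurable_sum => ij; apply: measurable_funM => //.
  apply: (measurableT_comp (@measurable_tnth _ _ _ _)); exact: measurable_tnth.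
apply: (@trig_measure_eq _ _ _ _ phi (fun a b ij => a ij + b ij)
  (fun a b ij => a ij - b ij) (fun=> 0)) => //.
set D := [set _ | _ in _ & _ in _].
have mid : measurable_fun setT (id : g_sigma_algebraType D -> k.-tuple (d.-tuple R)).
  apply/measurable_fun_tnthP => i; apply/measurable_fun_tnthP => j.
  apply: measurable_fun_sin_scaled => n.
  pose a (ij : 'I_k * 'I_d) : R := if ij == (i, j) then n.+1%:R^-1 else 0.
  have := trig_generated_sin (phi := phi) a; congr measurable_fun; apply/funext => x.
  rewrite /phi (bigD1 (i, j))//= /a eqxx big1 ?addr0// => ij /negbTE ->.
  by rewrite mul0r.
by have := mid measurableT B mB; rewrite setTI.
Qed.

End sine_limit.

Section gaussian_field.
Context (R : realType) (nu d : nat).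
Notation I := ('rV[int]_nu * 'I_d)%type.
Variables (i0 : I) (C : I -> I -> R).

Lemma measurable_gaussian_family (i : I) : measurable_fun setT (gaussian_family i0 C i).
Proof. exact: measurable_white_sum. Qed.

HB.instance Definition _ i := isMeasurableFun.Build _ _ _ _
  (gaussian_family i0 C i) (measurable_gaussian_family i).

Definition gaussian_field_of (p : 'rV[int]_nu) (j : 'I_d) : {RV (@unit_measure R) >-> R} :=
  gaussian_family i0 C (p, j).

Hypothesis psdC : psd_kernel C.
Hypothesis C_shift : forall p q m j j', C (p + m, j) (q + m, j') = C (p, j) (q, j').

Lemma gaussian_field_of_stationary : stationary gaussian_field_of.
Proof.
move=> m k p B mB.
have ms (q : k.-tuple 'rV[int]_nu) : measurable_fun setT (sample gaussian_field_of q).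
  apply/measurable_fun_tnthP => i; apply/measurable_fun_tnthP => j.
  rewrite (_ : _ \o _ = gaussian_family i0 C (tnth q i, j)); first exact: measurable_gaussian_family.
  by apply/funext => u /=; rewrite /sample !tnth_mktuple.
suff : forall B, measurable B -> image_measure (ms [tuple tnth p i + m | i < k]) (@unit_measure R) B =
    image_measure (ms p) (@unit_measure R) B by move=> /(_ B mB).
(* [g] stands for cosine and sine. Each integral is that of [g] at a centred normal variable whose
   variance is a quadratic form in [C], unchanged by the shift. *)
have key (g : R -> R) (a : 'I_k * 'I_d -> R) : bounded_measurable g ->
    let f (x : k.-tuple (d.-tuple R)) := g (\sum_(ij : 'I_k * 'I_d) a ij * tnth (tnth x ij.1) ij.2) in
    \int[image_measure (ms [tuple tnth p i + m | i < k]) (@unit_measure R)]_x f x =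
    \int[image_measure (ms p) (@unit_measure R)]_x f x.
  move=> bg f; have bf : bounded_measurable f.
    split; last by have [_ [M hM]] := bg; exists M => x; exact: hM.
    apply: (measurableT_comp bg.1); apply: measurable_sum => ij; apply: measurable_funM => //.
    by apply: (measurableT_comp (@measurable_tnth _ _ _ _)); exact: measurable_tnth.
  rewrite !Rintegral_image_measure//.
  have gE (q : k.-tuple 'rV[int]_nu) : \int[@unit_measure R]_u f (sample gaussian_field_of q u) =
    \int[normal_prob 0 1]_z
      g (Num.sqrt (\sum_(ij : 'I_k * 'I_d) \sum_(ij' : 'I_k * 'I_d) a ij * a ij' * C (tnth q ij.1, ij.2) (tnth q ij'.1, ij'.2)) * z).
    rewrite -(integral_gaussian_family i0 psdC (fun ij : 'I_k * 'I_d => (tnth q ij.1, ij.2)))//.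
    apply: eq_Rintegral => u _; rewrite /f; congr g; apply: eq_bigr => ij _.
    by rewrite /sample !tnth_mktuple.
  rewrite !gE; apply: eq_Rintegral => z _; congr (g (Num.sqrt _ * z)).
  by apply: eq_bigr => ij _; apply: eq_bigr => ij' _; rewrite !tnth_mktuple C_shift.
apply: tuple_measure_eq => a; apply: key.
- exact: (bounded_measurable_cos (phi := fun (_ : unit) (x : R) => x)).
- exact: (bounded_measurable_sin (phi := fun (_ : unit) (x : R) => x)).
Qed.

End gaussian_field.

Theorem theorem2p2 (R : realType) (d nu : nat) (d_gt0 : (0 < d)%N)
    (nu_gt0 : (0 < nu)%N) :
  (forall (dO : measure_display) (Omega : measurableType dO)
      (P : probability Omega R)
      (X : 'rV[int]_nu -> 'I_d -> {RV P >-> R}),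
    finite_second_moments X -> stationary X ->
    (forall p j, 'E_P[X p j] = 0)%E ->
    let r j j' p := fine 'E_P[(X 0 j : Omega -> R) \* X p j'] in
    exists G : 'I_d -> 'I_d -> complex_measure (torus R nu) R,
      [/\ (forall j j', finite_total_variation (G j j')) /\
          (forall j j' p,
             (r j j' p)%:C = complex_integral (G j j') (torus_char p)),
          forall j j' (H : complex_measure (torus R nu) R),
            finite_total_variation H ->
            (forall p, (r j j' p)%:C = complex_integral H (torus_char p)) ->
            forall A : set (torus R nu), measurable A -> H A = G j j' A,
          hermitian_measure G,
          even_measure G &
          (exists mu : {finite_measure set (torus R nu) -> \bar R},
             forall j j', cm_dominated (G j j') mu) /\
          (forall mu : {finite_measure set (torus R nu) -> \bar R},
             (forall j j', cm_dominated (G j j') mu) ->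
             {ae mu, forall x, psdmx (RN_matrix G mu x)})])
  /\
  (forall G : 'I_d -> 'I_d -> complex_measure (torus R nu) R,
    (forall j j', finite_total_variation (G j j')) ->
    positive_semidefinite_measure G -> even_measure G ->
    exists (dO : measure_display) (Omega : measurableType dO)
      (P : probability Omega R)
      (X : 'rV[int]_nu -> 'I_d -> {RV P >-> R}),
      [/\ finite_second_moments X, stationary X, gaussian_field X,
          (forall p j, 'E_P[X p j] = 0)%E &
          forall j j' p q,
            (fine 'E_P[(X p j : Omega -> R) \* X q j'])%:C =
            complex_integral (G j j') (torus_char (p - q))]).
Proof.
split=> [dO Omega P X X2 Xstat _|G _ [mu [dom psdG]] Geven].
  exact: spectral_representation.
(* Positivity of [d] makes the index set nonempty; [i0] is the default in its enumeration. *)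
pose i0 : 'rV[int]_nu * 'I_d := (0, Ordinal d_gt0).
have psdC := spectral_covariance_psd dom psdG.
have C_shift p q m j j' : spectral_covariance G (p + m, j) (q + m, j') =
    spectral_covariance G (p, j) (q, j').
  by rewrite /spectral_covariance/= opprD addrACA subrr addr0.
exists _, (measurableTypeR R), (@unit_measure R), (gaussian_field_of i0 (spectral_covariance G)); split.
- by move=> p j; exact: white_sum_Lfun.
- exact: gaussian_field_of_stationary.
- move=> k p; exact: (gaussian_family_vector i0 psdC (fun ij : 'I_k * 'I_d => (tnth p ij.1, ij.2))).
- by move=> p j; exact: white_sum_expectation.
- move=> j j' p q; rewrite (gaussian_family_covariance i0 psdC (p, j) (q, j')).
  by rewrite (even_spectral_covariance (p, j) (q, j') Geven).
Qed.
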